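(* Let $K:\mathcal{X}\to\mathcal{Y}$ be a compact linear operator between infinite-dimensional real Hilbert spaces with singular value decomposition $(\sigma_j,v_j,u_j)_{j\in\mathbb{N}}$. Assume that there exist $q>0$ and $\eta>1$ such that $\sigma_j^2=j^{-q}$ and $(x^\dagger,v_j)=j^{-\eta/2}X_j$ for all $j\in\mathbb{N}$, where the $(X_j)_{j\in\mathbb{N}}$ are either deterministic and all equal to $1$, or i.i.d. standard Gaussian. Moreover, assume that $Z$ is Gaussian white noise and $y^\delta=y^\dagger+\delta Z$ with $y^\dagger=Kx^\dagger$. Then for all $0<\delta\le1$ $$\mathbb{P}\left(\left\|x^\delta_{k^\delta_{\rm HD}}-x^\dagger\right\|\le C_{q,\eta}\min_{k\in\mathbb{N}}\left\|x_k^\delta-x^\dagger\right\|\right)\ge1-4\exp\left(-p_{q,\eta}\,\delta^{\frac{2(1-\eta)}{(q+\eta-1)(q+\eta)}}\right),$$ where, with $\varepsilon:=\frac14$, $\varepsilon':=1-\sqrt{1-3\varepsilon}=\frac12$, $$A:=\max\left(\left(\frac{2(1+\varepsilon')}{1-\varepsilon'}\right)^{\frac2{q+\eta}},\left(\frac{4\sqrt3(1+\varepsilon')}{1-\varepsilon'}\right)^{\frac2q}\right),\qquad a:=\left(2^{\frac{q+\eta}2}\,\frac{3\sqrt2(1+\varepsilon')}{1-\varepsilon'}\right)^{\frac{2}{1-q-\eta}},$$ the constants are $$C_{q,\eta}:=(1+\varepsilon')\left(\sqrt{A^{1+q}}+a^{-\frac\eta2}\sqrt{\frac{\eta}{\eta-1}}\right)\sqrt{\max\left(1,(\eta-1)4^{\eta-1}\right)},\qquad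 p_{q,\eta}:=\frac{a\left(\varepsilon-\log(1+\varepsilon)\right)}2.$$
   Context: $\mathbb{N}=\{1,2,\dots\}$. Singular value decomposition: $(v_j)_{j\in\mathbb{N}}$ is an orthonormal basis of $\mathcal{N}(K)^\perp\subset\mathcal{X}$, $(u_j)_{j\in\mathbb{N}}$ is an orthonormal basis of $\overline{\mathcal{R}(K)}\subset\mathcal{Y}$, $\sigma_1\ge\sigma_2\ge\dots\searrow0$, $Kv_j=\sigma_ju_j$ and $K^*u_j=\sigma_jv_j$. The solution $x^\dagger=\sum_j (x^\dagger,v_j)v_j\in\mathcal{N}(K)^\perp$ is the minimum-norm solution of $Kx=y^\dagger$ (it is random, and almost surely in $\mathcal{X}$, in the Gaussian case). Gaussian white noise: $Z:\mathcal{Y}\to L^2(\Omega,\mathbb{R})$ is a bounded linear map, where $(\Omega,\mathcal{F},\mathbb{P})$ is a probability space and $(Z,y):=Z(y)$, with $\mathbb{E}[(Z,y)]=0$ and $\mathbb{E}[(Z,y)(Z,y')]=(y,y')$ for all $y,y'\in\mathcal{Y}$, such that $(Z,y/\|y\|)$ is standard Gaussian for every $y\ne0$ (hence the $(Z,u_j)$ are i.i.d. standard Gaussian). The data is understood weakly: $(y^\delta,y):=(y^\dagger,y)+\delta(Z,y)$ for $y\in\mathcal{Y}$. Spectral cut-off: $x_k^\delta:=\sum_{j=1}^k\frac{(y^\delta,u_j)}{\sigma_j}v_j$. Modified heuristic discrepancy principle: for $m\in\mathbb{N}$, $m\ge2$, $$\Psi_m(k,y^\delta):=\frac1{\sigma_k}\sqrt{\sum_{j=k}^m(y^\delta,u_j)^2},\qquad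 k^\delta_{\rm HD}(m):=\arg\min_{k\in\mathbb{N},\,k\le m/2}\Psi_m(k,y^\delta),\qquad k^\delta_{\rm HD}:=\max_{m}k^\delta_{\rm HD}(m).$$ Ties in the $\arg\min$ are broken by any fixed measurable rule (e.g. the smallest minimiser). The event in the claim includes that $k^\delta_{\rm HD}$ is finite. *)

(* Defs.v *)
From HB Require Import structures.
From mathcomp Require Import all_boot all_order all_algebra finmap.
From mathcomp Require Import all_classical all_reals all_analysis.

Set Implicit Arguments.
Unset Strict Implicit.
Unset Printing Implicit Defensive.

Import Order.TTheory GRing.Theory Num.Theory.
Import numFieldNormedType.Exports.

Local Open Scope classical_set_scope.
Local Open Scope ring_scope.

(* Real Hilbert spaces: the norm and its completeness are those of the
   underlying [completeNormedModType]. *)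
HB.mixin Record isHilbert (R : realType) V of CompleteNormedModule R V := {
  inner : {dot V for idfun};
  innerE : forall x : V, inner x x = `|x| ^+ 2
}.

#[short(type="hilbertType")]
HB.structure Definition Hilbert (R : realType) :=
  {V of CompleteNormedModule R V & isHilbert R V}.

Notation "''[' x , y ]" := (inner x y) : ring_scope.

Definition infinite_dimensional (R : realType) (V : hilbertType R) : Prop :=
  ~ exists n (b : 'I_n -> V),
      forall x : V, exists c : 'I_n -> R, x = \sum_(i < n) c i *: b i.

Definition compact_operator (R : realType) (X Y : hilbertType R) (K : X -> Y)
    : Prop :=
  precompact (K @` [set x | `|x| <= 1]).

Definition is_adjoint (R : realType) (X Y : hilbertType R)
    (K : X -> Y) (Kadj : Y -> X) : Prop :=
  forall x y, '[K x, y] = '[x, Kadj y].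

(* N(K)^\perp *)
Definition ker_perp (R : realType) (X Y : hilbertType R) (K : X -> Y) : set X :=
  [set x | forall z, K z = 0 -> '[x, z] = 0].

(* Throughout, sequences indexed by {1, 2, ...} are functions on [nat] whose
   value at 0 is irrelevant. *)
Definition orthonormal_basis (R : realType) (V : hilbertType R) (M : set V)
    (e : nat -> V) : Prop :=
  [/\ forall j, (0 < j)%N -> M (e j),
      forall i j, (0 < i)%N -> (0 < j)%N -> '[e i, e j] = (i == j)%:R
    & forall x, M x ->
        (fun n => \sum_(1 <= j < n.+1) '[x, e j] *: e j) @ \oo --> x].

Definition is_svd (R : realType) (X Y : hilbertType R)
    (K : X -> Y) (Kadj : Y -> X)
    (sigma : nat -> R) (v : nat -> X) (u : nat -> Y) : Prop :=
  [/\ orthonormal_basis (ker_perp K) v /\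
        orthonormal_basis (closure (range K)) u,
      forall i j, (0 < i <= j)%N -> sigma j <= sigma i,
      sigma @ \oo --> 0,
      forall j, (0 < j)%N -> K (v j) = sigma j *: u j
    & forall j, (0 < j)%N -> Kadj (u j) = sigma j *: v j].

Section probability.
Context {R : realType} {d : measure_display} {T : measurableType d}.
Variable P : probability T R.

Definition standard_gaussian (X : {RV P >-> R}) : Prop :=
  forall B : set R, measurable B -> distribution P X B = normal_prob 0 1 B.

Definition mutually_independent (D : set nat) (X : nat -> {RV P >-> R}) : Prop :=
  forall (J : {fset nat}) (B : nat -> set R), [set` J] `<=` D ->
    (forall j, j \in J -> measurable (B j)) ->
    P (\bigcap_(j in [set` J]) (X j @^-1` B j)) =
    (\prod_(j <- J) P (X j @^-1` B j))%E.

Definition iid_standard_gaussian (D : set nat) (X : nat -> {RV P >-> R}) : Prop :=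
  mutually_independent D X /\ forall j, D j -> standard_gaussian (X j).

(* [Z y] is a representative of the class of [(Z, y)] in L^2(P), so linearity
   holds almost surely; [wn_bounded] is boundedness Y -> L^2(P). *)
Record gaussian_white_noise (Y : hilbertType R) (Z : Y -> {RV P >-> R})
    : Prop := {
  wn_linear : forall (a : R) (y y' : Y),
    {ae P, forall w, Z (a *: y + y') w = a * Z y w + Z y' w};
  wn_bounded : exists M : R, forall y,
    ('N[P]_2%:E[EFin \o Z y] <= (M * `|y|)%:E)%E;
  wn_mean : forall y, ('E_P[Z y] = 0)%E;
  wn_cov : forall y y', ('E_P[(fun w => Z y w * Z y' w)%R] = '[y, y']%R%:E)%E;
  wn_gaussian : forall y, y != 0 -> standard_gaussian (Z (`|y|^-1 *: y))
}.

End probability.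

(* The data is only given weakly, as the functional y |-> (y^delta, y). *)
Definition noisy_data (R : realType) (T : Type) (Y : hilbertType R)
    (ydag : T -> Y) (delta : R) (Z : Y -> T -> R) (w : T) : Y -> R :=
  fun y => '[ydag w, y] + delta * Z y w.

Definition spectral_cutoff (R : realType) (X Y : hilbertType R)
    (sigma : nat -> R) (v : nat -> X) (u : nat -> Y) (ydelta : Y -> R)
    (k : nat) : X :=
  \sum_(1 <= j < k.+1) (ydelta (u j) / sigma j) *: v j.

Definition Psi (R : realType) (Y : hilbertType R)
    (sigma : nat -> R) (u : nat -> Y) (m k : nat) (ydelta : Y -> R) : R :=
  (sigma k)^-1 * Num.sqrt (\sum_(k <= j < m.+1) ydelta (u j) ^+ 2).

Definition is_argmin (R : realType) (D : set nat) (f : nat -> R) (k : nat)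
    : Prop :=
  D k /\ forall l, D l -> f k <= f l.

Definition is_max (A : set nat) (k : nat) : Prop :=
  A k /\ forall l, A l -> (l <= k)%N.

(* [kHDm m w] is a minimiser of Psi_m( . , y^delta(w)) over 1 <= k <= m/2;
   the only constraint on how ties are broken is measurability. *)
Definition heuristic_rule (R : realType) (d : measure_display)
    (T : measurableType d) (Y : hilbertType R)
    (sigma : nat -> R) (u : nat -> Y) (ydelta : T -> Y -> R)
    (kHDm : nat -> T -> nat) : Prop :=
  forall m, (2 <= m)%N ->
    measurable_fun [set: T] (kHDm m) /\
    forall w, is_argmin [set k | (1 <= k)%N /\ (2 * k <= m)%N]
                (fun k => Psi sigma u m k (ydelta w)) (kHDm m w).

Section constants.
Context {R : realType}.
Variables q eta : R.

Definition eps : R := 1 / 4.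
Definition eps' : R := 1 - Num.sqrt (1 - 3 * eps).

Definition constA : R :=
  Num.max
    ((2 * (1 + eps') / (1 - eps')) `^ (2 / (q + eta)))
    ((4 * Num.sqrt 3 * (1 + eps') / (1 - eps')) `^ (2 / q)).

Definition consta : R :=
  (2 `^ ((q + eta) / 2) * (3 * Num.sqrt 2 * (1 + eps') / (1 - eps')))
    `^ (2 / (1 - q - eta)).

Definition constC : R :=
  (1 + eps') *
  (Num.sqrt (constA `^ (1 + q)) +
   consta `^ (- (eta / 2)) * Num.sqrt (eta / (eta - 1))) *
  Num.sqrt (Num.max 1 ((eta - 1) * 4 `^ (eta - 1))).

Definition constp : R := consta * (eps - ln (1 + eps)) / 2.

End constants.

(* Main.v *)
Require Import Defs.
From HB Require Import structures.
From mathcomp Require Import all_boot all_order all_algebra finmap.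
From mathcomp Require Import all_classical all_reals all_analysis.
From mathcomp Require Import measurable_realfun.
From mathcomp Require Import ring lra zify.

Set Implicit Arguments.
Unset Strict Implicit.
Unset Printing Implicit Defensive.

Import Order.TTheory GRing.Theory Num.Theory.
Import numFieldNormedType.Exports.

Local Open Scope classical_set_scope.
Local Open Scope ring_scope.

(* By the singular value decomposition the squared error at level k is
   V k + B k, with V k = delta^2 sum_(j <= k) j^q Z_j^2 increasing in k and
   B k = sum_(j > k) j^(- eta) X_j^2 decreasing in k.  Everything follows from
   the partial sums of X_j^2 and of Z_j^2 being close to their means from some
   index n on, which fails with probability exponentially small in n: a
   supermartingale inequality of Ville is applied to the Chernoff products
   prod_(j <= k) exp (t (X_j^2 - c)).  The variables Z_j = (Z, u_j) are not
   assumed independent; they are uncorrelated and all their linear combinations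
   are Gaussian, so the Laplace transform of (Z_j^2)_j factorises, and this
   determines the joint law.

   On the good event, comparing Psi_m with its value near the balancing scale
   kappa = delta^(- 2 / (q + eta)) bounds every minimiser by a multiple of
   kappa, which controls V.  For m close to 2 c kappa the minimiser is also not
   much smaller than kappa, by Abel summation of the signal part, which
   controls B at the maximal minimiser.  Both are compared with the lower bound
   min (V k, B k) at an index proportional to kappa.

   Writing s = q / (eta - 1) and Lambda = a kappa^((eta - 1) / (q + eta - 1)),
   the crude bound |S_k - k| <= k / 4 for k >= Lambda suffices if s <= 3 / 5;
   for larger s the sums of X_j^2 are controlled up to 1 / (6 (1 + s)) from the
   much larger index Lambda^(1 + s) on. *)

(** The admissible failure probability is 4 exp (- Lambda (1/4 - ln (5/4)) / 2). This fixes Lambda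
    as the first index from which the sums of squares can be controlled, and minimisers below it
    must be excluded through a block of indices above it. If the bound is at least 1 nothing is
    claimed; otherwise Lambda >= 100, which absorbs the rounding of all indices.

    A relative error e in the sums of X_j^2 costs a factor ((1 + e) / (1 - e))^(q + eta - 1) in the
    lower bound for the minimiser. Its exponent is (eta - 1) (1 + s), while C stays bounded as q
    grows; so e has to be of order 1 / (1 + s) when s is large. This sharper control is affordable
    because the minimiser is first shown to exceed Lambda^(1 + s), and the larger starting index
    more than makes up for the factor e^2 in the exponent of the tail bound.

    The factor c is (2 (1 + s))^(- 1 / (q + eta)), so that j^(- q - eta) = 2 (1 + s) delta^2 at j =
    c kappa. *)

(** * Inner products and Pythagoras *)

Section inner_product.
Context {R : realType} {V : hilbertType R}.
Implicit Types x y z : V.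

Lemma innerC x y : '[x, y] = '[y, x].
Proof. by rewrite [LHS]hermC /= expr0 mul1r. Qed.

Lemma innerDl x y z : '[x + y, z] = '[x, z] + '[y, z].
Proof. exact: linearDl. Qed.

Lemma innerZl a x z : '[a *: x, z] = a * '[x, z].
Proof. exact: linearZl_LR. Qed.

Lemma innerDr x y z : '[z, x + y] = '[z, x] + '[z, y].
Proof. by rewrite innerC innerDl !(innerC z). Qed.

Lemma innerZr a x z : '[z, a *: x] = a * '[z, x].
Proof. by rewrite innerC innerZl (innerC z). Qed.

Lemma inner0l z : '[0, z] = 0.
Proof. by rewrite -(scale0r 0) innerZl mul0r. Qed.

Lemma innerNl x z : '[- x, z] = - '[x, z].
Proof. by rewrite -scaleN1r innerZl mulN1r. Qed.

Lemma innerBl x y z : '[x - y, z] = '[x, z] - '[y, z].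
Proof. by rewrite innerDl innerNl. Qed.

Lemma innerBr x y z : '[z, x - y] = '[z, x] - '[z, y].
Proof. by rewrite innerC innerBl !(innerC z). Qed.

Lemma inner_suml (I : Type) (r : seq I) (Q : pred I) (F : I -> V) z :
  '[\sum_(i <- r | Q i) F i, z] = \sum_(i <- r | Q i) '[F i, z].
Proof.
elim/big_rec2: _ => [|i y x _ <-]; first exact: inner0l.
by rewrite innerDl.
Qed.

Lemma inner_sumr (I : Type) (r : seq I) (Q : pred I) (F : I -> V) z :
  '[z, \sum_(i <- r | Q i) F i] = \sum_(i <- r | Q i) '[z, F i].
Proof. by rewrite innerC inner_suml; apply: eq_bigr => i _; rewrite innerC. Qed.

Lemma norm_sum_orthonormal (e : nat -> V) (b : nat -> R) (s : seq nat) :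
  uniq s -> {in s &, forall i j, '[e i, e j] = (i == j)%:R} ->
  `|\sum_(j <- s) b j *: e j| ^+ 2 = \sum_(j <- s) b j ^+ 2.
Proof.
move=> us es; rewrite -innerE inner_suml [LHS]big_seq [RHS]big_seq.
apply: eq_bigr => i iS; rewrite innerZl inner_sumr (bigD1_seq i)//= innerZr es// eqxx mulr1.
rewrite big_seq_cond big1 ?addr0 ?expr2// => j /andP[js ji].
by rewrite innerZr es// eq_sym (negbTE ji) mulr0.
Qed.

End inner_product.

(** * Gaussian integrals through the density *)

Section gaussian_integrals.
Context {R : realType}.
Local Notation mu := (@lebesgue_measure R).
Import HBNNSimple.

(** [normal_prob] prescribes the integral of the density over sets only; simple functions and
    monotone convergence extend this to nonnegative functions. *)
Lemma ge0_integral_normal_prob (m s : R) (f : R -> \bar R) :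
  measurable_fun [set: R] f -> (forall x, 0 <= f x)%E ->
  (\int[normal_prob m s]_x f x = \int[mu]_x (f x * (normal_pdf m s x)%:E))%E.
Proof.
move=> mf f0.
have mpdf : measurable_fun setT (fun x => (normal_pdf m s x)%:E).
  by apply/measurable_EFinP; exact: measurable_normal_pdf.
pose f_ := nnsfun_approx measurableT mf.
have mf_ n : measurable_fun [set: R] (fun x => (f_ n x)%:E).
  by apply: measurableT_comp => //; exact: (measurable_funP (f_ n)).
have nd_ a b : (a <= b)%N -> forall x, f_ a x <= f_ b x.
  by move=> ab x; have /lefP := nd_nnsfun_approx measurableT mf ab; exact.
transitivity (lim (\int[normal_prob m s]_x (f_ n x)%:E @[n --> \oo])%E).
  rewrite -monotone_convergence//=.
  - apply: eq_integral => ? /[!inE] xD; apply/esym/cvg_lim => //=.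
    exact: cvg_nnsfun_approx.
  - by move=> n ? _; rewrite lee_fin.
  - by move=> ? _ ? ? mn; rewrite lee_fin; exact: nd_.
rewrite [RHS](_ : _ = lim
    (\int[mu]_x ((f_ n x)%:E * (normal_pdf m s x)%:E) @[n --> \oo])%E); last first.
  rewrite -monotone_convergence//=.
  - apply: eq_integral => x /[!inE] xD; apply/esym/cvg_lim => //.
    apply: cvgeZr => //.
    exact: cvg_nnsfun_approx.
  - by move=> n; apply: emeasurable_funM => //; exact: mf_.
  - by move=> n ? _; rewrite mule_ge0// lee_fin// normal_pdf_ge0.
  - move=> ? _ ? ? ?; apply: lee_wpmul2r; first by rewrite lee_fin normal_pdf_ge0.
    by rewrite lee_fin; exact: nd_.
apply: congr_lim; apply/funext => n /=.
have mfr r : measurable_fun [set: R] (fun x => (r * \1_(f_ n @^-1` [set r]) x)%:E).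
  by apply: measurableT_comp => //; exact: measurable_funM.
have nnf r x : (0 <= (r * \1_(f_ n @^-1` [set r]) x)%:E)%E.
  by rewrite nnfun_muleindic_ge0.
transitivity (\int[normal_prob m s]_x \sum_(r \in range (f_ n))
    (r * \1_(f_ n @^-1` [set r]) x)%:E)%E.
  by apply: eq_integral => x _; rewrite fimfunE -fsumEFin.
transitivity (\int[mu]_x \sum_(r \in range (f_ n))
    ((r * \1_(f_ n @^-1` [set r]) x)%:E * (normal_pdf m s x)%:E))%E; last first.
  by apply: eq_integral => x _; rewrite -ge0_mule_fsuml// fimfunE -fsumEFin.
rewrite !ge0_integral_fsum//; last 2 first.
- by move=> r; exact: (emeasurable_funM (mfr r) mpdf).
- by move=> r x _; rewrite mule_ge0// lee_fin normal_pdf_ge0.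
apply: eq_fsbigr => r _.
have mA : measurable (f_ n @^-1` [set r]) by exact: measurable_sfunP.
set A := f_ n @^-1` [set r] in mA *.
have mI : measurable_fun [set: R] (fun x : R => (\1_A x : R)%:E).
  by apply/measurable_EFinP; exact: measurable_indic.
have [r0|r0] := leP 0 r; last first.
  have -> : A = set0 by exact: preimage_nnfun0.
  by rewrite !integral0_eq// => x _; rewrite indicE in_set0 mulr0 ?mul0e.
transitivity (r%:E * \int[normal_prob m s]_x (\1_A x)%:E)%E.
  by rewrite -ge0_integralZl.
transitivity (r%:E * \int[mu]_x ((\1_A x)%:E * (normal_pdf m s x)%:E))%E; last first.
  rewrite -ge0_integralZl//.
  - by apply: eq_integral => x _; rewrite EFinM muleA.
  - exact: emeasurable_funM mI mpdf.
  - by move=> x _; rewrite mule_ge0// lee_fin normal_pdf_ge0.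
congr (_ * _)%E.
rewrite integral_indic//= setIT /normal_prob [LHS]integral_mkcond.
apply: eq_integral => x _; rewrite patchE indicE.
by case: ifPn => _; rewrite ?mul1e ?mul0e.
Qed.

(** The integrand is s times the Gaussian density of variance s^2 = 1 / (1 - 2 t). *)
Lemma integral_normal_prob_expR_sqr (t : R) : t < 2^-1 ->
  (\int[normal_prob 0 1]_x (expR (t * x ^+ 2))%:E =
   ((1 - 2 * t) `^ (- 2^-1))%:E)%E.
Proof.
move=> t2.
have c0 : 0 < 1 - 2 * t by lra.
have mexp : measurable_fun setT (fun x : R => expR (t * x ^+ 2)).
  by apply: measurableT_comp => //; apply: measurable_funM => //; exact: measurable_funX.
rewrite ge0_integral_normal_prob; last 2 first.
- exact/measurable_EFinP.
- by move=> x; rewrite lee_fin expR_ge0.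
pose s := (1 - 2 * t) `^ (- 2^-1).
have s0 : 0 < s by rewrite powR_gt0.
have s2 : s ^+ 2 = (1 - 2 * t)^-1.
  rewrite -powR_mulrn ?ltW// -powRrM mulNr mulVf ?pnatr_eq0//.
  by rewrite powR_inv1// ltW.
have E x : ((expR (t * x ^+ 2))%:E * (normal_pdf 0 1 x)%:E =
    s%:E * (normal_pdf 0 s x)%:E)%E.
  rewrite -!EFinM; congr EFin.
  rewrite !normal_pdfE ?oner_neq0 ?gt_eqF//.
  rewrite mulrCA /normal_fun -expRD [RHS]mulrA; congr (_ * _).
    rewrite /normal_peak expr1n mul1r -mulrnAr sqrtrM ?sqr_ge0// sqrtr_sqr.
    by rewrite ger0_norm ?ltW// invfM mulrA divff ?gt_eqF// mul1r.
  congr expR; rewrite subr0 expr1n -(mulr_natr (s ^+ 2)) s2.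
  by field; rewrite gt_eqF.
under eq_integral do rewrite E.
rewrite integralZl//=; last exact: integrable_normal_pdf.
by rewrite integral_normal_pdf mule1.
Qed.

End gaussian_integrals.

Lemma is_derive_mull {R : realType} (b x : R) :
  is_derive x (1 : R) (fun x => b * x) b.
Proof. by apply: is_derive_eq; rewrite /GRing.scale/= mulr1. Qed.

(** * Characteristic function of the standard Gaussian *)

Section gaussian_characteristic_function.
Context {R : realType}.
Local Notation mu := (@lebesgue_measure R).
Local Notation phi := (normal_pdf 0 1 : R -> R).

Let mphi : measurable_fun [set: R] (EFin \o phi).
Proof. by apply/measurable_EFinP; exact: measurable_normal_pdf. Qed.

Let is_derive_phi x : is_derive x (1 : R) phi (- x * phi x).
Proof.
have -> : phi = (fun x : R => normal_peak 1 * expR (- (x ^+ 2 / 2))).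
  apply/funext => y; rewrite normal_pdfE ?oner_neq0// /normal_fun subr0.
  by rewrite expr1n mulNr.
apply: is_derive_eq.
rewrite /= !scaler0 !scaler1 /GRing.scale/=.
by field.
Qed.

Let mexp (c : R) : measurable_fun [set: R] (fun x => (expR (c * x ^+ 2))%:E).
Proof.
apply/measurable_EFinP; apply: measurableT_comp => //.
by apply: measurable_funM => //; exact: measurable_funX.
Qed.

Let integrable_mphi (f : R -> R) : measurable_fun [set: R] f ->
  (forall x, `|f x| <= 1 + `|x|) ->
  mu.-integrable setT (EFin \o (fun x => f x * phi x)).
Proof.
move=> mf fx.
(* 1 + |x| <= 2 (1 + x^2 / 4) <= 2 exp (x^2 / 4), and exp (x^2 / 4) is integrable against [phi]
   because 1/4 < 1/2. *)
have ig : mu.-integrable setT (fun x => (expR (4^-1 * x ^+ 2))%:E * (phi x)%:E)%E.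
  apply/integrableP; split.
    exact: (emeasurable_funM (mexp _) mphi).
  under eq_integral do rewrite gee0_abs ?mule_ge0 ?lee_fin ?expR_ge0 ?normal_pdf_ge0//.
  rewrite -(@ge0_integral_normal_prob _ _ _ (fun x => (expR (4^-1 * x ^+ 2))%:E)).
  - by rewrite integral_normal_prob_expR_sqr ?ltry// ltf_pV2 ?posrE// ltr_nat.
  - exact: mexp.
  - by move=> x; rewrite lee_fin expR_ge0.
have ig2 := integrableZl measurableT 2 ig.
apply: le_integrable ig2 => //.
- by apply/measurable_EFinP/measurable_funM => //; exact/measurable_EFinP.
- move=> x _ /=; rewrite lee_fin !normrM mulrA.
  rewrite ler_wpM2r//.
  rewrite (ger0_norm (expR_ge0 _)) normr_nat.
  apply: (le_trans (fx x)); apply: (@le_trans _ _ (2 * (1 + 4^-1 * x ^+ 2))).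
    rewrite -(real_normK (num_real x)); nra.
  by rewrite ler_pM2l// expR_ge1Dx.
Qed.

Let charfun (b : R) := \int[mu]_x (cos (b * x) * phi x).

Let sin_ub (b x : R) : `|x * sin (b * x)| <= 1 + `|x|.
Proof.
rewrite normrM; apply: (@le_trans _ _ (`|x| * 1)); last by rewrite mulr1 lerDr.
by rewrite ler_wpM2l// ler_norml sin_geN1 sin_le1.
Qed.

Let cos_ub (b x : R) : `|cos (b * x)| <= 1 + `|x|.
Proof.
apply: (@le_trans _ _ 1); last by rewrite lerDl.
by rewrite ler_norml cos_geN1 cos_le1.
Qed.

Let msin (b : R) : measurable_fun [set: R] (fun x => sin (b * x)).
Proof.
apply: continuous_measurable_fun => x; apply: continuous_comp.
  by apply: cvgM; [exact: cvg_cst|exact: cvg_id].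
exact: continuous_sin.
Qed.

Let mcos (b : R) : measurable_fun [set: R] (fun x => cos (b * x)).
Proof.
apply: continuous_measurable_fun => x; apply: continuous_comp.
  by apply: cvgM; [exact: cvg_cst|exact: cvg_id].
exact: continuous_cos.
Qed.

Let isin (b : R) : mu.-integrable setT (EFin \o (fun x => x * sin (b * x) * phi x)).
Proof. by apply: integrable_mphi => //; exact: measurable_funM. Qed.

Let icos (b : R) : mu.-integrable setT (EFin \o (fun x => cos (b * x) * phi x)).
Proof. exact: integrable_mphi. Qed.

Let charfun_parts (b : R) :
  \int[mu]_x (x * sin (b * x) * phi x) = b * charfun b.
Proof.
(* Integration by parts: g is the derivative of F, so its integral over a symmetric interval is a
   boundary term, which vanishes in the limit because [phi] decays. *)
pose g x := b * (cos (b * x) * phi x) - x * sin (b * x) * phi x.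
pose F x := sin (b * x) * phi x.
have ig : mu.-integrable setT (EFin \o g).
  have -> : EFin \o g = (fun x => b%:E * (cos (b * x) * phi x)%R%:E
      - (x * sin (b * x) * phi x)%R%:E)%E.
    by apply/funext => x /=; rewrite /g EFinB EFinM.
  apply: integrableB => //; last exact: isin.
  exact: (integrableZl measurableT b (icos b)).
have dF x : is_derive x (1 : R) F (g x).
  have d1 : is_derive x (1 : R) (fun x => sin (b * x)) (cos (b * x) * b).
    exact: (@is_derive1_comp R sin ( *%R b) x _ _ (is_derive_sin _) (is_derive_mull b x)).
  apply: is_derive_eq; first exact: (is_deriveM d1 (is_derive_phi x)).
  by rewrite /g /GRing.scale/=; ring.
have cg : continuous g.
  move=> x; apply: cvgB; last first.
    apply: cvgM; last exact: continuous_normal_pdf.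
    apply: cvgM; first exact: cvg_id.
    apply: continuous_comp; last exact: continuous_sin.
    by apply: cvgM; [exact: cvg_cst|exact: cvg_id].
  apply: cvgM; first exact: cvg_cst.
  apply: cvgM; last exact: continuous_normal_pdf.
  apply: continuous_comp; last exact: continuous_cos.
  by apply: cvgM; [exact: cvg_cst|exact: cvg_id].
have FTC (n : nat) : (\int[mu]_(x in `[(- n.+1%:R)%R, n.+1%:R%R]) (g x)%:E =
    (F n.+1%:R)%:E - (F (- n.+1%:R)%R)%:E)%E.
  apply: continuous_FTC2.
  - by rewrite gtrN// ltr0n.
  - exact: continuous_subspaceT.
  - have cF : continuous F.
      by move=> x; apply/differentiable_continuous/derivable1_diffP; have [] := dF x.
    split.
    + by move=> x _; have [] := dF x.
    + by apply: cvg_at_right_filter; exact: cF.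
    + by apply: cvg_at_left_filter; exact: cF.
  - by move=> x _; rewrite derive1E; have [] := dF x.
have g0 : \int[mu]_x g x = 0.
  pose f_ (n : nat) := (EFin \o g) \_ `[(- n.+1%:R : R), n.+1%:R].
  have mf_ n : measurable_fun [set: R] (f_ n).
    apply/(measurable_restrictT _ _).1 => //; apply: measurable_funTS.
    by case/integrableP : ig.
  have cvf_ : {ae mu, forall x, [set: R] x -> f_ ^~ x @ \oo --> (g x)%:E}.
    apply: aeW => x _; apply: cvg_near_cst.
    near=> n; rewrite /f_ patchE ifT//= inE/= in_itv/= -ler_norml.
    rewrite (le_trans (ltW (truncnS_gt `|x|)))// ler_nat.
    by near: n; exists (Num.truncn `|x|) => // m /=; lia.
  have dom : {ae mu, forall x n, [set: R] x -> (`|f_ n x| <= `|(g x)%:E|)%E}.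
    apply: aeW => x n _; rewrite /f_ patchE; case: ifPn => // _.
    by rewrite abse0 abse_ge0.
  have [_ _ L] := @dominated_convergence _ _ _ mu setT measurableT f_ (EFin \o g)
    _ mf_ (measurable_int _ ig) cvf_ (integrable_abse ig) dom.
  have {}L : (F n.+1%:R - F (- n.+1%:R))%:E @[n --> \oo] --> (\int[mu]_x (g x)%:E)%E.
    apply: cvg_trans L; apply: near_eq_cvg; near=> n.
    by rewrite /= EFinB -FTC [RHS]integral_mkcond.
  have Fl : (F n.+1%:R - F (- n.+1%:R))%:E @[n --> \oo] --> (0 : \bar R)%E.
    have phiN x : phi (- x) = phi x.
      by rewrite normal_pdfE ?oner_neq0// /normal_fun !subr0 sqrrN.
    have phi_ub (n : nat) : phi n.+1%:R <= normal_peak 1 * 2 * n.+1%:R^-1.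
      rewrite normal_pdfE ?oner_neq0// /normal_fun subr0 expr1n mulNr expRN -mulrA.
      rewrite ler_wpM2l ?normal_peak_ge0// ler_pdivlMr ?ltr0n//.
      rewrite mulrC ler_pdivrMr ?expR_gt0//.
      apply: (@le_trans _ _ (2 * (1 + n.+1%:R ^+ 2 / 2))); last first.
        by rewrite ler_pM2l// expR_ge1Dx.
      have : (1 : R) <= n.+1%:R by rewrite ler1n.
      nra.
    apply: cvg_EFin; first exact: nearW.
    apply: norm_cvg0.
    apply: (@squeeze_cvgr _ _ _ _ (fun=> 0)
      (fun n : nat => 2 * (normal_peak 1 * 2) * n.+1%:R^-1)).
    - near=> n; rewrite normr_ge0 /= /F mulrN sinN phiN mulNr opprK.
      have := phi_ub n; have := normal_pdf_ge0 0 1 (n.+1%:R : R).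
      set p := phi _ => p0 pub.
      have : `|sin (b * n.+1%:R)| <= 1 by rewrite ler_norml sin_geN1 sin_le1.
      move=> s1; rewrite -mulr2n normrMn normrM (ger0_norm p0).
      have : `|sin (b * n.+1%:R)| * p <= p by rewrite ler_piMl.
      have -> : 2 * (normal_peak 1 * 2) * n.+1%:R^-1 = (normal_peak 1 * 2 / n.+1%:R) *+ 2 :> R.
        by ring.
      by rewrite lerMn2r/= => /le_trans; apply.
    - exact: cvg_cst.
    - rewrite -[X in _ --> X](mulr0 (2 * (normal_peak 1 * 2))).
      by apply: cvgM; [exact: cvg_cst|exact: cvg_harmonic].
  by rewrite /Rintegral (cvg_unique _ L Fl).
apply/eqP; rewrite eq_sym -subr_eq0 -[X in _ == X]g0 /charfun /g.
rewrite RintegralB//; last first.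
  by have := integrableZl measurableT b (icos b).
by rewrite RintegralZl.
Unshelve. all: end_near. Qed.

Let derive_cosM (x b : R) : is_derive b (1 : R) (fun b => cos (b * x) * phi x)
  (- x * sin (b * x) * phi x).
Proof.
have d1 : is_derive b (1 : R) (fun b => b * x) x.
  by under eq_fun do rewrite mulrC; exact: is_derive_mull.
have d2 := @is_derive1_comp R cos (fun b => b * x) b _ _ (is_derive_cos _) d1.
have -> : (fun b => cos (b * x) * phi x) = (fun b => phi x * (cos \o (fun b => b * x)) b).
  by apply/funext => y /=; rewrite mulrC.
have d3 := @is_derive1_comp R ( *%R (phi x)) _ b _ _ (is_derive_mull _ _) d2.
by apply: is_derive_eq d3 _; ring.
Qed.

Let is_derive_charfun (b : R) : is_derive b (1 : R) charfun (- b * charfun b).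
Proof.
pose f b x := cos (b * x) * phi x.
have pf c x : partial1of2 f c x = - (x * sin (c * x) * phi x).
  by rewrite partial1of2E; have [_ ->] := derive_cosM x c; ring.
have Ib : [set` `]b - 1, b + 1[] b by rewrite /= in_itv/=; apply/andP; split; lra.
have iG : mu.-integrable setT (EFin \o (fun x => `|x| * phi x)).
  apply: integrable_mphi => [|x]; first exact: normr_measurable.
  by rewrite normr_id lerDr.
have G0 (x : R) : 0 <= `|x| * phi x by rewrite mulr_ge0 ?normal_pdf_ge0.
have df c x : [set` `]b - 1, b + 1[] c -> [set: R] x -> derivable (f ^~ x) c 1.
  by move=> _ _; have [] := derive_cosM x c.
have ub c x : [set` `]b - 1, b + 1[] c -> [set: R] x -> `|partial1of2 f c x| <= `|x| * phi x.
  move=> _ _; rewrite pf normrN !normrM (ger0_norm (normal_pdf_ge0 _ _ _)).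
  rewrite ler_wpM2r ?normal_pdf_ge0//.
  by rewrite ler_piMr// ler_norml sin_geN1 sin_le1.
have intf c : [set` `]b - 1, b + 1[] c -> mu.-integrable setT (EFin \o f c).
  by move=> _; exact: icos.
apply: DeriveDef.
  exact: (derivable_under_integral measurableT Ib intf df G0 iG ub).
rewrite -derive1E (differentiation_under_integral measurableT Ib intf df G0 iG ub).
rewrite mulNr -charfun_parts.
transitivity (\int[mu]_x (-1 * (x * sin (b * x) * phi x))).
  by apply: eq_Rintegral => x _; rewrite pf mulN1r.
by rewrite RintegralZl// mulN1r.
Qed.

(** Differentiation under the integral and integration by parts give charfun' = - b charfun, so that
    charfun b * exp (b^2 / 2) is constant. *)
Let charfunE (b : R) : charfun b = expR (- (b ^+ 2 / 2)).
Proof.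
have d c : is_derive c (1 : R) (fun c => charfun c * expR (c ^+ 2 / 2)) 0.
  have d1 : is_derive c (1 : R) (fun c => c ^+ 2 / 2) c.
    by apply: is_derive_eq; rewrite /GRing.scale/=; field.
  have d2 := @is_derive1_comp R expR _ c _ _ (is_derive_expR _) d1.
  have d3 := is_deriveM (is_derive_charfun c) d2.
  by apply: is_derive_eq d3 _; rewrite /GRing.scale/=; ring.
have := is_derive_0_is_cst b 0 d.
have -> : charfun 0 = 1.
  rewrite /charfun /Rintegral.
  under eq_integral do rewrite mul0r cos0 mul1r.
  by rewrite integral_normal_pdf.
rewrite expr0n mul0r expR0 mulr1 expRN => e.
by apply: (mulIf (lt0r_neq0 (expR_gt0 (b ^+ 2 / 2)))); rewrite e mulVf// lt0r_neq0 ?expR_gt0.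
Qed.

Lemma integral_normal_prob_cos (b : R) :
  (\int[normal_prob 0 1]_x (cos (b * x))%:E = (expR (- (b ^+ 2 / 2)))%:E)%E.
Proof.
(* The passage to the density is available for nonnegative integrands, hence 1 + cos in place of
   cos. *)
have c1 (x : R) : 0 <= 1 + cos (b * x) by have := cos_geN1 (b * x); lra.
have ic : (normal_prob 0 1).-integrable setT (fun x => (cos (b * x))%:E).
  apply: (@le_integrable _ _ _ _ _ _ _ (cst 1%E)) => //.
  - by apply/measurable_EFinP; exact: mcos.
  - by move=> x _ /=; rewrite lee_fin normr1 ler_norml cos_geN1 cos_le1.
  - exact: finite_measure_integrable_cst.
have : (\int[normal_prob 0 1]_x (1 + cos (b * x))%:E =
    1 + (expR (- (b ^+ 2 / 2)))%:E)%E.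
  rewrite ge0_integral_normal_prob//; last first.
    by apply/measurable_EFinP/measurable_funD.
  under eq_integral do rewrite -EFinM mulrDl mul1r EFinD.
  rewrite integralD//=; [|exact: integrable_normal_pdf|exact: icos].
  rewrite integral_normal_pdf; congr (_ + _)%E.
  rewrite -charfunE /charfun /Rintegral fineK//.
  exact: (integrable_fin_num measurableT (icos b)).
under eq_integral do rewrite EFinD.
rewrite integralD//=; last exact: finite_measure_integrable_cst.
rewrite integral_cst//= probability_setT mule1.
rewrite -(fineK (integrable_fin_num measurableT ic)).
by rewrite -EFinD => -[/addrI ->].
Qed.

End gaussian_characteristic_function.

(* The image by X of the measure of density f with respect to mu. *)
Section weighted_image.
Context d d' (T : measurableType d) (T' : measurableType d') (R : realType).
Variables (mu : {measure set T -> \bar R}) (X : {mfun T >-> T'}) (f : T -> \bar R).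
Hypotheses (mf : measurable_fun setT f) (f0 : forall x, (0 <= f x)%E).

(** The measurability and sign proofs are arguments so that the measure structure can be attached to
    the term itself. *)
Definition weighted_image of measurable_fun setT f & (forall x, (0 <= f x)%E) :=
  fun B : set T' => (\int[mu]_(x in X @^-1` B) f x)%E.

Local Notation image := (weighted_image mf f0).

Let image0 : image set0 = 0%E.
Proof. by rewrite /weighted_image preimage_set0 integral_set0. Qed.

Let image_ge0 B : (0 <= image B)%E.
Proof. by apply: integral_ge0 => x _; exact: f0. Qed.

Let image_sigma_additive : semi_sigma_additive image.
Proof.
move=> F mF tF mUF; rewrite /weighted_image preimage_bigcup ge0_integral_bigcup//.
- by apply: is_cvg_ereal_nneg_natsum_cond => n _ _; exact: image_ge0.
- by move=> n; rewrite -[X in measurable X]setTI; exact: measurable_funPT.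
- exact: measurable_funTS.
- apply/trivIsetP => /= i j _ _ ij; rewrite -preimage_setI.
  by move/trivIsetP : tF => /(_ _ _ _ _ ij) ->//; rewrite preimage_set0.
Qed.

HB.instance Definition _ := isMeasure.Build _ _ _
  image image0 image_ge0 image_sigma_additive.

End weighted_image.

(** * Laplace transforms at the integers determine a law *)

Section laplace.
Context d (T : measurableType d) (R : realType) (P : probability T R).

Lemma bounded_integrable (f : T -> R) (M : R) : measurable_fun setT f ->
  (forall x, `|f x| <= M) -> P.-integrable setT (EFin \o f).
Proof.
move=> mf fM; apply: measurable_bounded_integrable => //.
  by rewrite (le_lt_trans (probability_le1 _ _))// ltry.
exists M; split; first exact: num_real.
by move=> y My x _ /=; apply: (le_trans (fM x)); exact: ltW.
Qed.

Variables (w A : T -> R) (c : R).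
Hypotheses (mw : measurable_fun setT w) (mA : measurable_fun setT A).
Hypotheses (w01 : forall x, 0 <= w x <= 1) (A0 : forall x, 0 <= A x).
Hypothesis laplace : forall n : nat,
  \int[P]_x (w x * expR (- A x) ^+ n) = c * \int[P]_x (expR (- A x) ^+ n).

Let y x := expR (- A x).

Let y01 x : 0 <= y x <= 1.
Proof. by rewrite expR_ge0 expR_le1 oppr_le0 A0. Qed.

Let my : measurable_fun setT y.
Proof. by apply: measurableT_comp => //; exact: measurableT_comp. Qed.

Let mpoly (p : {poly R}) : measurable_fun setT (fun x => p.[y x]).
Proof.
under eq_fun do rewrite horner_coef.
by apply: measurable_sum => i; apply: measurable_funM => //; exact: measurable_funX.
Qed.

Let ipow (v : T -> R) n : measurable_fun setT v -> (forall x, 0 <= v x <= 1) ->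
  P.-integrable setT (EFin \o (fun x => v x * y x ^+ n)).
Proof.
move=> mv v01; apply: (@bounded_integrable _ 1).
  by apply: measurable_funM => //; exact: measurable_funX.
move=> x; have /andP[v0 v1] := v01 x; have /andP[y0 y1] := y01 x.
by rewrite ger0_norm ?mulr_ge0 ?exprn_ge0// mulr_ile1// ?exprn_ge0// exprn_ile1.
Qed.

Let integral_poly (v : T -> R) (p : {poly R}) :
  measurable_fun setT v -> (forall x, 0 <= v x <= 1) ->
  \int[P]_x (v x * p.[y x]) = \sum_(i < size p) p`_i * \int[P]_x (v x * y x ^+ i).
Proof.
move=> mv v01; rewrite /Rintegral.
transitivity (fine (\int[P]_x \sum_(i < size p) (p`_i)%R%:E * (v x * y x ^+ i)%R%:E)%E).
  congr fine; apply: eq_integral => x _; rewrite horner_coef mulr_sumr -sumEFin.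
  by apply: eq_bigr => i _; rewrite mulrCA EFinM.
rewrite integral_sum//; last first.
  by move=> i; apply: integrableZl => //; exact: ipow.
rewrite (eq_bigr (fun i : 'I_(size p) =>
    (p`_i * \int[P]_x (v x * y x ^+ i))%:E)); first by rewrite sumEFin.
move=> i _; rewrite integralZl//; last exact: ipow.
by rewrite EFinM fineK//; exact: (integrable_fin_num measurableT (ipow _ mv v01)).
Qed.

Let laplace_poly (p : {poly R}) :
  \int[P]_x (w x * p.[y x]) = c * \int[P]_x (p.[y x]).
Proof.
rewrite integral_poly//.
transitivity (c * \int[P]_x (1 * p.[y x])); last first.
  by congr (_ * _); apply: eq_Rintegral => x _; rewrite mul1r.
rewrite integral_poly//; last by move=> x; rewrite lexx ler01.
rewrite mulr_sumr; apply: eq_bigr => i _; rewrite laplace mulrCA.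
by congr (_ * (_ * _)); apply: eq_Rintegral => x _; rewrite mul1r.
Qed.

Variable a : R.
Hypothesis a0 : 0 < a.

(** Polynomials in y with values in [0, 1] that tend to the indicator of A >= a, including the
    boundary A = a. The hypothesis extends linearly to polynomials in y, and dominated convergence
    carries it over to half-lines. *)
Let N (n : nat) := (Num.truncn (expR (n.+1%:R * a) / n.+1%:R)).+1.
Let p (n : nat) : {poly R} := (1 - 'X ^+ n.+1) ^+ N n.

Let pE n x : (p n).[y x] = (1 - y x ^+ n.+1) ^+ N n.
Proof. by rewrite /p !hornerE. Qed.

Let p01 n x : 0 <= (p n).[y x] <= 1.
Proof.
have /andP[y0 y1] := y01 x.
rewrite pE; have : 0 <= y x ^+ n.+1 <= 1 by rewrite exprn_ge0// exprn_ile1.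
by move=> /andP[? ?]; rewrite exprn_ge0 ?exprn_ile1 ?subr_ge0// gerBl.
Qed.

Let bernoulli (t : R) k : 0 <= t <= 1 -> 1 - k%:R * t <= (1 - t) ^+ k.
Proof.
move=> /andP[t0 t1]; elim: k => [|k IH]; first by rewrite expr0 mul0r subr0.
have k0 : 0 <= k%:R :> R by [].
rewrite exprSr (le_trans _ (ler_wpM2r _ IH)) ?subr_ge0//.
rewrite -natr1; nra.
Qed.

(* N n lies between exp (n a) / n and exp (n a) / n + 1, so that N n * y ^ n
   tends to 0 if y <= exp (- a), and to infinity otherwise. *)
Let cvg_p x : (p n).[y x] @[n --> \oo] --> ((a <= A x)%R%:R : R).
Proof.
have /andP[y0 y1] := y01 x.
have yE n : y x ^+ n.+1 = (expR (n.+1%:R * A x))^-1.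
  by rewrite /y -expRM_natl mulrN expRN.
have [aA|Aa] := leP a (A x).
  apply: (@squeeze_cvgr _ _ _ _ (fun n : nat => 1 - (1 + a^-1) * n.+1%:R^-1) (fun=> 1)).
  - near=> n.
    have n0 : 0 < n.+1%:R :> R by [].
    have /andP[_ ->] := p01 n x; rewrite andbT pE.
    have /(bernoulli (N n)) : 0 <= y x ^+ n.+1 <= 1 by rewrite exprn_ge0 ?exprn_ile1.
    apply: le_trans; rewrite lerD2l lerN2.
    have e0 := expR_gt0 (n.+1%:R * a).
    have ya : y x ^+ n.+1 <= (expR (n.+1%:R * a))^-1.
      by rewrite yE lef_pV2 ?posrE ?expR_gt0// ler_expR ler_pM2l.
    apply: (@le_trans _ _ ((N n)%:R * (expR (n.+1%:R * a))^-1)).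
      by rewrite ler_wpM2l.
    rewrite /N -natr1 mulrDl mul1r [leRHS]mulrDl mul1r lerD//.
      rewrite ler_pdivrMr// [leRHS]mulrC.
      by rewrite truncn_le divr_ge0 ?ltW.
    rewrite -invfM lef_pV2 ?posrE ?mulr_gt0// (mulrC a).
    by rewrite (le_trans _ (expR_ge1Dx _))// lerDr.
  - rewrite -[X in _ --> X](subr0 1) -[X in _ - X](mulr0 (1 + a^-1)).
    apply: cvgB; first exact: cvg_cst.
    by apply: cvgM; [exact: cvg_cst|exact: cvg_harmonic].
  - exact: cvg_cst.
(* With n for n + 1 and t = y^n: (1 - t)^N <= exp (- N t) <= 1 / (N t), and N t >= n (a - A)^2 / 2
   by the quadratic term of the exponential series. *)
apply: (@squeeze_cvgr _ _ _ _ (fun=> 0) (fun n : nat => 2 / (a - A x) ^+ 2 * n.+1%:R^-1)).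
- near=> n.
  have n0 : 0 < n.+1%:R :> R by [].
  have /andP[-> _] := p01 n x; rewrite pE /=.
  have aA0 : 0 < a - A x by rewrite subr_gt0.
  have Ny : n.+1%:R * (a - A x) ^+ 2 / 2 <= (N n)%:R * y x ^+ n.+1.
    apply: (@le_trans _ _ (expR (n.+1%:R * a) / n.+1%:R * y x ^+ n.+1)); last first.
      by rewrite ler_wpM2r ?exprn_ge0// ltW// truncnS_gt.
    rewrite yE [leRHS]mulrAC -expRB -mulrBr ler_pdivlMr//.
    apply: le_trans (expR_ge1Dxn 1 _); last by rewrite mulr_ge0// ltW.
    rewrite /= (_ : 2`! = 2)%N// exprMn.
    by rewrite [leLHS](_ : _ = n.+1%:R ^+ 2 * (a - A x) ^+ 2 / 2) ?lerDr//; ring.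
  apply: (@le_trans _ _ (expR (- ((N n)%:R * y x ^+ n.+1)))).
    rewrite -mulrN expRM_natl; apply: lerXn2r; rewrite ?nnegrE ?expR_ge0//.
      by rewrite subr_ge0 exprn_ile1.
    exact: expR_ge1Dx.
  have u0 : 0 < n.+1%:R * (a - A x) ^+ 2 / 2 by rewrite divr_gt0// mulr_gt0// exprn_gt0.
  rewrite expRN (_ : 2 / (a - A x) ^+ 2 * n.+1%:R^-1 =
    (n.+1%:R * (a - A x) ^+ 2 / 2)^-1); last first.
    by field; rewrite !gt_eqF.
  rewrite lef_pV2 ?posrE ?expR_gt0// (le_trans _ (expR_ge1Dx _))//.
  by rewrite (le_trans Ny)// lerDr.
- exact: cvg_cst.
- rewrite -[X in _ --> X](mulr0 (2 / (a - A x) ^+ 2)).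
  by apply: cvgM; [exact: cvg_cst|exact: cvg_harmonic].
Unshelve. all: end_near. Qed.

Let mge : measurable_fun setT (fun x => (a <= A x)%R%:R : R).
Proof.
rewrite (_ : (fun x => _) = \1_(A @^-1` `[a, +oo[)); last first.
  apply/funext => x; rewrite indicE; case: (boolP (a <= A x)) => h.
    by rewrite mem_set//= in_itv/= andbT.
  by rewrite memNset//= in_itv/= andbT; exact/negP.
by apply: measurable_indic; rewrite -[X in measurable X]setTI; exact: mA.
Qed.

Let cvg_integral_p (v : T -> R) : measurable_fun setT v -> (forall x, 0 <= v x <= 1) ->
  \int[P]_x (v x * (p n).[y x]) @[n --> \oo] --> \int[P]_x (v x * (a <= A x)%R%:R).
Proof.
move=> mv v01.
have mvp n : measurable_fun setT (fun x => (v x * (p n).[y x])%:E).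
  by apply/measurable_EFinP/measurable_funM => //; exact: mpoly.
have mvl : measurable_fun setT (fun x => (v x * (a <= A x)%R%:R)%:E).
  exact/measurable_EFinP/measurable_funM.
have cv : {ae P, forall x, setT x ->
    (v x * (p n).[y x])%:E @[n --> \oo] --> (v x * (a <= A x)%R%:R)%:E}.
  apply: aeW => x _; apply: cvg_EFin; first exact: nearW.
  by apply: cvgM; [exact: cvg_cst|exact: cvg_p].
have dom : {ae P, forall x n, setT x -> (`|(v x * (p n).[y x])%:E| <= cst 1 x)%E}.
  apply: aeW => x n _; rewrite lee_fin.
  have /andP[v0 v1] := v01 x; have /andP[p0 p1] := p01 n x.
  by rewrite ger0_norm ?mulr_ge0// mulr_ile1.
have i1 : P.-integrable setT (cst 1%E) by exact: finite_measure_integrable_cst.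
have [il _ L] := @dominated_convergence _ _ _ P setT measurableT
  (fun n x => (v x * (p n).[y x])%:E) _ _ mvp mvl cv i1 dom.
by apply: fine_cvg; rewrite fineK//; exact: integrable_fin_num.
Qed.

Lemma laplace_halfline :
  \int[P]_x (w x * (a <= A x)%R%:R) = c * \int[P]_x (a <= A x)%R%:R.
Proof.
have L1 := cvg_integral_p mw w01.
have one01 (x : T) : 0 <= (1 : R) <= 1 by rewrite lexx ler01.
have m1 : measurable_fun [set: T] (fun=> 1 : R) by exact: measurable_cst.
have L2 := cvg_integral_p m1 one01.
have {}L2 : \int[P]_x (w x * (p n).[y x]) @[n --> \oo] --> c * \int[P]_x (1 * (a <= A x)%R%:R).
  rewrite (_ : (fun n => _) = (fun n => c * \int[P]_x (1 * (p n).[y x]))).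
    by apply: cvgM => //; exact: cvg_cst.
  apply/funext => n; rewrite laplace_poly; congr (_ * _).
  by apply: eq_Rintegral => x _; rewrite mul1r.
rewrite (cvg_unique _ L1 L2)//; congr (_ * _).
by apply: eq_Rintegral => x _; rewrite mul1r.
Qed.

End laplace.

Section laplace_unique.
Context d (T : measurableType d) (R : realType) (P : probability T R).

(** Both sides are finite measures in B: the image under A of the measure with density w, and c
    times the law of A. They agree on the half-lines [a, +oo[, which generate the Borel sets. *)
Lemma laplace_independence (w A : T -> R) (c : R) (B : set R) :
  measurable_fun setT w -> measurable_fun setT A ->
  (forall x, 0 <= w x <= 1) -> (forall x, 0 <= A x) ->
  (forall n : nat,
    \int[P]_x (w x * expR (- A x) ^+ n) = c * \int[P]_x (expR (- A x) ^+ n)) ->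
  measurable B ->
  \int[P]_x (w x * \1_B (A x)) = c * \int[P]_x (\1_B (A x) : R).
Proof.
move=> mw mA w01 A0 lap mB.
(* The case n = 0 reads E w = c; the sign is needed to scale a measure by c. *)
have c0 : 0 <= c.
  have := lap 0%N.
  under eq_Rintegral do rewrite expr0 mulr1.
  under [in RHS]eq_Rintegral do rewrite expr0.
  rewrite Rintegral_cst// mul1r (_ : fine _ = 1) ?mulr1; last exact: (congr1 fine (@probability_setT _ _ _ P)).
  move=> <-.
  by apply: Rintegral_ge0 => x _; have /andP[] := w01 x.
have mwE : measurable_fun setT (fun x => (w x)%:E) by exact/measurable_EFinP.
have wE0 x : (0 <= (w x)%:E)%E by rewrite lee_fin; have /andP[] := w01 x.
pose Af : {mfun T >-> R} := HB.pack A (isMeasurableFun.Build _ _ _ _ A mA).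
pose m1 : {measure set R -> \bar R} := weighted_image P Af mwE wE0.
pose m2 : {measure set R -> \bar R} := mscale (NngNum c0) (distribution P Af).
have mAB C : measurable C -> measurable (A @^-1` C).
  by move=> mC; rewrite -[X in measurable X]setTI; exact: (mA measurableT _ mC).
have mI C : measurable C -> measurable_fun setT (fun x => \1_C (A x) : R).
  by move=> mC; apply: measurableT_comp => //; exact: measurable_indic.
have I01 C x : 0 <= (\1_C (A x) : R) <= 1 by rewrite indicE; case: (_ \in _); rewrite ?lexx ?ler01.
have iwI C : measurable C -> P.-integrable setT (EFin \o (fun x => w x * \1_C (A x))).
  move=> mC; apply: (@bounded_integrable _ _ _ _ _ 1).
    by apply: measurable_funM => //; exact: mI.
  move=> x; have /andP[w0 w1] := w01 x; have /andP[J0 J1] := I01 C x.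
  by rewrite ger0_norm ?mulr_ge0// mulr_ile1.
have m1E C : measurable C -> m1 C = (\int[P]_x (w x * \1_C (A x)))%:E.
  move=> mC; rewrite /m1 /= /weighted_image integral_mkcond /Rintegral fineK; last first.
    exact: (integrable_fin_num measurableT (iwI _ mC)).
  apply: eq_integral => x _; rewrite patchE indicE.
  rewrite (_ : (A x \in C) = (x \in A @^-1` C)); last by apply/idP/idP; rewrite !inE.
  by case: ifPn => _; rewrite ?mulr1 ?mulr0.
have m2E C : measurable C -> m2 C = (c * \int[P]_x (\1_C (A x) : R))%:E.
  move=> mC; rewrite /m2 /= /mscale/= /distribution /pushforward EFinM; congr (_ * _)%E.
  rewrite -(setIT (A @^-1` C)) -integral_indic//; last exact: mAB.
  rewrite /Rintegral fineK.
    by apply: eq_integral => x _; rewrite !indicE; congr (_%:R%:E); congr nat_of_bool; apply/idP/idP; rewrite !inE.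
  apply: (integrable_fin_num measurableT); apply: (@bounded_integrable _ _ _ _ _ 1); first exact: mI.
  by move=> x; have /andP[J0 J1] := I01 C x; rewrite ger0_norm.
apply: EFin_inj; rewrite -m1E// -m2E//.
apply: (measure_unique (@RGenCInfty.G R) (fun n => `[(- n%:R : R), +oo[%classic)) => //.
- exact: RGenCInfty.measurableE.
- move=> _ _ [x ->] [z ->]; exists (Num.max x z).
  apply/seteqP; split => t /=; rewrite !in_itv/= !andbT ge_max.
    by move=> [-> ->].
  by move=> /andP[].
- by move=> n; exists (- n%:R).
- rewrite -subTset => x _; exists (Num.truncn `|x|).+1 => //=.
  rewrite in_itv/= andbT lerNl (le_trans (ler_norm _))// normrN.
  by rewrite ltW// truncnS_gt.
- move=> _ [a ->]; rewrite m1E// m2E//; congr EFin.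
  have E x : \1_(`[a, +oo[%classic) (A x) = (a <= A x)%R%:R :> R.
    rewrite indicE; case: (boolP (a <= A x)) => h.
      by rewrite mem_set//= in_itv/= andbT.
    by rewrite memNset//= in_itv/= andbT; exact/negP.
  under eq_Rintegral do rewrite E.
  under [in RHS]eq_Rintegral do rewrite E.
  (* For a <= 0 the half-line contains all values of A, and the case n = 0 suffices. *)
  have [a0|a0] := ltP 0 a; first exact: (laplace_halfline mw mA w01 A0 lap a0).
  have := lap 0%N.
  under eq_Rintegral do rewrite expr0.
  under [in RHS]eq_Rintegral do rewrite expr0.
  have a1 x : (a <= A x)%R by exact: le_trans (A0 x).
  under [in X in _ -> X]eq_Rintegral do rewrite a1.
  by under [in X in _ -> _ = X]eq_Rintegral do rewrite a1.
- by move=> k; rewrite m1E// ltry.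
Qed.

End laplace_unique.

(** * Independence from factorised Laplace transforms *)

Section independence_criterion.
Context d (T : measurableType d) (R : realType) (P : probability T R).
Variables (D : set nat) (A : nat -> {RV P >-> R}).
Hypothesis A0 : forall j x, 0 <= A j x.
Hypothesis laplaceA : forall (s : seq nat) (n : nat -> nat),
  uniq s -> (forall j, j \in s -> D j) ->
  \int[P]_x (\prod_(j <- s) expR (- A j x) ^+ n j) =
  \prod_(j <- s) \int[P]_x (expR (- A j x) ^+ n j).

Let y01 j n x : 0 <= expR (- A j x) ^+ n <= 1.
Proof. by rewrite exprn_ge0 ?exprn_ile1 ?expR_ge0// expR_le1 oppr_le0. Qed.

Let my j n : measurable_fun setT (fun x => expR (- A j x) ^+ n).
Proof.
by apply: measurable_funX; apply: measurableT_comp => //; exact: measurableT_comp.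
Qed.

Let I01 j (B : nat -> set R) x : 0 <= (\1_(B j) (A j x) : R) <= 1.
Proof. by rewrite indicE; case: (_ \in _); rewrite ?lexx ?ler01. Qed.

Let prod01 (s : seq nat) (f : nat -> T -> R) x :
  (forall j x, 0 <= f j x <= 1) -> 0 <= \prod_(j <- s) f j x <= 1.
Proof.
move=> f01; elim: s => [|j s /andP[s0 s1]]; first by rewrite big_nil lexx ler01.
by rewrite big_cons; have /andP[f0 f1] := f01 j x; rewrite mulr_ge0// mulr_ile1.
Qed.

(** The exponentials are replaced by indicators one index at a time. For the index i all other
    factors form the weight w of [laplace_independence]; its hypothesis is the induction hypothesis
    with i moved to s2 and an arbitrary exponent k, which is why s2 and n stay general. *)
Let independence_step (s1 s2 : seq nat) (n : nat -> nat) (B : nat -> set R) :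
  uniq (s1 ++ s2) -> (forall j, j \in s1 ++ s2 -> D j) ->
  (forall j, j \in s1 -> measurable (B j)) ->
  \int[P]_x ((\prod_(j <- s1) \1_(B j) (A j x)) *
             \prod_(j <- s2) expR (- A j x) ^+ n j) =
  (\prod_(j <- s1) \int[P]_x (\1_(B j) (A j x) : R)) *
  \prod_(j <- s2) \int[P]_x (expR (- A j x) ^+ n j).
Proof.
elim: s1 => [|i s1 IH] in s2 n *.
  move=> us Ds _; rewrite big_nil mul1r -laplaceA//.
  by apply: eq_Rintegral => x _; rewrite big_nil mul1r.
rewrite cat_cons cons_uniq => /andP[iS us] Ds mB.
have mBs j : j \in s1 -> measurable (B j) by move=> js; apply: mB; rewrite in_cons js orbT.
pose w x : R := (\prod_(j <- s1) \1_(B j) (A j x)) * \prod_(j <- s2) expR (- A j x) ^+ n j.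
have mw : measurable_fun setT w.
  apply: measurable_funM; last by apply: measurable_prod => j _; exact: my.
  (* [B j] is known to be measurable only for j in s1; setT is a harmless value elsewhere. *)
  rewrite (_ : (fun x => _) =
      (fun x => \prod_(j <- s1) (\1_(if j \in s1 then B j else setT) (A j x)))).
    apply: measurable_prod => j _; apply: measurableT_comp => //.
    by apply: measurable_indic; case: ifPn => // /mBs.
  by apply/funext => x; apply: eq_big_seq => j ->.
have w01 x : 0 <= w x <= 1.
  have /andP[p0 p1] := prod01 s1 x (fun j x => I01 j B x).
  have /andP[q0 q1] := prod01 s2 x (fun j x => y01 j (n j) x).
  by rewrite mulr_ge0// mulr_ile1.
rewrite big_cons -mulrA [RHS]mulrC.
transitivity (\int[P]_x (w x * \1_(B i) (A i x))).
  by apply: eq_Rintegral => x _; rewrite big_cons -mulrA mulrC.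
apply: laplace_independence => //; last by apply: mB; rewrite mem_head.
move=> k.
have us' : uniq (s1 ++ i :: s2) by rewrite uniq_catC /= mem_cat orbC -mem_cat iS uniq_catC.
have Ds' j : j \in s1 ++ i :: s2 -> D j.
  by move=> js; apply: Ds; rewrite in_cons; move: js; rewrite !mem_cat in_cons orbCA.
have := IH (i :: s2) (fun j => if j == i then k else n j) us' Ds' mBs.
have E (f : nat -> nat -> R) : \prod_(j <- i :: s2) f j (if j == i then k else n j) =
    f i k * \prod_(j <- s2) f j (n j).
  rewrite big_cons eqxx; congr (_ * _); apply: eq_big_seq => j js.
  by case: eqP => // ji; move: iS; rewrite mem_cat -ji js orbT.
rewrite (E (fun j k => \int[P]_x (expR (- A j x) ^+ k))) => H.
rewrite -[RHS]mulrA [X in _ * X]mulrC -H.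
apply: eq_Rintegral => x _; rewrite /w (E (fun j k => expR (- A j x) ^+ k)).
by rewrite mulrCA mulrC.
Qed.

Lemma mutually_independent_of_laplace : mutually_independent D A.
Proof.
move=> J B JD mB.
have mAB j : j \in J -> measurable (A j @^-1` B j).
  by move=> jJ; rewrite -[X in measurable X]setTI; apply: measurable_funPT => //; exact: mB.
have IE j : j \in J -> \int[P]_x (\1_(B j) (A j x) : R) = fine (P (A j @^-1` B j)).
  move=> jJ; rewrite /Rintegral -(setIT (A j @^-1` B j)) -integral_indic//; last exact: mAB.
have := @independence_step J [::] (fun=> 0%N) B.
rewrite cats0 => /(_ (fset_uniq _) _ mB).
have JD' j : j \in (J : seq nat) -> D j by move=> jJ; exact: JD.
move=> /(_ JD'); rewrite big_nil mulr1.
under eq_Rintegral do rewrite big_nil mulr1.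
have mcap : measurable (\bigcap_(j in [set` J]) A j @^-1` B j).
  by apply: fin_bigcap_measurable => // j; exact: mAB.
rewrite (eq_big_seq (fun j => fine (P (A j @^-1` B j)))) => [H|j]; last exact: IE.
have -> : P (\bigcap_(j in [set` J]) A j @^-1` B j) =
    (\int[P]_x (\prod_(j <- J) \1_(B j) (A j x)))%:E.
  rewrite -(setIT (\bigcap_(j in _) _)) -integral_indic//.
  rewrite /Rintegral fineK.
    apply: eq_integral => x _; congr EFin.
    rewrite indicE; have [xJ|xJ] := pselect ((\bigcap_(j in [set` J]) A j @^-1` B j) x).
      rewrite mem_set// big_seq big1// => j jJ.
      by rewrite indicE mem_set//; exact: xJ.
    rewrite memNset//; have [j jJ AB] : exists2 j, j \in J & ~ B j (A j x).
      by apply: contrapT => h; apply: xJ => j jJ; apply: contrapT => h'; apply: h; exists j.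
    by rewrite (big_rem j)//= indicE memNset// mul0r.
  apply: (integrable_fin_num measurableT); apply: (@bounded_integrable _ _ _ _ _ 1).
    rewrite (_ : (fun x => _) =
        (fun x => \prod_(j <- J) (\1_(if j \in J then B j else setT) (A j x)))).
      apply: measurable_prod => j _; apply: measurableT_comp => //.
      by apply: measurable_indic; case: ifPn => // /mB.
    by apply/funext => x; apply: eq_big_seq => j ->.
  by move=> x; have /andP[p0 p1] := prod01 J x (fun j x => I01 j B x); rewrite ger0_norm.
rewrite H -prodEFin; apply: eq_big_seq => j jJ.
by rewrite fineK// fin_num_measure//; exact: mAB.
Qed.

End independence_criterion.

(** * Transfer of Gaussian integrals to random variables *)

Section standard_gaussian.
Context d (T : measurableType d) (R : realType) (P : probability T R).

Lemma measurable_cos : measurable_fun [set: R] (@cos R).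
Proof. by apply: continuous_measurable_fun; exact: continuous_cos. Qed.

Lemma ge0_integral_standard_gaussian (X : {RV P >-> R}) (f : R -> \bar R) :
  standard_gaussian X -> measurable_fun [set: R] f -> (forall x, 0 <= f x)%E ->
  (\int[P]_x f (X x) = \int[normal_prob 0 1]_y f y)%E.
Proof.
move=> gX mf f0.
(* [normal_prob] lives on [measurableTypeR R], whose display is not that of [R]. *)
have mX : measurable_fun [set: T] (X : T -> measurableTypeR R).
  by move=> mT B mB; exact: (measurable_funPT X mT B mB).
pose X' : {RV P >-> measurableTypeR R} := HB.pack (X : T -> measurableTypeR R)
  (isMeasurableFun.Build _ _ _ _ (X : T -> measurableTypeR R) mX).
have mf' : measurable_fun [set: measurableTypeR R] (f : measurableTypeR R -> \bar R).
  by move=> mT B mB; exact: (mf mT B mB).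
rewrite -[LHS](@ge0_integral_distribution _ _ _ _ _ P X' f mf' f0).
by apply: eq_measure_integral => B mB _; exact: gX.
Qed.

Lemma standard_gaussian_cos (X : {RV P >-> R}) (b : R) : standard_gaussian X ->
  \int[P]_x cos (b * X x) = expR (- (b ^+ 2 / 2)).
Proof.
move=> gX.
have mcos : measurable_fun [set: R] (fun y => cos (b * y)).
  by apply: measurableT_comp; [exact: measurable_cos|exact: measurable_funM].
have icos : P.-integrable setT (EFin \o (fun x => cos (b * X x))).
  apply: (@bounded_integrable _ _ _ _ (fun x => cos (b * X x)) 1).
    by apply: (measurableT_comp mcos).
  by move=> x; rewrite ler_norml cos_geN1 cos_le1.
have icos' : (normal_prob 0 1).-integrable setT (fun x => (cos (b * x))%:E).
  apply: (@bounded_integrable _ _ _ (normal_prob 0 1 : probability _ R) _ 1) => //.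
  by move=> x; rewrite ler_norml cos_geN1 cos_le1.
have : (\int[P]_x (1 + cos (b * X x))%:E = \int[normal_prob 0 1]_x (1 + cos (b * x))%:E)%E.
  apply: (@ge0_integral_standard_gaussian X (fun y => (1 + cos (b * y))%:E)) => //.
    exact/measurable_EFinP/measurable_funD.
under eq_integral do rewrite EFinD.
under [in RHS]eq_integral do rewrite EFinD.
rewrite !integralD//=; try exact: finite_measure_integrable_cst.
rewrite !integral_cst//= !probability_setT !mule1 integral_normal_prob_cos.
rewrite -(fineK (integrable_fin_num measurableT icos)).
by rewrite -EFinD => -[/addrI e]; exact: e.
Qed.

Lemma standard_gaussian_expR_sqr (X : {RV P >-> R}) (t : R) : standard_gaussian X ->
  t < 2^-1 ->
  (\int[P]_x (expR (t * X x ^+ 2))%:E = ((1 - 2 * t) `^ (- 2^-1))%:E)%E.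
Proof.
move=> gX t2; rewrite -integral_normal_prob_expR_sqr//.
apply: (@ge0_integral_standard_gaussian X (fun y => (expR (t * y ^+ 2))%:E)) => //.
  apply/measurable_EFinP; apply: measurableT_comp => //.
  by apply: measurable_funM => //; exact: measurable_funX.
Qed.

End standard_gaussian.

(** * Characteristic functions of white noise *)

Section white_noise.
Context {R : realType} {d} {T : measurableType d} (P : probability T R).
Context {Y : hilbertType R} (Z : Y -> {RV P >-> R}).
Hypothesis hZ : gaussian_white_noise Z.

Lemma white_noise0 : {ae P, forall w, Z 0 w = 0}.
Proof.
have := wn_linear hZ 1 0 0; apply: filterS => w.
by rewrite scaler0 addr0 mul1r => /eqP; rewrite -subr_eq subrr eq_sym => /eqP.
Qed.

Lemma white_noise_scale a y : {ae P, forall w, Z (a *: y) w = a * Z y w}.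
Proof.
have := white_noise0; have := wn_linear hZ a y 0; apply: filterS2 => w.
by rewrite addr0 => -> ->; rewrite addr0.
Qed.

Lemma white_noise_sum (u : nat -> Y) (b : nat -> R) (s : seq nat) :
  {ae P, forall w, Z (\sum_(j <- s) b j *: u j) w = \sum_(j <- s) b j * Z (u j) w}.
Proof.
elim: s => [|i s IH].
  have := white_noise0; apply: filterS => w.
  by rewrite !big_nil.
have := IH; have := wn_linear hZ (b i) (u i) (\sum_(j <- s) b j *: u j).
by apply: filterS2 => w; rewrite !big_cons => -> ->.
Qed.

Lemma ae_eq_Rintegral (f g : T -> R) : measurable_fun setT f -> measurable_fun setT g ->
  {ae P, forall w, f w = g w} -> \int[P]_x f x = \int[P]_x g x.
Proof.
move=> mf mg fg; rewrite /Rintegral; congr fine; apply: ae_eq_integral => //.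
- exact/measurable_EFinP.
- exact/measurable_EFinP.
- by apply: filterS fg => w -> _.
Qed.

(** Gaussianity is assumed for normalised arguments only. The scaling is undone almost surely, and y
    = 0 is separate because Z 0 vanishes almost surely. *)
Lemma white_noise_cos y : \int[P]_x cos (Z y x) = expR (- (`|y| ^+ 2 / 2)).
Proof.
have mZ z : measurable_fun setT (fun x => cos (Z z x)).
  by apply: measurableT_comp => //; exact: measurable_cos.
have [->|y0] := eqVneq y 0.
  rewrite normr0 expr0n mul0r oppr0 expR0.
  rewrite (@ae_eq_Rintegral _ (fun=> 1))//.
    by rewrite Rintegral_cst// mul1r; exact: (congr1 fine (@probability_setT _ _ _ P)).
  by apply: filterS white_noise0 => w ->; rewrite cos0.
rewrite -(@standard_gaussian_cos _ _ _ _ (Z (`|y|^-1 *: y)))//; last exact: wn_gaussian.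
apply: ae_eq_Rintegral => //.
  by apply: measurableT_comp; [exact: measurable_cos|exact: measurable_funM].
have := white_noise_scale (`|y|) (`|y|^-1 *: y); apply: filterS => w.
by rewrite scalerA divff ?normr_eq0// scale1r => ->.
Qed.

Variables (D : set nat) (u : nat -> Y).
Hypothesis ou : forall i j, D i -> D j -> '[u i, u j] = (i == j)%:R.

(** By linearity the combination is almost surely Z at a vector whose squared norm is the sum of the
    b_j^2; no independence enters. *)
Lemma white_noise_cos_sum (b : nat -> R) (s : seq nat) :
  uniq s -> (forall j, j \in s -> D j) ->
  \int[P]_x cos (\sum_(j <- s) b j * Z (u j) x) =
  expR (- ((\sum_(j <- s) b j ^+ 2) / 2)).
Proof.
move=> us sD; rewrite -(@norm_sum_orthonormal _ _ u)//; last first.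
  by move=> i j /sD Di /sD Dj; exact: ou.
rewrite -white_noise_cos; apply: ae_eq_Rintegral.
- apply: measurableT_comp; first exact: measurable_cos.
  by apply: measurable_sum => j; exact: measurable_funM.
- by apply: measurableT_comp => //; exact: measurable_cos.
- by have := white_noise_sum u b s; apply: filterS => w ->.
Qed.

End white_noise.

Lemma bounded_Fubini d d' (T : measurableType d) (T' : measurableType d') (R : realType)
    (P : probability T R) (Q : probability T' R) (f : T * T' -> R) (M : R) :
  measurable_fun setT f -> (forall z, `|f z| <= M) ->
  \int[P]_x \int[Q]_y f (x, y) = \int[Q]_y \int[P]_x f (x, y).
Proof.
move=> mf fM.
have mfE : measurable_fun setT (EFin \o f) by exact/measurable_EFinP.
have i1 x : Q.-integrable setT (fun y => (f (x, y))%:E).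
  by apply: (@bounded_integrable _ _ _ _ (fun y => f (x, y)) M) => //; exact: measurableT_comp.
have i2 y : P.-integrable setT (fun x => (f (x, y))%:E).
  by apply: (@bounded_integrable _ _ _ _ (fun x => f (x, y)) M) => //; exact: measurableT_comp.
have ifP : (P \x Q)%E.-integrable setT (EFin \o f).
  apply/(integrable12ltyP P Q mfE).
  apply: (@le_lt_trans _ _ (\int[P]_x M%:E)%E); last first.
    by rewrite integral_cst//= probability_setT mule1 ltry.
  apply: ge0_le_integral => //.
  - by move=> x _; exact: integral_ge0.
  - apply: (measurable_fun_fubini_tonelli_F (m2 := Q) (fun z => abse ((EFin \o f) z))) => //.
    exact: (measurableT_comp (@abse_measurable _ _) mfE).
  - move=> x _.
    apply: (@le_trans _ _ (\int[Q]_y M%:E)%E); last first.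
      by rewrite integral_cst//= probability_setT mule1.
    apply: ge0_le_integral => //.
    + by apply: measurableT_comp => //; exact: measurableT_comp.
    + by move=> y _; rewrite lee_fin.
rewrite /Rintegral; congr fine.
under eq_integral do rewrite fineK ?(integrable_fin_num measurableT)//.
under [RHS]eq_integral do rewrite fineK ?(integrable_fin_num measurableT)//.
exact: (Fubini ifP).
Qed.

(** * Independence of the squared noise coefficients *)

Section white_noise_squares.
Context {R : realType} {d} {T : measurableType d} (P : probability T R).
Context {Y : hilbertType R} (Z : Y -> {RV P >-> R}).
Hypothesis hZ : gaussian_white_noise Z.
Variables (D : set nat) (u : nat -> Y).
Hypothesis ou : forall i j, D i -> D j -> '[u i, u j] = (i == j)%:R.

Let sqlap (s : seq nat) (n : nat -> nat) x : R :=
  \prod_(j <- s) expR (- (Z (u j) x) ^+ 2) ^+ n j.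

Let msqlap s n : measurable_fun setT (sqlap s n).
Proof.
apply: measurable_prod => j _; apply: measurable_funX; apply: measurableT_comp => //.
by apply: measurableT_comp => //; exact: measurable_funX.
Qed.

Let sqlap01 s n x : 0 <= sqlap s n x <= 1.
Proof.
rewrite /sqlap; elim: s => [|j s /andP[s0 s1]]; first by rewrite big_nil lexx ler01.
have e01 : 0 <= expR (- (Z (u j) x) ^+ 2) ^+ n j <= 1.
  by rewrite exprn_ge0 ?exprn_ile1 ?expR_ge0// expR_le1 oppr_le0 sqr_ge0.
by rewrite big_cons; have /andP[e0 e1] := e01; rewrite mulr_ge0// mulr_ile1.
Qed.

Let lin (s : seq nat) (b : nat -> R) x := \sum_(j <- s) b j * Z (u j) x.

Let mlin s b : measurable_fun setT (lin s b).
Proof. by apply: measurable_sum => j; exact: measurable_funM. Qed.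

Let cos1 (x : R) : `|cos x| <= 1. Proof. by rewrite ler_norml cos_geN1 cos_le1. Qed.

Let bnd1 (a b : R) : 0 <= a <= 1 -> `|b| <= 1 -> `|a * b| <= 1.
Proof. by move=> /andP[a0 a1] b1; rewrite normrM (ger0_norm a0) mulr_ile1. Qed.

(* Each factor exp (- n Z_i^2) is the mean of cos (sqrt (2 n) g Z_i) over an
   auxiliary standard Gaussian g. *)
Let laplace_cos (s1 s2 : seq nat) (n : nat -> nat) (b : nat -> R) :
  uniq (s1 ++ s2) -> (forall j, j \in s1 ++ s2 -> D j) ->
  \int[P]_x (sqlap s1 n x * cos (lin s2 b x)) =
  (\prod_(j <- s1) (1 + 2 * (n j)%:R) `^ (- 2^-1)) * expR (- ((\sum_(j <- s2) b j ^+ 2) / 2)).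
Proof.
elim: s1 => [|i s1 IH] in s2 b *.
  move=> us Ds; rewrite big_nil mul1r -(white_noise_cos_sum hZ ou)//.
  by apply: eq_Rintegral => x _; rewrite /sqlap big_nil mul1r.
rewrite cat_cons cons_uniq => /andP[iS us] Ds.
have us' : uniq (s1 ++ i :: s2) by rewrite uniq_catC /= mem_cat orbC -mem_cat iS uniq_catC.
have Ds' j : j \in s1 ++ i :: s2 -> D j.
  by move=> js; apply: Ds; rewrite in_cons; move: js; rewrite !mem_cat in_cons orbCA.
pose C := \prod_(j <- s1) (1 + 2 * (n j)%:R : R) `^ (- 2^-1).
pose al : R := Num.sqrt (2 * (n i)%:R).
have al2 : al ^+ 2 = 2 * (n i)%:R by rewrite sqr_sqrtr// mulr_ge0.
pose S := \sum_(j <- s2) b j ^+ 2.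
have upd (g : R) : \int[P]_x (sqlap s1 n x * cos (g * Z (u i) x + lin s2 b x)) =
    C * expR (- ((g ^+ 2 + S) / 2)).
  have := IH (i :: s2) (fun j => if j == i then g else b j) us' Ds'.
  have E (f : nat -> R -> R) : \sum_(j <- i :: s2) f j (if j == i then g else b j) =
      f i g + \sum_(j <- s2) f j (b j).
    rewrite big_cons eqxx; congr (_ + _); apply: eq_big_seq => j js.
    by case: eqP => // ji; move: iS; rewrite mem_cat -ji js orbT.
  rewrite (E (fun j c => c ^+ 2)) => <-.
  by apply: eq_Rintegral => x _; rewrite /lin (E (fun j c => c * Z (u j) x)).
(* For fixed g the product of the two cosines is the average of cos (L + al g Z_i) and cos (L - al g
   Z_i), with L the combination [lin s2 b]; both are covered by [upd]. *)
have inner2 (g : R) : \int[P]_x (sqlap s1 n x * cos (lin s2 b x) * cos (al * Z (u i) x * g)) =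
    C * expR (- (S / 2)) * expR (- (n i)%:R * g ^+ 2).
  have i1 c : P.-integrable setT (EFin \o (fun x => sqlap s1 n x * cos (c * Z (u i) x + lin s2 b x))).
    apply: (@bounded_integrable _ _ _ _ _ 1); last by move=> x; exact: bnd1.
    apply: measurable_funM => //; apply: measurableT_comp; first exact: (@measurable_cos R).
    by apply: measurable_funD => //; exact: measurable_funM.
  transitivity (\int[P]_x (2^-1 * (sqlap s1 n x * cos (al * g * Z (u i) x + lin s2 b x) +
      sqlap s1 n x * cos (- (al * g) * Z (u i) x + lin s2 b x)))).
    apply: eq_Rintegral => x _.
    rewrite !cosD mulNr cosN sinN (mulrAC al g).
    by field.
  rewrite RintegralZl//; last exact: (integrableD measurableT (i1 _) (i1 _)).
  rewrite RintegralD//.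
  rewrite !upd sqrrN exprMn al2 -mulrA -expRD.
  rewrite (_ : (2 * (n i)%:R * g ^+ 2 + S) / 2 = S / 2 + (n i)%:R * g ^+ 2); last by field.
  by rewrite opprD mulNr; field.
have mid : measurable_fun [set: measurableTypeR R] (fun x => x : R).
  by move=> mT B mB; rewrite setTI.
have inner1 x : \int[normal_prob 0 1]_g
      (sqlap s1 n x * cos (lin s2 b x) * cos (al * Z (u i) x * g)) =
    sqlap (i :: s1) n x * cos (lin s2 b x).
  rewrite RintegralZl//; last first.
    apply: (@bounded_integrable _ _ _ (normal_prob 0 1 : probability _ R) _ 1) => //.
    have h : measurable_fun [set: R] (fun g => cos (al * Z (u i) x * g)).
      by apply: (measurableT_comp (@measurable_cos R)); exact: measurable_funM.
    by move=> mT B mB; exact: (h mT B mB).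
  rewrite /Rintegral integral_normal_prob_cos /= exprMn al2 /sqlap big_cons.
  rewrite -expRM_natl mulrAC; congr (_ * _); rewrite mulrC; congr (expR _ * _).
  by field.
transitivity (\int[P]_x \int[normal_prob 0 1]_g
      (sqlap s1 n x * cos (lin s2 b x) * cos (al * Z (u i) x * g))).
  by apply: eq_Rintegral => x _; rewrite inner1.
(* After the exchange, the mean of exp (- n_i g^2) over g supplies the new factor (1 + 2 n_i)^(-
   1/2). *)
rewrite (@bounded_Fubini _ _ _ _ _ P (normal_prob 0 1 : probability _ R)
  (fun z => sqlap s1 n z.1 * cos (lin s2 b z.1) * cos (al * Z (u i) z.1 * z.2)) 1).
- transitivity (\int[normal_prob 0 1]_g (C * expR (- (S / 2)) * expR (- (n i)%:R * g ^+ 2))).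
    by apply: eq_Rintegral => g _; exact: inner2.
  have n2 : - (n i)%:R < 2^-1 :> R by rewrite (le_lt_trans (_ : _ <= 0))// ?oppr_le0.
  have ie : (normal_prob 0 1).-integrable setT
      (EFin \o (fun g : R => expR (- (n i)%:R * g ^+ 2))).
    apply: (@bounded_integrable _ _ _ (normal_prob 0 1 : probability _ R) _ 1) => //.
      by apply: measurableT_comp => //; apply: measurable_funM => //; exact: measurable_funX.
    by move=> g; rewrite ger0_norm ?expR_ge0// expR_le1 mulNr oppr_le0 mulr_ge0 ?sqr_ge0.
  rewrite RintegralZl// /Rintegral integral_normal_prob_expR_sqr//=.
  by rewrite big_cons mulrN opprK -/C -/S; ring.
- apply: measurable_funM.
    apply: measurable_funM; first exact: (measurableT_comp (msqlap s1 n)).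
    apply: (measurableT_comp (@measurable_cos R)).
    exact: (measurableT_comp (mlin s2 b)).
  apply: (measurableT_comp (@measurable_cos R)).
  apply: measurable_funM => //; apply: measurable_funM => //.
  exact: measurableT_comp.
- by move=> z; rewrite -mulrA bnd1// normrM mulr_ile1.
Qed.

(** Squares rather than the coefficients themselves: the criterion asks for nonnegative variables,
    and the deviation inequality sees the noise only through its squares. *)
Lemma white_noise_sqr_independent :
  mutually_independent D (fun j => (Z (u j) ^+ 2 : {mfun T >-> R}) : {RV P >-> R}).
Proof.
apply: mutually_independent_of_laplace => [j x|s n us sD].
  by rewrite /= sqr_ge0.
have L s' : uniq s' -> (forall j, j \in s' -> D j) -> \int[P]_x sqlap s' n x =
    \prod_(j <- s') (1 + 2 * (n j)%:R) `^ (- 2^-1).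
  move=> us' sD'.
  have := @laplace_cos s' [::] n (fun=> 0); rewrite cats0 => /(_ us' sD').
  rewrite big_nil mul0r oppr0 expR0 mulr1 => <-.
  by apply: eq_Rintegral => x _; rewrite /lin big_nil cos0 mulr1.
rewrite [LHS](L s us sD); apply: eq_big_seq => j js.
have := L [:: j] isT; rewrite big_seq1 => <-; last by move=> k; rewrite inE => /eqP ->; exact: sD.
by apply: eq_Rintegral => x _; rewrite /sqlap big_seq1.
Qed.

End white_noise_squares.

(** * Ville's inequality for products of independent factors *)

Section past.
Context d (T : measurableType d) (R : realType) (P : probability T R).
Variable (X : nat -> {RV P >-> R}).
Hypothesis hX : mutually_independent [set j | (0 < j)%N] X.

(* Rectangles in the variables X_1, ..., X_N. *)
Definition past_rectangles (N : nat) : set (set T) :=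
  [set A | exists2 B : nat -> set R, forall j, measurable (B j) &
    A = \bigcap_(j in [set` [fset j | j in iota 1 N]%fset]) (X j @^-1` B j)].

Local Notation G := past_rectangles.

Lemma past_rectangles_measurable N : G N `<=` measurable.
Proof.
move=> _ [B mB ->]; apply: fin_bigcap_measurable; first exact: finite_fset.
by move=> j _; rewrite -[X in measurable X]setTI; exact: measurable_funPT.
Qed.

Lemma past_rectangles_setT N : G N setT.
Proof.
by exists (fun=> setT) => //; rewrite bigcapT.
Qed.

Lemma past_rectangles_setI N : setI_closed (G N).
Proof.
move=> _ _ [B mB ->] [C mC ->]; exists (fun j => B j `&` C j).
  by move=> j; exact: measurableI.
by rewrite -bigcapI; apply: eq_bigcapr => j _; rewrite preimage_setI.
Qed.

(** Both sides are finite measures in A that agree on the rectangles, by independence for the index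
    set enlarged by N + 1; rectangles are stable under intersection and generate the past. *)
Lemma past_independent N A (B : set R) : <<s G N >> A -> measurable B ->
  P (A `&` X N.+1 @^-1` B) = (P A * P (X N.+1 @^-1` B))%E.
Proof.
move=> sA mB.
have mC : measurable (X N.+1 @^-1` B).
  by rewrite -[X in measurable X]setTI; exact: measurable_funPT.
set C := X N.+1 @^-1` B in mC *.
have fC : P C \is a fin_num by exact: fin_num_measure.
pose r : {nonneg R} := NngNum (fine_ge0 (measure_ge0 P C)).
have := @g_sigma_algebra_measure_unique _ _ _ (G N) (@past_rectangles_measurable N)
  (fun=> setT) (fun=> past_rectangles_setT N) _ (mrestr P mC) (mscale r P)
  (@past_rectangles_setI N).
move=> /(_ _ _ _ A sA); rewrite /mrestr/= /mscale/= fineK// muleC; apply.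
- by rewrite bigcup_const//; exists 0%N.
- move=> _ [D mD ->]; rewrite /mrestr.
  pose J := [fset j | j in iota 1 N]%fset.
  pose J' := (N.+1 |` J)%fset.
  have NJ : N.+1 \notin J by rewrite !inE/= mem_iota add1n ltnn andbF.
  have J0 j : j \in J -> (0 < j)%N by rewrite !inE/= mem_iota => /andP[].
  pose D' j := if j == N.+1 then B else D j.
  have DE j : j \in J -> D' j = D j.
    by move=> jJ; rewrite /D'; case: eqP => // jN; move: NJ; rewrite -jN jJ.
  have mD' j : measurable (D' j) by rewrite /D'; case: ifP.
  have h1 := @hX J D J0 (fun j _ => mD j).
  have := @hX J' D' _ (fun j _ => mD' j).
  rewrite big_fsetU1//= {2}/D' eqxx => h2.
  rewrite -/J (_ : _ `&` C = \bigcap_(j in [set` J']) (X j @^-1` D' j)).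
    rewrite h2; last by move=> j /=; rewrite in_fset1U => /orP[/eqP->//|]; exact: J0.
    rewrite h1; congr (_ * _)%E; apply: eq_big_seq => j jJ; by rewrite DE.
  rewrite set_fsetU1 bigcap_setU1 setIC /D' eqxx; congr (_ `&` _).
  by apply: eq_bigcapr => j jJ; rewrite -/(D' j) DE.
- by move=> _; rewrite /mrestr setTI (le_lt_trans (probability_le1 _ _))// ltry.
Qed.

Local Notation past N := (g_sigma_algebraType (G N)).

Lemma measurable_past N j : (0 < j <= N)%N ->
  measurable_fun [set: past N] (X j : past N -> R).
Proof.
move=> jN mT B mB; rewrite setTI; apply: sub_sigma_algebra.
exists (fun i => if i == j then B else setT); first by move=> i; case: ifP.
apply/seteqP; split => x /=.
  by move=> xB i _ /=; case: eqP => // ->.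
by move=> /(_ j); rewrite /= eqxx; apply; rewrite !inE/= mem_iota add1n ltnS.
Qed.

(** The identity, read as a map into the coarser space [past N], and X_(N+1) are independent. Their
    joint law is therefore a product measure, and Tonelli splits the integral. *)
Lemma integral_past_mul N (F : T -> R) (h : R -> R) :
  measurable_fun [set: past N] (F : past N -> R) -> (forall x, 0 <= F x) ->
  measurable_fun setT h -> (forall x, 0 <= h x) ->
  (\int[P]_x (F x * h (X N.+1 x))%:E =
   (\int[P]_x (F x)%:E) * \int[P]_x (h (X N.+1 x))%:E)%E.
Proof.
move=> mF F0 mh h0.
have mid : measurable_fun [set: T] (id : T -> past N).
  move=> mT A mA; rewrite setTI; move: A mA.
  by apply: smallest_sub; [exact: sigma_algebra_measurable|exact: past_rectangles_measurable].
pose I : {mfun T >-> past N} := HB.pack (id : T -> past N)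
  (isMeasurableFun.Build _ _ _ _ (id : T -> past N) mid).
have mphi : measurable_fun [set: T] (fun x => (I x, X N.+1 x) : past N * R).
  by apply: measurable_fun_pair => //; exact: measurable_funPT.
pose phi : {mfun T >-> (past N * R)%type} := HB.pack (fun x => (I x, X N.+1 x) : past N * R)
  (isMeasurableFun.Build _ _ _ _ (fun x => (I x, X N.+1 x) : past N * R) mphi).
pose P1 := distribution P I.
pose P2 := distribution P (X N.+1).
pose m' := distribution P phi.
have mf : measurable_fun [set: past N * R] (fun z => (F z.1 * h z.2)%:E).
  apply/measurable_EFinP; apply: measurable_funM; first exact: (measurableT_comp mF).
  exact: (measurableT_comp mh).
transitivity (\int[m']_z (F z.1 * h z.2)%:E)%E.
  by rewrite ge0_integral_distribution// => z; rewrite lee_fin mulr_ge0.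
have E A : measurable A -> (P1 \x P2)%E A = m' A.
  apply: product_measure_unique => B C mB mC.
  exact: past_independent.
transitivity (\int[(P1 \x P2)%E]_z (F z.1 * h z.2)%:E)%E.
  by apply: eq_measure_integral => A mA _; symmetry; exact: E.
rewrite fubini_tonelli1//; last by move=> z; rewrite lee_fin mulr_ge0.
rewrite /fubini_F /=.
have -> : (\int[P]_x (h (X N.+1 x))%:E = \int[P2]_y (h y)%:E)%E.
  by rewrite ge0_integral_distribution//; exact/measurable_EFinP.
have -> : (\int[P]_x (F x)%:E = \int[P1]_y (F y)%:E)%E.
  by rewrite ge0_integral_distribution//; exact/measurable_EFinP.
rewrite -ge0_integralZr//; first last.
- by apply: integral_ge0 => y _; rewrite lee_fin.
- by move=> y _; rewrite lee_fin.
- exact/measurable_EFinP.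
apply: eq_integral => x _; under eq_integral do rewrite EFinM.
rewrite ge0_integralZl_EFin//; last 2 first.
- by move=> y _; rewrite lee_fin.
- exact/measurable_EFinP.
Qed.

Variables (g : R -> R) (rho : R).
Hypotheses (mg : measurable_fun setT g) (g0 : forall x, 0 <= g x).
Hypothesis (grho : forall j, (0 < j)%N -> (\int[P]_x (g (X j x))%:E = rho%:E)%E).
Hypothesis rho1 : rho <= 1.

Let M k x := \prod_(1 <= j < k.+1) g (X j x).

Let rho0 : 0 <= rho.
Proof.
by rewrite -lee_fin -(grho (isT : (0 < 1)%N)) integral_ge0// => x _; rewrite lee_fin.
Qed.

Let M0 k x : 0 <= M k x. Proof. exact: prodr_ge0. Qed.

Let mM k N : (k <= N)%N -> measurable_fun [set: past N] (M k : past N -> R).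
Proof.
move=> kN.
apply: (@measurable_prod _ (past N) _ _ _ _ (fun j (x : past N) => g (X j x))) => j.
rewrite mem_index_iota => /andP[j0 jk].
have jN : (0 < j <= N)%N by rewrite j0 (leq_trans _ kN).
exact: (measurableT_comp mg (measurable_past jN)).
Qed.

Let integral_M k : (\int[P]_x (M k x)%:E = (rho ^+ k)%:E)%E.
Proof.
elim: k => [|k IH].
  under eq_integral do rewrite /M big_geq//.
  by rewrite integral_cst//= probability_setT mule1.
under eq_integral do rewrite /M big_nat_recr//=.
by rewrite (@integral_past_mul k (M k) g)// ?IH ?grho// ?exprSr//; exact: mM.
Qed.

Let hit n N : set T := \bigcup_(k in [set k | (n <= k <= N)%N]) [set x | 1 <= M k x].

Let mhit n N : measurable (hit n N : set (past N)).
Proof.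
apply: bigcup_measurable => k /andP[nk kN].
rewrite -[X in measurable X]setTI.
exact: (measurable_fun_le (d := (G N).-sigma) (T := past N) measurableT (measurable_cst (1 : R)) (mM kN)).
Qed.

Let past_sub N (A : set T) : measurable (A : set (past N)) -> measurable A.
Proof.
move: A; apply: smallest_sub; first exact: sigma_algebra_measurable.
exact: past_rectangles_measurable.
Qed.

(** The product stopped when it first reaches 1 at an index k >= n, with the stopped value lowered
    to 1. Its mean does not increase with N because rho <= 1, and it dominates the indicator of
    [hit n N]. *)
Let F n N x : R := if x \in hit n N then 1 else M N x.

Let hitS n N x : x \in hit n N -> x \in hit n N.+1.
Proof.
rewrite !inE => -[k /= /andP[nk kN] Mk]; exists k => //=.
by rewrite nk leqW.
Qed.

Let mem_mhit n N : measurable_fun [set: past N] (fun x : past N => x \in hit n N).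
Proof.
apply: (measurable_fun_bool true); rewrite setTI.
rewrite (_ : _ @^-1` _ = hit n N); first exact: (@mhit n N).
by apply/seteqP; split => x; [exact: set_mem|exact: mem_set].
Qed.

Let mFpast n N : measurable_fun [set: past N] (F n N : past N -> R).
Proof.
apply: measurable_fun_if => //.
by apply: measurable_funTS; exact: mM.
Qed.

Let mF n N : measurable_fun [set: T] (F n N).
Proof.
by move=> mT B mB; apply: (@past_sub N); exact: mFpast.
Qed.

Let F0 n N x : 0 <= F n N x.
Proof. by rewrite /F; case: ifP. Qed.

Let le_int (f h : T -> R) : measurable_fun setT f -> measurable_fun setT h ->
  (forall x, 0 <= f x <= h x) -> (\int[P]_x (f x)%:E <= \int[P]_x (h x)%:E)%E.
Proof.
move=> mf mh fh; have f0 x : 0 <= f x by have /andP[] := fh x.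
have fleh x : f x <= h x by have /andP[] := fh x.
have h0 x : 0 <= h x := le_trans (f0 x) (fleh x).
by apply: ge0_le_integral => //;
  do ?[exact/measurable_EFinP|by move=> x _; rewrite lee_fin].
Qed.

Let integral_F n N : (n <= N)%N -> (\int[P]_x (F n N x)%:E <= (rho ^+ n)%:E)%E.
Proof.
have mMT k : measurable_fun [set: T] (M k).
  by move=> mT B mB; apply: (@past_sub k); exact: mM.
elim: N => [|N IH].
  rewrite leqn0 => /eqP ->; rewrite -integral_M.
  apply: le_int => // x; rewrite F0/= /F; case: ifP => // _; by rewrite /M big_geq.
rewrite leq_eqVlt => /orP[/eqP nN|]; last rewrite ltnS => nN.
  rewrite -integral_M; apply: le_int => // x; rewrite F0/= /F; case: ifP => [|_].
    by rewrite inE => -[k /= ]; rewrite nN -eqn_leq => /eqP <-.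
  by rewrite nN.
apply: (le_trans _ (IH nN)).
(* F is the indicator h of the stopped paths plus the value W on the others; the next factor
   multiplies the mean of W by rho <= 1. *)
pose h := fun x => (x \in hit n N)%:R : R.
pose W := fun x => (x \notin hit n N)%:R * M N x.
have mh : measurable_fun [set: past N] (h : past N -> R).
  by rewrite (_ : h = \1_(hit n N))//; apply/funext => x; rewrite indicE.
have mW : measurable_fun [set: past N] (W : past N -> R).
  rewrite (_ : W = fun x => (1 - h x) * M N x).
    by apply: measurable_funM; [exact: measurable_funB|exact: mM].
  by apply/funext => x; rewrite /W /h; case: (x \in _); rewrite /= ?subrr ?subr0.
have toT (f : T -> R) : measurable_fun [set: past N] (f : past N -> R) -> measurable_fun [set: T] f.
  by move=> mf mT B mB; apply: (@past_sub N); exact: mf.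
have W0 x : 0 <= W x by rewrite mulr_ge0.
have h0 x : 0 <= h x by [].
have FE x : F n N x = h x + W x.
  by rewrite /F /h /W; case: (x \in _); rewrite ?mul0r ?addr0 ?mul1r ?add0r.
have mWg : measurable_fun [set: T] (fun x => W x * g (X N.+1 x)).
  by apply: measurable_funM; [exact: toT|exact: measurableT_comp].
have mhT := toT h mh.
have mWT := toT W mW.
apply: (@le_trans _ _ (\int[P]_x (h x + W x * g (X N.+1 x))%:E)%E).
  apply: le_int => //; first exact: measurable_funD.
  move=> x; rewrite F0/= /F /h /W.
  have [hx|hx] := boolP (x \in hit n N).
    by rewrite hitS// mul0r mul0r addr0.
  rewrite /= mul1r add0r; have MS : M N.+1 x = M N x * g (X N.+1 x) by rewrite /M big_nat_recr.
  rewrite -MS; case: ifP => //; rewrite inE => -[k /= /andP[nk]].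
  rewrite leq_eqVlt => /orP[/eqP -> //|]; rewrite ltnS => kN Mk.
  by move: hx; rewrite notin_setE => /(_ _); case; exists k => //=; rewrite nk.
under eq_integral do rewrite EFinD.
under [leRHS]eq_integral do rewrite FE EFinD.
rewrite !ge0_integralD//; do ?[exact/measurable_EFinP|by move=> x _; rewrite lee_fin ?mulr_ge0].
rewrite leeD2l// integral_past_mul// grho//.
have iW : (0 <= \int[P]_x (W x)%:E)%E by apply: integral_ge0 => x _; rewrite lee_fin.
by rewrite -[leRHS]mule1 lee_wpmul2l// lee_fin.
Qed.

Lemma ville n :
  (P (\bigcup_(k in [set k | (n <= k)%N]) [set x | (1 <= \prod_(1 <= j < k.+1) g (X j x))%R])
    <= (rho ^+ n)%:E)%E.
Proof.
have mH N : measurable (hit n N) by apply: (@past_sub N); exact: (@mhit n N).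
have -> : \bigcup_(k in [set k | (n <= k)%N]) [set x | (1 <= \prod_(1 <= j < k.+1) g (X j x))%R] =
    \bigcup_N hit n N.
  apply/seteqP; split => x.
    by move=> [k /= nk Mk]; exists k => //; exists k => //=; rewrite nk leqnn.
  by move=> [N _ [k /= /andP[nk _] Mk]]; exists k.
have nd : nondecreasing_seq (hit n).
  move=> N N' NN'; apply/subsetPset => x [k /= /andP[nk kN] Mk]; exists k => //=.
  by rewrite nk (leq_trans kN).
have cv := @nondecreasing_cvg_mu _ _ _ P _ mH (bigcup_measurable (fun k _ => mH k)) nd.
rewrite -(cvg_lim _ cv)//; apply: lime_le; first by apply/cvg_ex; eexists; exact: cv.
apply: nearW => N /=.
have [nN|Nn] := leqP n N; last first.
  rewrite (_ : hit n N = set0) ?measure0 ?lee_fin ?exprn_ge0//.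
  by rewrite -subset0 => x [k /= /andP[nk /(leq_trans nk)]]; rewrite leqNgt Nn.
apply: (le_trans _ (integral_F nN)).
rewrite -[hit n N]setIT -integral_indic//.
apply: le_int => // x.
by rewrite indicE /F; case: ifP; rewrite ?ler01 ?lexx ?M0.
Qed.

End past.

(** * Chernoff bounds for chi-square sums, uniform in the index *)

Section chi_square_deviations.
Context d (T : measurableType d) (R : realType) (P : probability T R).
Variables (X : nat -> {RV P >-> R}) (f : R -> R).
Hypothesis hX : mutually_independent [set j | (0 < j)%N] X.
Hypothesis mf : measurable_fun setT f.
Hypothesis mgf : forall j (t : R), (0 < j)%N -> t < 2^-1 ->
  (\int[P]_x (expR (t * f (X j x)))%:E = ((1 - 2 * t) `^ (- 2^-1))%:E)%E.

Let S k x := \sum_(1 <= j < k.+1) f (X j x).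

(* The Chernoff parameter t = (c - 1) / (2 c) minimises E exp (t (f X - c)). *)
Lemma chi_square_deviation (c : R) (n : nat) : 0 < c ->
  (P (\bigcup_(k in [set k | (n <= k)%N]) [set x | (0 <= (c - 1) * (S k x - k%:R * c))%R])
    <= (expR (- (n%:R * ((c - 1 - ln c) / 2))))%:E)%E.
Proof.
move=> c0; pose t := (c - 1) / (2 * c).
pose g x := expR (t * (f x - c)).
pose rho := expR (- ((c - 1 - ln c) / 2)).
have c20 : 0 < 2 * c by rewrite mulr_gt0.
have t2 : 1 - 2 * t = c^-1 by rewrite /t; field; rewrite gt_eqF.
have mg : measurable_fun setT g.
  by apply: measurableT_comp => //; apply: measurable_funM => //; exact: measurable_funB.
have g0 x : 0 <= g x by exact: expR_ge0.
(* 1 - 2 t = 1 / c and t c = (c - 1) / 2, so the mean is c^(1/2) exp (- (c - 1) / 2). *)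
have grho j : (0 < j)%N -> (\int[P]_x (g (X j x))%:E = rho%:E)%E.
  move=> j0; rewrite /g; under eq_integral do rewrite mulrBr expRD mulrC EFinM.
  rewrite ge0_integralZl_EFin//; last first.
    apply/measurable_EFinP; apply: measurableT_comp => //.
    by apply: measurable_funM => //; exact: measurableT_comp.
  rewrite mgf//; last by have := t2; have : 0 < c^-1; [rewrite invr_gt0|lra].
  rewrite t2 -EFinM; congr (_%:E); rewrite /powR invr_eq0 gt_eqF// -expRD lnV ?posrE//.
  by congr expR; rewrite /t; field; rewrite gt_eqF.
have rho1 : rho <= 1.
  rewrite expR_le1 oppr_le0 divr_ge0// subr_ge0.
  rewrite -[X in ln X](subrKC 1); apply: le_ln1Dx.
  by rewrite ltrBrDr addrC subrr.
have := ville hX mg g0 grho rho1 n.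
have -> : rho ^+ n = expR (- (n%:R * ((c - 1 - ln c) / 2))).
  by rewrite -expRM_natl mulrN.
apply: le_trans; rewrite [leRHS](_ : _ = P (\bigcup_(k in [set k | (n <= k)%N])
  [set x | (0 <= (c - 1) * (S k x - k%:R * c))%R]))//.
congr (P _); apply: eq_bigcupr => k _; apply/funext => x; apply/propext => /=.
have -> : \prod_(1 <= j < k.+1) g (X j x) = expR (t * (S k x - k%:R * c)).
  rewrite /g -expR_sum; congr expR; rewrite -mulr_sumr; congr (_ * _).
  by rewrite sumrB sumr_const_nat subn1 mulr_natl.
(* t has the sign of c - 1, so that one event serves for the upper tail (c > 1) and the lower tail
   (c < 1). *)
by rewrite leNgt expR_lt1 -leNgt /t mulrAC pmulr_lge0 ?invr_gt0.
Qed.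

End chi_square_deviations.

(** * Elementary inequalities for exponentials, logarithms and power sums *)

Section real_tools.
Context {R : realType}.

(** The Pade approximant: the difference f vanishes at 0 and f' = 1 - exp y (1 - y) >= 0. Upper
    bounds for exponentials at rational points are derived from it. *)
Lemma expR_le_mobius (x : R) : 0 <= x < 2 -> expR x <= (2 + x) / (2 - x).
Proof.
move=> /andP[x0 x2]; rewrite ler_pdivlMr ?subr_gt0// -subr_ge0.
pose f (y : R) := 2 + y - expR y * (2 - y).
have df (y : R) : is_derive y 1 f (1 - expR y * (1 - y)).
  apply: is_derive_eq.
  by rewrite /GRing.scale /=; ring.
have f0 : f 0 = 0 by rewrite /f expR0; ring.
have [->|xn0] := eqVneq x 0; first by rewrite -/(f 0) f0.
have xp : 0 < x by rewrite lt_neqAle eq_sym xn0.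
have [c _] := @MVT R f (fun y => 1 - expR y * (1 - y)) 0 x xp (fun y _ => df y)
  (derivable_within_continuous (fun y _ => @ex_derive _ _ _ _ _ _ _ (df y))).
rewrite f0 !subr0 -/(f x) => ->; rewrite mulr_ge0// subr_ge0.
by rewrite mulrC -ler_pdivlMr ?expR_gt0// div1r -expRN; exact: expR_ge1Dx.
Qed.

Lemma expR_le_frac (x y : R) : 0 <= x < 2 -> 2 + x <= y * (2 - x) -> expR x <= y.
Proof.
move=> x02 xy; apply: (le_trans (expR_le_mobius x02)).
by rewrite ler_pdivrMr// subr_gt0; case/andP: x02.
Qed.

Lemma ln_ge_mobius (x : R) : 0 <= x -> 2 * x / (2 + x) <= ln (1 + x).
Proof.
move=> x0; have x2 : 0 < 2 + x by rewrite ltr_wpDr.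
rewrite -ler_expR lnK ?posrE ?ltr_pwDl//.
apply: (le_trans (expR_le_mobius _)).
  by rewrite divr_ge0 ?mulr_ge0 ?(ltW x2)//= ltr_pdivrMr// mulrDr; lra.
rewrite le_eqVlt; apply/orP; left; apply/eqP; field.
by rewrite ?lt0r_neq0 //=; lra.
Qed.

Lemma ln_le_sub1 (x : R) : 0 < x -> ln x <= x - 1.
Proof.
by move=> x0; rewrite -[X in ln X](subrKC 1); apply: le_ln1Dx; rewrite ltrBrDr addrC subrr.
Qed.

Lemma powR_lnE (x p : R) : 0 < x -> x `^ p = expR (p * ln x).
Proof. by move=> x0; rewrite /powR gt_eqF. Qed.

Lemma powR_Bernoulli_neg (x p : R) : 0 < x -> 0 <= p -> 1 - p * (x - 1) <= x `^ (- p).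
Proof.
move=> x0 p0; rewrite powR_lnE//; apply: le_trans (expR_ge1Dx _).
by rewrite mulNr lerD2l lerN2 ler_wpM2l// ln_le_sub1.
Qed.

Lemma powR_nat_anti (p : R) (i j : nat) : 0 <= p -> (0 < i <= j)%N ->
  j%:R `^ (- p) <= i%:R `^ (- p) :> R.
Proof.
move=> p0 /andP[i0 ij]; rewrite !powRN lef_pV2 ?posrE ?powR_gt0 ?ltr0n// ?(leq_trans i0)//.
by rewrite ge0_ler_powR// ?nnegrE ?ler0n// ler_nat.
Qed.

Lemma gt0_powRD (x a b : R) : 0 < x -> x `^ (a + b) = x `^ a * x `^ b.
Proof. by move=> x0; rewrite powRD// (gt_eqF x0) implybT. Qed.

Lemma powRNS (x p : R) : 0 < x -> x `^ (- (p + 1)) = x `^ (- p) / x.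
Proof.
by move=> x0; rewrite opprD gt0_powRD// powR_inv1 ?ltW.
Qed.

(** With [powR_tail_le], a telescoping substitute for comparing the sum of j^(- p - 1) with an
    integral; the two are [powR_Bernoulli_neg] at 1 + 1/j and at 1 - 1/(j + 1). *)
Lemma powR_tail_ge (p : R) (j : nat) : 0 < p -> (0 < j)%N ->
  (j%:R `^ (- p) - j.+1%:R `^ (- p)) / p <= j%:R `^ (- (p + 1)).
Proof.
move=> p0 j0; have jR : 0 < j%:R :> R by rewrite ltr0n.
rewrite ler_pdivrMr// powRNS// lerBlDr -lerBlDl.
have -> : j.+1%:R = j%:R * (1 + j%:R^-1) :> R by rewrite -natr1; field; rewrite gt_eqF.
rewrite powRM ?addr_ge0 ?invr_ge0 ?ler0n//.
apply: (@le_trans _ _ (j%:R `^ (- p) * (1 - p * j%:R^-1))).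
  by rewrite mulrBr mulr1 mulrA mulrAC.
rewrite ler_wpM2l ?powR_ge0//.
have := @powR_Bernoulli_neg (1 + j%:R^-1) p; rewrite addrAC subrr add0r; apply; last exact: ltW.
by rewrite ltr_wpDr ?invr_ge0 ?ler0n.
Qed.

Lemma powR_tail_le (p : R) (j : nat) : 0 < p -> (0 < j)%N ->
  j.+1%:R `^ (- (p + 1)) <= (j%:R `^ (- p) - j.+1%:R `^ (- p)) / p.
Proof.
move=> p0 j0; have jR : 0 < j%:R :> R by rewrite ltr0n.
have jS : 0 < j.+1%:R :> R by rewrite ltr0n.
rewrite ler_pdivlMr// powRNS// lerBrDr.
have -> : j%:R = j.+1%:R * (1 - j.+1%:R^-1) :> R.
  by rewrite mulrBr mulr1 divff ?gt_eqF// -natr1 addrK.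
have h : 0 < 1 - j.+1%:R^-1 :> R.
  by rewrite subr_gt0 invf_lt1// ltr1n.
rewrite powRM ?ler0n ?(ltW h)//.
apply: (@le_trans _ _ (j.+1%:R `^ (- p) * (1 + p * j.+1%:R^-1))).
  by rewrite mulrDr mulr1 addrC lerD2l mulrA mulrAC.
rewrite ler_wpM2l ?powR_ge0//.
have := powR_Bernoulli_neg h (ltW p0); rewrite addrAC subrr add0r mulrN opprK.
exact.
Qed.

Lemma sum_powR_ge (p : R) (a n : nat) : 0 < p -> (0 < a <= n)%N ->
  (a%:R `^ (- p) - n%:R `^ (- p)) / p <= \sum_(a <= j < n) j%:R `^ (- (p + 1)).
Proof.
move=> p0 /andP[a0 an]; rewrite -(opprK (a%:R `^ _)) -opprB opprK.
rewrite -(telescope_sumr (fun j => j%:R `^ (- p)) an) -sumrN mulr_suml.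
apply: ler_sum_nat => j /andP[aj _]; rewrite opprB.
by apply: powR_tail_ge => //; exact: leq_trans aj.
Qed.

Lemma sum_powR_le (p : R) (a n : nat) : 0 < p -> (0 < a)%N ->
  \sum_(a.+1 <= j < n) j%:R `^ (- (p + 1)) <= a%:R `^ (- p) / p.
Proof.
move=> p0 a0; have [na|an] := leqP n a.
  by rewrite big_geq ?divr_ge0 ?powR_ge0 ?(ltW p0)// ltnW.
apply: (@le_trans _ _ ((a%:R `^ (- p) - n.-1%:R `^ (- p)) / p)); last first.
  by rewrite ler_pM2r ?invr_gt0// gerBl powR_ge0.
case: n an => // n; rewrite ltnS => an.
rewrite big_add1 -(opprK (a%:R `^ _)) -opprB opprK /=.
rewrite -(telescope_sumr (fun j => j%:R `^ (- p)) an) -sumrN mulr_suml.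
apply: ler_sum_nat => j /andP[aj _]; rewrite opprB.
by apply: powR_tail_le => //; exact: leq_trans aj.
Qed.

(* Abel summation: comparing partial sums suffices against nonincreasing weights. *)
Lemma abel_le (w x y : nat -> R) (a n : nat) :
  (forall j, 0 <= w j) -> (forall j, (a <= j)%N -> w j.+1 <= w j) ->
  (forall m, (a <= m <= n)%N -> \sum_(a <= j < m) x j <= \sum_(a <= j < m) y j) ->
  \sum_(a <= j < n) w j * x j <= \sum_(a <= j < n) w j * y j.
Proof.
move=> w0 wd xy; have [na|an] := leqP n a; first by rewrite !big_geq.
suff h m : (a <= m <= n)%N -> w m * (\sum_(a <= j < m) y j - \sum_(a <= j < m) x j) <=
    \sum_(a <= j < m) w j * y j - \sum_(a <= j < m) w j * x j.
  rewrite -subr_ge0; apply: le_trans (h n _); last by rewrite (ltnW an) leqnn.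
  by rewrite mulr_ge0// subr_ge0 xy// (ltnW an) leqnn.
elim: m => [|m IH].
  by rewrite leqn0 => /andP[/eqP -> _]; rewrite !big_geq// subrr mulr0.
rewrite leq_eqVlt => /andP[/orP[/eqP <- _|]]; first by rewrite !big_geq// subrr mulr0.
rewrite ltnS => am mn; have amn : (a <= m <= n)%N by rewrite am ltnW.
apply: (@le_trans _ _ (w m * (\sum_(a <= j < m.+1) y j - \sum_(a <= j < m.+1) x j))).
  by rewrite ler_wpM2r ?wd// subr_ge0 xy// mn leqW.
rewrite !big_nat_recr//=; have := IH amn; lra.
Qed.

Lemma sqrD_le (t a b : R) : 0 < t -> (a + b) ^+ 2 <= (1 + t) * a ^+ 2 + (1 + t^-1) * b ^+ 2.
Proof.
move=> t0; rewrite -subr_ge0.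
have -> : (1 + t) * a ^+ 2 + (1 + t^-1) * b ^+ 2 - (a + b) ^+ 2 = t^-1 * (t * a - b) ^+ 2.
  by field; rewrite gt_eqF.
by rewrite mulr_ge0 ?sqr_ge0// invr_ge0 ltW.
Qed.

End real_tools.

(** * Arithmetic of the scales Lambda, Lambda^(1 + s) and kappa *)

Section scales.
Context {R : realType}.
Variables q z La ka : R.
Hypotheses (q0 : 0 < q) (z0 : 0 < z) (La100 : 100 <= La).

Local Notation s := (q / z).
Local Notation r := (q + z + 1).
Local Notation D := (La `^ (1 + s)).
(** The relation Lambda = a kappa^(z / (q + z)) solved for kappa, with z = eta - 1 and a = (324 *
    2^(q + z))^(- 1 / (q + z)). *)
Hypothesis kaE : ka = 324 `^ (z^-1) * 2 `^ (1 + s) * D.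

Let s0 : 0 < s. Proof. exact: divr_gt0. Qed.
Let La0 : 0 < La. Proof. by rewrite (lt_le_trans _ La100). Qed.
Let La1 : 1 <= La. Proof. by rewrite (le_trans _ La100)// ler1n. Qed.
Let zr : z <= r. Proof. have := q0; lra. Qed.
Let r0 : 0 < r. Proof. have := q0; have := z0; lra. Qed.
Let qzr : q + z <= r. Proof. lra. Qed.
Let zs : z * (1 + s) = q + z. Proof. by field; rewrite gt_eqF. Qed.

Lemma scale_D_gt0 : 0 < D. Proof. exact: powR_gt0. Qed.
Let D0 := scale_D_gt0.

Lemma scale_ka_gt0 : 0 < ka.
Proof. by rewrite kaE !mulr_gt0 ?powR_gt0. Qed.
Let ka0 := scale_ka_gt0.

Lemma scale_D_powR : D `^ z = La `^ (q + z).
Proof. by rewrite -powRrM mulrC zs. Qed.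

Lemma scale_ka_powR : ka `^ z = 162 * 2 `^ r * La `^ (q + z).
Proof.
rewrite kaE !powRM ?mulr_ge0 ?powR_ge0// scale_D_powR -!powRrM mulVf ?gt_eqF//.
rewrite (mulrC (1 + s)) zs powRr1// (@gt0_powRD _ 2 (q + z) 1)// powRr1//.
by rewrite (_ : 324 = 162 * 2); [ring|rewrite -natrM].
Qed.

Lemma scale_D_ge : 100 * (1 + s) <= D.
Proof.
have L1 : 1 <= ln La.
  rewrite -[leLHS]expRK ler_ln ?posrE ?expR_gt0// (le_trans _ La100)//.
  by apply: expR_le_frac; lra.
rewrite gt0_powRD// powRr1 ?(ltW La0)// ler_pM ?addr_ge0 ?(ltW s0)//.
rewrite powR_lnE//; apply: le_trans (expR_ge1Dx _).
by rewrite lerD2l ler_peMr// (ltW s0).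
Qed.

Lemma scale_La_le_D : La <= D.
Proof.
rewrite -[leLHS](powRr1 (ltW La0)); apply: ler_powR => //.
by rewrite lerDl (ltW s0).
Qed.

Lemma scale_ka_ge (c : R) : 0 < c <= 324 -> c `^ (z^-1) * (2 * D) <= ka.
Proof.
move=> /andP[c0 c324]; rewrite kaE mulrA ler_wpM2r ?(ltW D0)// ler_pM ?powR_ge0//.
  by rewrite ge0_ler_powR ?nnegrE ?invr_ge0 ?(ltW z0) ?(ltW c0).
by rewrite -[leLHS]powRr1//; apply: ler_powR; rewrite ?ler1n// lerDl (ltW s0).
Qed.

Lemma scale_ka_ge2D : 2 * D <= ka.
Proof. by have := @scale_ka_ge 1; rewrite powR1 mul1r; apply; rewrite ltr01/= ler1n. Qed.

Lemma scale_ka_r_ge : 162 * (2 * D) `^ r <= ka `^ r.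
Proof.
have -> : ka = 324 `^ (z^-1) * 2 `^ s * (2 * D).
  by rewrite kaE [in LHS]gt0_powRD// powRr1//; ring.
rewrite (powRM r (mulr_ge0 (powR_ge0 _ _) (powR_ge0 _ _)) (mulr_ge0 (ler0n _ 2) (ltW D0))).
rewrite ler_wpM2r ?powR_ge0// powRM ?powR_ge0// -!powRrM.
have h1 : (324 : R) <= 324 `^ (z^-1 * r).
  rewrite -[leLHS]powRr1//; apply: ler_powR; first by rewrite ler1n.
  by rewrite mulrC ler_pdivlMr// mul1r.
have h2 : (1 : R) <= 2 `^ (s * r).
  by rewrite -[leLHS](powRr0 2); apply: ler_powR; rewrite ?ler1n// mulr_ge0 ?(ltW s0) ?(ltW r0).
have : (324 : R) * 1 <= 324 `^ (z^-1 * r) * 2 `^ (s * r) by rewrite ler_pM.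
lra.
Qed.

(** K1 = cc ka is the scale of the competitor k1 to which minimisers are compared. It solves K1^(-
    r) = w ka^(- r), and ka^(- r) will be delta^2: there the signal outweighs the noise by the
    factor w. *)
Let w := 2 * (1 + s).
Let cc := w `^ (- r^-1).
Local Notation K1 := (cc * ka).

Let w0 : 0 < w. Proof. by rewrite mulr_gt0// addr_gt0. Qed.
Let cc0 : 0 < cc. Proof. exact: powR_gt0. Qed.

Let expR08 : expR (4 / 5) <= 56 / 25 :> R.
Proof.
rewrite expRM_natl (le_trans (_ : _ <= (11 / 9) ^+ 4))//; last lra.
rewrite ler_pXn2r ?nnegrE ?expR_ge0//.
by apply: expR_le_frac; lra.
Qed.

(** The tangent of ln at 5/2, together with ln (5/2) <= 1. Since z (1 + s) = q + z <= r, this gives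
    w^(z / r) <= exp (4/5) <= 56/25: passing from ka to K1 loses a bounded factor in the z-th
    power. *)
Let lnw : ln w <= 4 / 5 * (1 + s).
Proof.
have e25 : ln (5 / 2 : R) <= 1.
  rewrite -ler_expR lnK ?posrE//.
  have -> : (1 : R) = 8%:R * 8^-1 by lra.
  rewrite expRM_natl (le_trans (_ : _ <= (9 / 8) ^+ 8))//; first lra.
  rewrite ler_pXn2r ?nnegrE ?expR_ge0//.
  rewrite (le_trans _ (expR_ge1Dx _))//; lra.
have -> : w = 5 / 2 * (2 / 5 * w) by field.
have h : 0 < 2 / 5 * w by apply: mulr_gt0.
rewrite lnM ?posrE//; have := ln_le_sub1 h.
by have := s0; rewrite /w; lra.
Qed.

Let lnwr : ln w / r <= 4 / 5 / z.
Proof.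
rewrite ler_pdivrMr//; apply: (le_trans lnw).
have -> : 4 / 5 / z * r = 4 / 5 * (r / z) by ring.
by rewrite ler_wpM2l ?divr_ge0// ler_pdivlMr// mulrC zs.
Qed.

Lemma scale_K1_powR : ka `^ (- r) = K1 `^ (- r) / w.
Proof.
rewrite powRM ?(ltW cc0) ?(ltW ka0)// /cc -powRrM mulrNN mulVf ?gt_eqF// powRr1 ?(ltW w0)//.
by rewrite mulrAC divff ?gt_eqF// mul1r.
Qed.

Lemma scale_ka_K1 : ka `^ z <= 56 / 25 * K1 `^ z.
Proof.
rewrite powRM ?(ltW cc0) ?(ltW ka0)// mulrA ler_peMl ?powR_ge0// /cc -powRrM mulNr powRN.
rewrite ler_pdivlMr ?powR_gt0// mul1r powR_lnE//.
apply: le_trans expR08; rewrite ler_expR.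
have -> : r^-1 * z * ln w = ln w / r * z by ring.
by rewrite -ler_pdivlMr.
Qed.

Lemma scale_K1_ge2D : 2 * D <= K1.
Proof.
have h := @scale_ka_ge (56 / 25).
have {}h : (56 / 25) `^ (z^-1) * (2 * D) <= ka by apply: h; lra.
have ww : w `^ (r^-1) <= (56 / 25) `^ (z^-1).
  apply: (@le_trans _ _ (expR (4 / 5) `^ (z^-1))); last first.
    by rewrite ge0_ler_powR ?nnegrE ?invr_ge0 ?expR_ge0 ?(ltW z0) ?powR_ge0.
  by rewrite !powR_lnE ?expR_gt0// expRK ler_expR mulrC [leRHS]mulrC.
rewrite /cc powRN [leRHS]mulrC ler_pdivlMr ?powR_gt0// [leLHS]mulrC.
by apply: le_trans h; rewrite ler_wpM2r// mulr_ge0// (ltW D0).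
Qed.

Lemma scale_K1_le : K1 <= ka.
Proof.
rewrite ger_pMl// /cc powRN invf_le1 ?powR_gt0// -[leLHS](powRr0 w).
apply: ler_powR; last by rewrite invr_ge0 (ltW r0).
by rewrite /w; have := s0; lra.
Qed.

End scales.

(** * Sums of squares and splitting of signal and noise *)

Section sums_of_squares.
Context {R : realType}.

(* The law-of-large-numbers bound on sums of squares from index n on. *)
Definition sumsq_near (e : R) (n : nat) (x : nat -> R) :=
  forall k, (n <= k)%N ->
    (1 - e) * k%:R <= \sum_(1 <= j < k.+1) x j ^+ 2 <= (1 + e) * k%:R.

Lemma sumsq_near_block (e : R) n x a b : sumsq_near e n x -> (n <= a <= b)%N ->
  (1 - e) * b%:R - (1 + e) * a%:R <= \sum_(a.+1 <= j < b.+1) x j ^+ 2 <=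
  (1 + e) * b%:R - (1 - e) * a%:R.
Proof.
move=> nx /andP[na ab]; have := nx _ na; have := nx _ (leq_trans na ab).
rewrite [in X in X -> _](@big_cat_nat _ _ _ a.+1)//=; lra.
Qed.

Lemma sumsq_le_block (x : nat -> R) a b a' b' : (0 < a')%N -> (a' <= a)%N -> (b <= b')%N ->
  \sum_(a <= j < b) x j ^+ 2 <= \sum_(a' <= j < b') x j ^+ 2.
Proof.
move=> a'0 aa bb; have [ba|ab] := leqP b a.
  by rewrite big_geq//; apply: sumr_ge0 => j _; exact: sqr_ge0.
have ge0 c d : 0 <= \sum_(c <= j < d) x j ^+ 2 by apply: sumr_ge0 => j _; exact: sqr_ge0.
rewrite (@big_cat_nat _ _ _ a a' b')//= ?(leq_trans (ltnW ab))//.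
rewrite (@big_cat_nat _ _ _ b a b')//= ?(ltnW ab)//.
by have := ge0 a' a; have := ge0 b b'; lra.
Qed.

Lemma sumsq_near_le (e : R) n x a b : sumsq_near e n x -> (n <= b)%N -> (0 < a)%N ->
  \sum_(a <= j < b.+1) x j ^+ 2 <= (1 + e) * b%:R.
Proof.
move=> nx nb a0; have /andP[_] := nx _ nb; apply: le_trans.
exact: sumsq_le_block.
Qed.

Section noisy.
Variables (r de : R) (x g : nat -> R).
Hypothesis r0 : 0 <= r.

(** The data coefficient (y^delta, u_j) for r = q + eta, because sigma_j (x^dagger, v_j) = j^(- (q +
    eta) / 2) X_j. *)
Definition noisy_coef (j : nat) : R := j%:R `^ (- (r / 2)) * x j + de * g j.

Local Notation y := noisy_coef.

Let sqr_half (j : nat) : (j%:R `^ (- (r / 2)) * x j) ^+ 2 = j%:R `^ (- r) * x j ^+ 2.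
Proof.
rewrite exprMn; congr (_ * _); rewrite -powR_mulrn ?powR_ge0// -powRrM.
by congr (_ `^ _); field.
Qed.

(** This and the next three splittings keep the weight t of Young's inequality free; each use picks
    the t that its constants require. *)
Lemma noisy_sumsq_le (t : R) a b : 0 < t -> (0 < a)%N ->
  \sum_(a <= j < b) y j ^+ 2 <=
  (1 + t) * (a%:R `^ (- r) * \sum_(a <= j < b) x j ^+ 2) +
  (1 + t^-1) * (de ^+ 2 * \sum_(a <= j < b) g j ^+ 2).
Proof.
move=> t0 a0; rewrite !mulr_sumr -big_split/=; apply: ler_sum_nat => j /andP[aj _].
apply: (le_trans (sqrD_le _ _ t0)).
rewrite sqr_half exprMn lerD2r ler_wpM2l ?addr_ge0 ?(ltW t0)// ler_wpM2r ?sqr_ge0//.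
by apply: powR_nat_anti => //; rewrite a0.
Qed.

Lemma noisy_sumsq_le_signal (t : R) a b : 0 < t ->
  \sum_(a <= j < b) y j ^+ 2 <=
  (1 + t) * (\sum_(a <= j < b) j%:R `^ (- r) * x j ^+ 2) +
  (1 + t^-1) * (de ^+ 2 * \sum_(a <= j < b) g j ^+ 2).
Proof.
move=> t0; rewrite !mulr_sumr -big_split/=; apply: ler_sum_nat => j _.
by apply: (le_trans (sqrD_le _ _ t0)); rewrite sqr_half exprMn.
Qed.

Lemma signal_sumsq_le (t : R) a b : 0 < t ->
  \sum_(a <= j < b) j%:R `^ (- r) * x j ^+ 2 <=
  (1 + t) * (\sum_(a <= j < b) y j ^+ 2) +
  (1 + t^-1) * (de ^+ 2 * \sum_(a <= j < b) g j ^+ 2).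
Proof.
move=> t0; rewrite !mulr_sumr -big_split/=; apply: ler_sum_nat => j _.
rewrite -sqr_half (_ : _ * x j = y j + - (de * g j)); last by rewrite /y addrK.
by apply: (le_trans (sqrD_le _ _ t0)); rewrite sqrrN exprMn.
Qed.

Lemma noise_sumsq_le (t : R) a b : 0 < t -> (0 < a)%N ->
  de ^+ 2 * (\sum_(a <= j < b) g j ^+ 2) <=
  (1 + t) * (\sum_(a <= j < b) y j ^+ 2) +
  (1 + t^-1) * (a%:R `^ (- r) * \sum_(a <= j < b) x j ^+ 2).
Proof.
move=> t0 a0; rewrite !mulr_sumr -big_split/=; apply: ler_sum_nat => j /andP[aj _].
rewrite -exprMn (_ : de * g j = y j + - (j%:R `^ (- (r / 2)) * x j)); last by rewrite /y; ring.
apply: (le_trans (sqrD_le _ _ t0)).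
rewrite sqrrN sqr_half lerD2l ler_wpM2l ?addr_ge0 ?invr_ge0 ?(ltW t0)// ler_wpM2r ?sqr_ge0//.
by apply: powR_nat_anti => //; rewrite a0.
Qed.

End noisy.

End sums_of_squares.

(** * Minimisers are not much larger than kappa *)

Section overestimation.
Context {R : realType}.
Variables q z ka de : R.
Hypotheses (q0 : 0 < q) (z0 : 0 < z) (ka0 : 0 < ka).
Local Notation r := (q + z + 1).
Hypothesis de2 : de ^+ 2 = ka `^ (- r).
Variables (n0 : nat) (x g : nat -> R).
Hypotheses (nx : sumsq_near 4^-1 n0 x) (ng : sumsq_near 4^-1 n0 g).
Local Notation y := (noisy_coef r de x g).

Let r0 : 0 <= r. Proof. have := q0; have := z0; lra. Qed.

(** Both values are dominated by noise. At k >= ka the sum of y_j^2 is at most 5 delta^2 m. If l^q >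
    100 k^q the signal at l is below delta^2 / 100, and l <= m / 2 leaves noise at least delta^2 m /
    8, so the sum is at least delta^2 m / 20. The ratio of the two bounds is 100. *)
Lemma minimiser_not_large (k l m : nat) : ka <= k%:R -> (n0 <= k)%N ->
  (0 < k)%N -> (0 < l)%N -> (2 * l <= m)%N ->
  (forall k', (0 < k')%N -> (2 * k' <= m)%N ->
     l%:R `^ q * (\sum_(l <= j < m.+1) y j ^+ 2) <=
     k'%:R `^ q * (\sum_(k' <= j < m.+1) y j ^+ 2)) ->
  l%:R `^ q <= 100 * k%:R `^ q.
Proof.
move=> kak n0k k0 l0 lm; have kR : 0 < k%:R :> R by rewrite ltr0n.
have kq : 0 < k%:R `^ q by rewrite powR_gt0.
have lR : 0 < l%:R :> R by rewrite ltr0n.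
have [lk _|kl] := leqP l k.
  apply: (@le_trans _ _ (k%:R `^ q)); last by have := kq; lra.
  by rewrite ge0_ler_powR ?nnegrE ?(ltW q0) ?(ltW kR) ?(ltW lR)// ler_nat.
have km : (2 * k <= m)%N by rewrite (leq_trans _ lm)// leq_mul2l/= ltnW.
move=> /(_ k k0 km) h; rewrite leNgt; apply/negP => big.
have d2 : de ^+ 2 = ka `^ (- r) := de2.
have d0 : 0 < de ^+ 2 by rewrite d2 powR_gt0.
have kr : k%:R `^ (- r) <= de ^+ 2.
  rewrite d2 !powRN lef_pV2 ?posrE ?powR_gt0//.
  by rewrite ge0_ler_powR// nnegrE ltW.
have lr : l%:R `^ (- r) <= de ^+ 2 / 100.
  apply: (@le_trans _ _ (k%:R `^ (- r) / 100)); last by rewrite ler_pM2r.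
  rewrite !powRN -invfM lef_pV2 ?posrE ?mulr_gt0 ?powR_gt0//.
  have -> : r = q + (z + 1) by rewrite addrA.
  rewrite !(@gt0_powRD _ _ q (z + 1))//.
  have klz : k%:R `^ (z + 1) <= l%:R `^ (z + 1).
    by rewrite ge0_ler_powR ?nnegrE ?addr_ge0 ?(ltW z0) ?(ltW kR) ?(ltW lR)// ler_nat ltnW.
  have := ler_pM (mulr_ge0 (ler0n _ 100) (ltW kq)) (powR_ge0 _ _) (ltW big) klz.
  by apply: le_trans; rewrite le_eqVlt; apply/orP; left; apply/eqP; ring.
have mR : 0 < m%:R :> R by rewrite ltr0n (leq_trans _ lm)// muln_gt0.
have l1 : (n0 <= l.-1 <= m)%N.
  by apply/andP; split; [rewrite (leq_trans n0k)// -ltnS prednK|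
    rewrite (leq_trans (leq_pred _))// (leq_trans _ lm)// leq_pmull].
have := sumsq_near_block nx l1; have := sumsq_near_block ng l1; rewrite prednK//.
have mk : (n0 <= m)%N by case/andP: l1 => /leq_trans; exact.
have := sumsq_near_le nx mk k0; have := sumsq_near_le ng mk k0.
have := @noisy_sumsq_le _ r de x g r0 1 k m.+1 ltr01 k0.
(* With t = 3/7 what remains at l is 7/10 (1/8 - 10/3 * 1/80) = 7/120 >= 1/20. *)
have t37 : 0 < 3 / 7 :> R by [].
have := @noise_sumsq_le _ r de x g r0 (3 / 7) l m.+1 t37 l0.
have lmR : 2 * (l.-1)%:R <= m%:R :> R.
  by rewrite -natrM ler_nat (leq_trans _ lm)// leq_mul2l/= leq_pred.
move: h; set Yl := \sum_(l <= j < m.+1) y j ^+ 2; set Yk := \sum_(k <= j < m.+1) y j ^+ 2.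
set Xl := \sum_(l <= j < m.+1) x j ^+ 2; set Gl := \sum_(l <= j < m.+1) g j ^+ 2.
set Xk := \sum_(k <= j < m.+1) x j ^+ 2; set Gk := \sum_(k <= j < m.+1) g j ^+ 2.
move: (l.-1)%:R (m%:R : R) (ler0n R l.-1) mR lmR => a M a0 Mp lmR h h1 h2 gk xk /andP[gl _] /andP[_ xl].
have M0 := ltW Mp.
have bnd c e : 0 <= c <= de ^+ 2 -> e <= (1 + 4^-1) * M -> c * e <= 5 / 4 * (de ^+ 2 * M).
  move=> /andP[c0 cd] eM; apply: (le_trans (ler_wpM2l c0 eM)).
  have -> : c * ((1 + 4^-1) * M) = 5 / 4 * (c * M) by field.
  by rewrite ler_wpM2l// ler_wpM2r.
have Yk5 : Yk <= 5 * (de ^+ 2 * M).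
  have := bnd _ _ (introT andP (conj (powR_ge0 _ _) kr)) xk.
  have := bnd _ _ (introT andP (conj (ltW d0) (lexx _))) gk.
  by move: h2; rewrite invr1; lra.
have Yl5 : 5 / 100 * (de ^+ 2 * M) <= Yl.
  have g2 := ler_wpM2l (ltW d0) gl.
  have x2 : l%:R `^ (- r) * Xl <= de ^+ 2 / 100 * (5 / 4 * M).
    by apply: ler_pM; rewrite ?powR_ge0 ?sumr_ge0//; [move=> *; exact: sqr_ge0|lra].
  have := h1; rewrite invf_div => {}h1.
  have aM := ler_wpM2l (ltW d0) lmR.
  have dM := mulr_ge0 (ltW d0) M0.
  lra.
have kY := ler_wpM2l (ltW kq) Yk5.
have lY' : 100 * k%:R `^ q * (5 / 100 * (de ^+ 2 * M)) < l%:R `^ q * Yl.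
  apply: (@lt_le_trans _ _ (l%:R `^ q * (5 / 100 * (de ^+ 2 * M)))).
    by rewrite ltr_pM2r// (mulr_gt0 _ (mulr_gt0 d0 Mp)).
  by rewrite ler_wpM2l// powR_ge0.
lra.
Qed.
End overestimation.

(** * Power-weighted sums of squares *)

Section weighted_sums.
Context {R : realType}.

Lemma powR_weight_noninc (p : R) (a : nat) : 0 < p -> (0 < a)%N ->
  forall j, (a <= j)%N -> j.+1%:R `^ (- (p + 1)) <= j%:R `^ (- (p + 1)) :> R.
Proof.
move=> p0 a0 j aj; apply: powR_nat_anti; first by rewrite addr_ge0 ?(ltW p0).
by rewrite leqnSn (leq_trans a0 aj).
Qed.

Lemma sumsq_weighted_le (e p : R) n x a b : 0 <= e -> 0 < p -> sumsq_near e n x ->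
  (n <= a)%N ->
  \sum_(a.+1 <= j < b) j%:R `^ (- (p + 1)) * x j ^+ 2 <=
  (1 + e) * (\sum_(a.+1 <= j < b) j%:R `^ (- (p + 1))) +
  2 * e * a%:R * a.+1%:R `^ (- (p + 1)).
Proof.
move=> e0 p0 nx na; have [ba|ab] := leqP b a.+1.
  by rewrite !big_geq// mulr0 add0r !mulr_ge0 ?powR_ge0.
(* The block bound (1 + e) m - (1 - e) a is (1 + e) (m - a) + 2 e a. The comparison sequence puts
   the excess 2 e a on the first index, where the partial sums need it. *)
pose y j : R := (1 + e) + (if j == a.+1 then 2 * e * a%:R else 0).
have sy (c : nat -> R) m : (a.+1 < m)%N -> \sum_(a.+1 <= j < m) c j * y j =
    (1 + e) * (\sum_(a.+1 <= j < m) c j) + 2 * e * a%:R * c a.+1.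
  move=> am; have E : \sum_(a.+2 <= j < m) c j * y j = (1 + e) * \sum_(a.+2 <= j < m) c j.
    rewrite mulr_sumr; apply: eq_big_nat => j /andP[aj _].
    by rewrite /y gtn_eqF// addr0 mulrC.
  rewrite [in LHS](big_ltn am) E /y eqxx [in RHS](big_ltn am); ring.
apply: le_trans (@abel_le _ _ _ y a.+1 b _ _ _) _ => [j|j aj|m|].
- exact: powR_ge0.
- exact: (powR_weight_noninc p0 (ltn0Sn a)).
- case/andP; rewrite leq_eqVlt => /orP[/eqP <- _|am _]; first by rewrite !big_geq.
  case: m am => // m; rewrite ltnS => am.
  have := sumsq_near_block nx (introT andP (conj na (ltnW am))) => /andP[_].
  move/le_trans; apply.
  have := @sy (fun=> 1) m.+1 am; under eq_bigr do rewrite mul1r.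
  move=> ->; rewrite mulr1 sumr_const_nat subSS natrB ?(ltnW am)//; lra.
- by rewrite sy.
Qed.

Lemma sumsq_weighted_ge (e p : R) n x a b G : 0 <= e < 1 -> 0 < p -> sumsq_near e n x ->
  (n <= a)%N -> (0 < a)%N -> (0 < b)%N -> (1 + e) / (1 - e) * a%:R + 1 <= G%:R ->
  (1 - e) * ((G%:R `^ (- p) - b%:R `^ (- p)) / p) <=
  \sum_(a.+1 <= j < b) j%:R `^ (- (p + 1)) * x j ^+ 2.
Proof.
move=> /andP[e0 e1] p0 nx na a0 b0 aG; have e1' : 0 < 1 - e by rewrite subr_gt0.
have aG' : (1 + e) * a%:R + (1 - e) <= (1 - e) * G%:R.
  have := ler_wpM2l (ltW e1') aG; rewrite mulrDr mulr1 mulrA (mulrC (1 - e)) divfK ?gt_eqF//.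
have aG1 : (a < G)%N.
  rewrite -(ltr_nat R) -(ltr_pM2l e1'); apply: lt_le_trans aG'.
  by have : 0 <= e * a%:R by [rewrite mulr_ge0]; lra.
have G0 : (0 < G)%N := leq_ltn_trans (leq0n a) aG1.
have [bG|Gb] := leqP b G.
  apply: (@le_trans _ _ 0).
    rewrite pmulr_rle0// pmulr_lle0 ?invr_gt0// subr_le0.
    by apply: powR_nat_anti; rewrite ?(ltW p0) ?b0.
  by apply: sumr_ge0 => j _; rewrite mulr_ge0 ?powR_ge0 ?sqr_ge0.
apply: (@le_trans _ _ ((1 - e) * \sum_(G <= j < b) j%:R `^ (- (p + 1)))).
  by rewrite ler_pM2l// sum_powR_ge// G0 ltnW.
(* The lower block bound (1 - e) m - (1 + e) a starts to be useful near m = (1 + e) / (1 - e) a.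
   Before G only nonnegativity is used, afterwards 1 - e per index; the + 1 in the condition on G
   absorbs the strict upper end of the sums. *)
pose y j : R := if (G <= j)%N then 1 - e else 0.
have sy (c : nat -> R) m : \sum_(a.+1 <= j < m) c j * y j =
    (1 - e) * (\sum_(G <= j < m) c j).
  have [mG|Gm] := leqP m G.
    rewrite [in RHS]big_geq// mulr0; apply: big1_seq => j /andP[_].
    rewrite mem_index_iota => /andP[_ jm].
    by rewrite /y leqNgt (leq_trans jm mG) mulr0.
  rewrite (@big_cat_nat _ _ _ G)//= ?(ltnW Gm)// big1_seq ?add0r; last first.
    move=> j /andP[_]; rewrite mem_index_iota => /andP[_ jG].
    by rewrite /y leqNgt jG mulr0.
  rewrite mulr_sumr; apply: eq_big_nat => j /andP[Gj _].
  by rewrite /y Gj mulrC.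
rewrite -sy; apply: abel_le => [j|j aj|m].
- exact: powR_ge0.
- exact: (powR_weight_noninc p0 (ltn0Sn a)).
- case/andP => am _; have := @sy (fun=> 1) m; under eq_bigr do rewrite mul1r.
  move=> ->; rewrite sumr_const_nat.
  case: m am => // m; rewrite ltnS => am.
  have := sumsq_near_block nx (introT andP (conj na am)) => /andP[+ _].
  have [mG|Gm] := leqP m.+1 G => [_|].
    have -> : (m.+1 - G = 0)%N by apply/eqP; rewrite subn_eq0.
    by rewrite mulr0; apply: sumr_ge0 => j _; exact: sqr_ge0.
  by apply: le_trans; rewrite natrB ?(ltnW Gm)// -natr1; lra.
Qed.

End weighted_sums.

(** * The minimiser for m = 2 k1 is not below Lambda^(1 + s) *)

Section early_constants.
Context {R : realType}.

Lemma early_lower_bound (P La : R) : 0 < La -> (19 / 10) `^ (- (P + 1)) * (101 / 100 * La) `^ (- P) =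
    10 / 19 * ((19 / 10 * (101 / 100)) `^ P * La `^ P)^-1 :> R.
Proof.
move=> La0; have a0 : 0 < 19 / 10 :> R by rewrite divr_gt0 ?ltr0n.
have b0 : 0 < 101 / 100 :> R by rewrite divr_gt0 ?ltr0n.
rewrite !powRN (gt0_powRD P 1 a0) (powRr1 (ltW a0)) (powRM _ (ltW b0) (ltW La0)).
rewrite (powRM _ (ltW a0) (ltW b0)).
have := powR_gt0 P a0; have := powR_gt0 P b0; have := powR_gt0 P La0.
move: (_ `^ P) (_ `^ P) (_ `^ P) => u v w u0 v0 w0.
by field; rewrite !gt_eqF.
Qed.

Lemma early_base_le (P z : R) : 0 <= z <= P -> (200 / 199) `^ z * (19 / 10 * (101 / 100)) `^ P <= 2 `^ P :> R.
Proof.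
move=> /andP[z0 zP].
have a0 : 0 <= 200 / 199 :> R by rewrite divr_ge0 ?ler0n.
have b0 : 0 <= 19 / 10 * (101 / 100) :> R by rewrite mulr_ge0 ?divr_ge0 ?ler0n.
apply: (@le_trans _ _ ((200 / 199) `^ P * (19 / 10 * (101 / 100)) `^ P)).
  rewrite ler_wpM2r ?powR_ge0//; apply: ler_powR => //; lra.
rewrite -(powRM _ a0 b0); apply: ge0_ler_powR; rewrite ?nnegrE ?(mulr_ge0 a0 b0)//; last lra.
exact: le_trans zP.
Qed.

(** The numerical core of [minimiser_not_early], with A = 2^P, B = (19/10 * 101/100)^P, C = Lambda^P
    and P = q + z. The margin is 132/25 * 56/25 / 324 < 1/20; the 324 comes from the constant a. *)
Lemma early_constants_lt (A B C tz : R) : 0 < A -> 0 < B -> 0 < C -> 0 < tz -> tz * B <= A ->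
 132 / 25 * (56 / 25 * tz * (324 * (A * C))^-1) < 19 / 200 * (10 / 19 * (B * C)^-1).
Proof.
move=> A0 B0 C0 t0 V.
have V' : tz / (A * C) <= (B * C)^-1.
  rewrite ler_pdivrMr ?mulr_gt0// mulrC ler_pdivlMr ?mulr_gt0// mulrA ler_pM2r//.
have W0 : 0 < (B * C)^-1 by rewrite invr_gt0 mulr_gt0.
have -> : 132 / 25 * (56 / 25 * tz * (324 * (A * C))^-1) =
   132 / 25 * (56 / 25) / 324 * (tz / (A * C)).
  by field; rewrite !gt_eqF.
lra.
Qed.
End early_constants.

Section underestimation.
Context {R : realType}.
Variables q z La ka de : R.
Hypotheses (q0 : 0 < q) (z0 : 0 < z) (La100 : 100 <= La).
Local Notation s := (q / z).
Local Notation r := (q + z + 1).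
Local Notation D := (La `^ (1 + s)).
Hypothesis kaE : ka = 324 `^ (z^-1) * 2 `^ (1 + s) * D.
Hypothesis de2 : de ^+ 2 = ka `^ (- r).
Variables (n0 : nat) (x g : nat -> R).
Hypotheses (n0La : La <= n0%:R <= La + 1).
Hypotheses (nx : sumsq_near 4^-1 n0 x) (ng : sumsq_near 4^-1 n0 g).
Local Notation y := (noisy_coef r de x g).
Local Notation K1 := ((2 * (1 + s)) `^ (- r^-1) * ka).
Variable k1 : nat.
Hypothesis k1K : K1 - 1 <= k1%:R <= K1.

Let s0 : 0 < s. Proof. exact: divr_gt0. Qed.
Let P0 : 0 < q + z. Proof. exact: addr_gt0. Qed.
Let r0 : 0 < r. Proof. exact: addr_gt0. Qed.
Let La0 : 0 < La. Proof. by rewrite (lt_le_trans _ La100). Qed.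
Let zs : z * (1 + s) = q + z. Proof. by field; rewrite gt_eqF. Qed.
Let ka0 : 0 < ka := scale_ka_gt0 La100 kaE.
Let D_La : La <= D := scale_La_le_D q0 z0 La100.
Let D100 : 100 * (1 + s) <= D := scale_D_ge q0 z0 La100.
Let D0 : 0 < D. Proof. exact: powR_gt0. Qed.
Let K12D : 2 * D <= K1 := scale_K1_ge2D q0 z0 La100 kaE.

Lemma competitor_large : D + 99 * s <= k1%:R - 1 /\ (n0 < k1)%N.
Proof.
have /andP[h1 h2] := k1K; have /andP[h3 h4] := n0La.
have h5 := K12D; have h6 := D100; have h7 := D_La; have h8 := La100; have h9 := s0.
split; first lra.
by rewrite -(ltr_nat R); lra.
Qed.

Let k10 : (0 < k1)%N. Proof. by have [_] := competitor_large; apply: leq_ltn_trans. Qed.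
Let k1R : 0 < k1%:R :> R. Proof. by rewrite ltr0n. Qed.

Let k1200 : 199 <= k1%:R :> R.
Proof. by have [h1 _] := competitor_large; have h2 := D100; have h3 := s0; have /andP[h4 h5] := k1K; have h6 := K12D; lra. Qed.

Lemma competitor_noise : de ^+ 2 <= k1%:R `^ (- r) / (2 * (1 + s)).
Proof.
rewrite de2 (scale_K1_powR q0 z0 La100 kaE).
rewrite ler_wpM2r ?invr_ge0 ?mulr_ge0 ?addr_ge0 ?(ltW s0)//.
have := k1K; set K := _ * ka => /andP[_ h]; rewrite !powRN lef_pV2 ?posrE ?powR_gt0 ?(lt_le_trans k1R h)//.
by rewrite ge0_ler_powR ?nnegrE ?(ltW r0) ?(ltW k1R) ?(le_trans (ltW k1R) h).
Qed.

(** The loss from rounding K1 down to k1 >= 199: K1 <= k1 + 1 <= 200/199 k1. *)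
Let tz := (200 / 199) `^ z : R.
Let tz0 : 0 < tz. Proof. by apply: powR_gt0; rewrite divr_gt0 ?ltr0n. Qed.

Lemma competitor_ka : ka `^ z <= 56 / 25 * tz * k1%:R `^ z.
Proof.
apply: (le_trans (scale_ka_K1 q0 z0 La100 kaE)).
rewrite -(mulrA (56 / 25) tz); apply: ler_wpM2l; first by rewrite divr_ge0 ?ler0n.
have t0 : 0 <= 200 / 199 :> R by rewrite divr_ge0 ?ler0n.
rewrite /tz -(powRM _ t0 (ltW k1R)).
have /andP[h1 h2] := k1K; have h3 := k1200.
have h4 : 0 <= K1 by apply: (le_trans _ h2); apply: ltW.
apply: ge0_ler_powR; rewrite ?nnegrE ?(ltW z0)// ?(mulr_ge0 t0 (ltW k1R))//; lra.
Qed.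

(** From k1 to 2 k1 either sum of squares is at most 44/25 k1, and by the choice of K1 the noise
    counts at most half as much as the signal: 132/25 = 2 (44/25 + 22/25). *)
Lemma competitor_block :
  k1%:R `^ q * (\sum_(k1 <= j < (2 * k1).+1) y j ^+ 2) <= 132 / 25 * k1%:R `^ (- z).
Proof.
have [h1 n0k1] := competitor_large.
have kl : (n0 <= k1.-1 <= 2 * k1)%N.
  by rewrite -ltnS prednK// n0k1 (leq_trans (leq_pred _))// leq_pmull.
have := sumsq_near_block nx kl; have := sumsq_near_block ng kl; rewrite prednK//.
have -> : (k1.-1)%:R = k1%:R - 1 :> R by rewrite -[in RHS](prednK k10) -natr1 addrK.
rewrite natrM; move=> /andP[_ hg] /andP[_ hx].
have h2 := k1200.
have kr0 : 0 < k1%:R `^ (- r) :> R by rewrite powR_gt0.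
have X : k1%:R `^ (- r) * (\sum_(k1 <= j < (2 * k1).+1) x j ^+ 2) <=
    k1%:R `^ (- r) * (44 / 25 * k1%:R) by rewrite ler_pM2l//; lra.
have G : de ^+ 2 * (\sum_(k1 <= j < (2 * k1).+1) g j ^+ 2) <=
    k1%:R `^ (- r) / 2 * (44 / 25 * k1%:R).
  apply: ler_pM; rewrite ?sqr_ge0 ?sumr_ge0//; first by move=> *; exact: sqr_ge0.
    apply: (le_trans competitor_noise); rewrite ler_pM2l// lef_pV2 ?posrE ?mulr_gt0 ?addr_gt0//.
    by rewrite ler_peMr// lerDl (ltW s0).
  by lra.
have := @noisy_sumsq_le _ r de x g (ltW r0) 1 k1 (2 * k1).+1 ltr01 k10; rewrite invr1 => Y.
have -> : k1%:R `^ (- z) = k1%:R `^ q * (k1%:R `^ (- r) * k1%:R) :> R.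
  rewrite -[X in _ * (_ * X)](powRr1 (ltW k1R)) -!gt0_powRD//; congr (_ `^ _); ring.
rewrite mulrCA ler_pM2l ?powR_gt0//; lra.
Qed.

(* Were the minimiser below the scale D, the signal in the block (L, 1.9 L]
   alone would exceed the value at k1. *)
Lemma minimiser_not_early (L l : nat) :
  (n0 <= L)%N -> L%:R <= 101 / 100 * D -> (0 < l <= L)%N ->
  (101 / 100 * La) `^ (- (q + z)) <= l%:R `^ q * (L%:R * L%:R `^ (- r)) ->
  k1%:R `^ q * (\sum_(k1 <= j < (2 * k1).+1) y j ^+ 2) <
  l%:R `^ q * (\sum_(l <= j < (2 * k1).+1) y j ^+ 2).
Proof.
move=> n0L LD /andP[l0 lL] lq; apply: (le_lt_trans competitor_block).
have [hk n0k1] := competitor_large.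
have L100 : 100 <= L%:R :> R.
  by have /andP[h1 _] := n0La; rewrite (le_trans La100)// (le_trans h1)// ler_nat.
have L0 : 0 < L%:R :> R by rewrite (lt_le_trans _ L100).
pose b := Num.truncn (19 / 10 * L%:R : R).
have b1 : b%:R <= 19 / 10 * L%:R :> R by rewrite truncn_le// mulr_ge0.
have b2 : 19 / 10 * L%:R < b%:R + 1 :> R by rewrite natr1 truncnS_gt.
have Lb : (L <= b)%N by rewrite -(ler_nat R); lra.
have bk : (b <= 2 * k1)%N.
  rewrite -(ler_nat R) natrM; have h1 := D0; have h2 := k1200; have h3 := s0; lra.
have b0 : 0 < b%:R :> R by rewrite (lt_le_trans L0)// ler_nat.
have := sumsq_near_block nx (introT andP (conj n0L Lb)).
have := sumsq_near_block ng (introT andP (conj n0L Lb)) => /andP[_ hg] /andP[hx _].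
pose c := (19 / 10 * L%:R) `^ (- r) : R.
have c0 : 0 < c by rewrite powR_gt0// mulr_gt0.
(* The block contributes 3/4 * 19/10 - 5/4 = 7/40 per unit of L, and rounding b costs at most 3/4 <=
   8/1000 L. The weight c is the one at the right end. *)
have S1 : c * (167 / 1000 * L%:R) <= \sum_(L.+1 <= j < b.+1) j%:R `^ (- r) * x j ^+ 2.
  apply: (@le_trans _ _ (c * \sum_(L.+1 <= j < b.+1) x j ^+ 2)).
    by rewrite ler_pM2l//; lra.
  rewrite mulr_sumr; apply: ler_sum_nat => j /andP[Lj jb].
  have j0 : 0 < j%:R :> R by rewrite ltr0n (leq_trans _ Lj).
  rewrite ler_wpM2r ?sqr_ge0// /c !powRN lef_pV2 ?posrE ?powR_gt0 ?(mulr_gt0 _ L0)//.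
  rewrite ge0_ler_powR ?nnegrE ?(ltW r0) ?ler0n ?mulr_ge0//.
  by apply: le_trans b1; rewrite ler_nat.
have dc : de ^+ 2 <= c / 162.
  rewrite de2 /c !powRN -invfM lef_pV2 ?posrE ?powR_gt0 ?mulr_gt0 ?powR_gt0 ?mulr_gt0//.
  apply: le_trans (scale_ka_r_ge q0 z0 La100 kaE); rewrite mulrC ler_pM2l//.
  rewrite ge0_ler_powR ?nnegrE ?(ltW r0) ?mulr_ge0 ?(ltW D0)//.
  have h1 := D0; lra.
have G1 : de ^+ 2 * (\sum_(L.+1 <= j < b.+1) g j ^+ 2) <= c / 162 * (13 / 8 * L%:R).
  apply: ler_pM; rewrite ?sqr_ge0 ?sumr_ge0//; first by move=> *; exact: sqr_ge0.
  by lra.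
(* With t = 1/3 there remains 3/4 (167/1000 - 4 * 13/8 / 162) >= 19/200. *)
have t3 : 0 < 3^-1 :> R by [].
have := @signal_sumsq_le _ r de x g 3^-1 L.+1 b.+1 t3; rewrite invrK => S2.
have cL : 0 < c * L%:R by rewrite mulr_gt0.
have Y1 : 19 / 200 * (c * L%:R) <= \sum_(L.+1 <= j < b.+1) y j ^+ 2 by lra.
have Y2 : \sum_(L.+1 <= j < b.+1) y j ^+ 2 <= \sum_(l <= j < (2 * k1).+1) y j ^+ 2.
  by apply: sumsq_le_block => //; rewrite ?ltnS// (leq_trans lL).
have Y3 := ler_wpM2l (powR_ge0 l%:R q) (le_trans Y1 Y2).
apply: lt_le_trans Y3.
have cE : c = (19 / 10) `^ (- r) * L%:R `^ (- r) by rewrite /c powRM.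
apply: (@lt_le_trans _ _ (19 / 200 * ((19 / 10) `^ (- r) * (101 / 100 * La) `^ (- (q + z))))); last first.
  rewrite [leRHS]mulrCA ler_wpM2l// cE.
  apply: (le_trans (ler_wpM2l (powR_ge0 _ _) lq)).
  by rewrite le_eqVlt; apply/orP; left; apply/eqP; ring.
have kz : k1%:R `^ (- z) <= 56 / 25 * tz * ka `^ (- z).
  rewrite !powRN ler_pdivlMr ?powR_gt0// [leLHS]mulrC ler_pdivrMr ?powR_gt0//.
  exact: competitor_ka.
have kaz : ka `^ (- z) = (324 * (2 `^ (q + z) * La `^ (q + z)))^-1.
  rewrite powRN (scale_ka_powR z0 kaE) (@gt0_powRD _ 2 (q + z) 1)// powRr1//.
  by congr (_^-1); ring.
have U := early_lower_bound (q + z) La0.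
have LP0 : 0 < La `^ (q + z) by rewrite powR_gt0.
have zP : 0 <= z <= q + z by rewrite (ltW z0) lerDr (ltW q0).
have V := early_base_le zP.
have A0 : 0 < 2 `^ (q + z) :> R by rewrite powR_gt0.
have B0 : 0 < (19 / 10 * (101 / 100)) `^ (q + z) :> R.
  by apply: powR_gt0; rewrite mulr_gt0// divr_gt0 ?ltr0n.
rewrite U; apply: (@le_lt_trans _ _ (132 / 25 * (56 / 25 * tz * ka `^ (- z)))).
  by rewrite ler_pM2l// divr_gt0 ?ltr0n.
by rewrite kaz; exact: (early_constants_lt A0 B0 LP0 tz0 V).
Qed.

End underestimation.

(** * The minimiser for m = 2 k1 is of the order of kappa *)

Section late_minimiser.
Context {R : realType}.
Variables q z La ka de : R.
Hypotheses (q0 : 0 < q) (z0 : 0 < z) (La100 : 100 <= La).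
Local Notation s := (q / z).
Local Notation r := (q + z + 1).
Local Notation D := (La `^ (1 + s)).
Hypothesis kaE : ka = 324 `^ (z^-1) * 2 `^ (1 + s) * D.
Hypothesis de2 : de ^+ 2 = ka `^ (- r).
Variables (n0 : nat) (x g : nat -> R).
Hypotheses (n0La : La <= n0%:R <= La + 1).
Hypotheses (nx : sumsq_near 4^-1 n0 x) (ng : sumsq_near 4^-1 n0 g).
Local Notation y := (noisy_coef r de x g).
Local Notation K1 := ((2 * (1 + s)) `^ (- r^-1) * ka).
Variable k1 : nat.
Hypothesis k1K : K1 - 1 <= k1%:R <= K1.

Let s0 : 0 < s. Proof. exact: divr_gt0. Qed.
Let P0 : 0 < q + z. Proof. exact: addr_gt0. Qed.
Let r0 : 0 < r. Proof. exact: addr_gt0. Qed.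
Let La0 : 0 < La. Proof. by rewrite (lt_le_trans _ La100). Qed.
Let zs : z * (1 + s) = q + z. Proof. by field; rewrite gt_eqF. Qed.
Let ka0 : 0 < ka := scale_ka_gt0 La100 kaE.
Let D_La : La <= D := scale_La_le_D q0 z0 La100.
Let D100 : 100 * (1 + s) <= D := scale_D_ge q0 z0 La100.
Let D0 : 0 < D. Proof. exact: powR_gt0. Qed.
Let K12D : 2 * D <= K1 := scale_K1_ge2D q0 z0 La100 kaE.

Let k10 : (0 < k1)%N.
Proof. by have [_] := competitor_large q0 z0 La100 kaE n0La k1K; apply: leq_ltn_trans. Qed.
Let k1R : 0 < k1%:R :> R. Proof. by rewrite ltr0n. Qed.
Let tz := (200 / 199) `^ z : R.
Let tz0 : 0 < tz. Proof. by apply: powR_gt0; rewrite divr_gt0 ?ltr0n. Qed.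

(** Put P = q + z. The signal between l and k1 is at least (1 - e) (G^(- P) - k1^(- P)) / P with G
    close to (1 + e) / (1 - e) l. Minimality bounds l^q times this by signal beyond k1 and noise,
    both multiples of k1^(- P) / P times k1^q. Cancelling 1 / P leaves l^(- z) against k1^(- z). *)
Lemma minimiser_late (e : R) (n1 l : nat) :
  0 <= e < 1 -> sumsq_near e n1 x -> (n1 < k1)%N -> (n1 <= l < k1)%N -> (0 < l)%N ->
  l%:R `^ q * (\sum_(l <= j < (2 * k1).+1) y j ^+ 2) <=
  k1%:R `^ q * (\sum_(k1 <= j < (2 * k1).+1) y j ^+ 2) ->
  ka `^ z <= 56 / 25 * tz * ((1 + e) / (1 - e) * (1 + 2 / l%:R)) `^ (q + z) *
    ((3 * ((1 + e) * (1 + (q + z) / k1%:R) + 2 * e * (q + z)) + 15 / 4 * z) / (1 - e) + 1)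
    * l%:R `^ z.
Proof.
move=> e01 nx1 n1k1 /andP[n1l lk] l0.
have /andP[e0 e1] := e01.
have e1' : 0 < 1 - e by rewrite subr_gt0.
have lR : 0 < l%:R :> R by rewrite ltr0n.
have l1 : 1 <= l%:R :> R by rewrite ler1n.
set P := q + z; set al := (1 + e) * _ + _.
have kz : k1%:R `^ (- z) = k1%:R `^ q * k1%:R `^ (- P) :> R.
  by rewrite -gt0_powRD//; congr (_ `^ _); rewrite /P; ring.
rewrite (@big_cat_nat _ _ _ k1 l)//= ?(ltnW lk) ?(leq_trans _ (leqnSn _)) ?leq_pmull//.
set Y1 := \sum_(l <= j < k1) y j ^+ 2; set Y2 := \sum_(k1 <= j < (2 * k1).+1) y j ^+ 2 => hY.
have sq0 (f : nat -> R) a b : 0 <= \sum_(a <= j < b) f j ^+ 2.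
  by apply: sumr_ge0 => *; exact: sqr_ge0.
have lq0 : 0 < l%:R `^ q by rewrite powR_gt0.
have kq0 : 0 < k1%:R `^ q by rewrite powR_gt0.
have lkq : l%:R `^ q <= k1%:R `^ q.
  by rewrite ge0_ler_powR ?nnegrE ?(ltW q0) ?(ltW lR) ?(ltW k1R)// ler_nat ltnW.
have hY1 : l%:R `^ q * Y1 <= k1%:R `^ q * Y2.
  have : 0 <= l%:R `^ q * Y2 by rewrite mulr_ge0 ?(ltW lq0) ?sq0.
  by move: hY; rewrite mulrDr; lra.
(* t = 1/2 on the left and t = 1 on the right: as 3/2 * 2 = 3, both noise blocks enter with the
   coefficient 3 and are bounded together as one sum up to 2 k1. *)
have t2 : 0 < 2^-1 :> R by [].
have := @signal_sumsq_le _ r de x g 2^-1 l k1 t2; rewrite invrK -/Y1.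
have := @noisy_sumsq_le_signal _ r de x g 1 k1 (2 * k1).+1 ltr01; rewrite invr1 -/Y2.
set S1 := \sum_(l <= j < k1) _ * _; set S2 := \sum_(k1 <= j < (2 * k1).+1) _ * _.
set G1 := \sum_(l <= j < k1) _; set G2 := \sum_(k1 <= j < (2 * k1).+1) _ => hS2 hS1.
have n0k1 : (n0 < k1)%N by have [] := competitor_large q0 z0 La100 kaE n0La k1K.
have hG : G1 + G2 <= 5 / 2 * k1%:R.
  rewrite /G1 /G2 -big_cat_nat//= ?(ltnW lk) ?(leq_trans _ (leqnSn _)) ?leq_pmull//.
  apply: (le_trans (sumsq_near_le ng _ l0)).
    by rewrite (leq_trans (ltnW n0k1))// leq_pmull.
  by rewrite natrM; lra.
have kP0 : 0 < k1%:R `^ (- P) :> R by rewrite powR_gt0.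
have krP : k1%:R `^ (- r) = k1%:R `^ (- P) / k1%:R :> R by rewrite powRNS.
(* Here the factor 2 (1 + s) in K1 pays off: as z (1 + s) = P, the noise becomes a multiple of z /
   P, in the form of the signal tail. *)
have hdG : de ^+ 2 * (G1 + G2) <= 5 / 4 * z * (k1%:R `^ (- P) / P).
  apply: (@le_trans _ _ (k1%:R `^ (- r) / (2 * (1 + s)) * (5 / 2 * k1%:R))).
    by apply: ler_pM; rewrite ?sqr_ge0 ?addr_ge0 ?sq0//; exact: (competitor_noise q0 z0 La100 kaE de2 n0La k1K).
  rewrite krP /P -zs le_eqVlt; apply/orP; left; apply/eqP; field.
  by rewrite !gt_eqF ?addr_gt0.
have hS2' : S2 <= al * (k1%:R `^ (- P) / P).
  have n1k : (n1 <= k1.-1)%N by rewrite -ltnS prednK.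
  have := @sumsq_weighted_le _ e P n1 x k1.-1 (2 * k1).+1 e0 P0 nx1 n1k.
  rewrite prednK// -/S2 => /le_trans; apply.
  have kb : (k1 < (2 * k1).+1)%N by rewrite ltnS leq_pmull.
  have h1 : \sum_(k1 <= j < (2 * k1).+1) j%:R `^ (- r) <= k1%:R `^ (- r) + k1%:R `^ (- P) / P :> R.
    by rewrite big_ltn// lerD2l sum_powR_le.
  have h2 : (k1.-1)%:R * k1%:R `^ (- r) <= k1%:R `^ (- P) :> R.
    by rewrite krP mulrCA ler_piMr ?(ltW kP0)// ler_pdivrMr// mul1r ler_nat leq_pred.
  have h3 := ler_wpM2l (addr_ge0 ler01 e0) h1.
  have h4 := ler_wpM2l (mulr_ge0 (ler0n R 2) e0) h2.
  apply: (@le_trans _ _ ((1 + e) * (k1%:R `^ (- r) + k1%:R `^ (- P) / P) + 2 * e * k1%:R `^ (- P))).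
    by move: h3 h4; rewrite !mulrA; lra.
  rewrite krP /al le_eqVlt; apply/orP; left; apply/eqP; field.
  by rewrite !gt_eqF.
pose G := (Num.truncn ((1 + e) / (1 - e) * l%:R : R)).+2.
have g0 : 0 < (1 + e) / (1 - e) by rewrite divr_gt0// ltr_wpDr.
have g1 : 1 <= (1 + e) / (1 - e) by rewrite ler_pdivlMr//; lra.
have gl0 : 0 <= (1 + e) / (1 - e) * l%:R by rewrite mulr_ge0 ?(ltW g0).
have G1' : (1 + e) / (1 - e) * l%:R + 1 <= G%:R.
  by rewrite -natr1 lerD2r ltW// truncnS_gt.
have G2' : G%:R <= (1 + e) / (1 - e) * l%:R + 2.
  by rewrite /G -addn2 natrD lerD2r truncn_le.
have hS1' : (1 - e) * ((G%:R `^ (- P) - k1%:R `^ (- P)) / P) <= S1.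
  apply: (le_trans (@sumsq_weighted_ge _ e P n1 x l k1 G e01 P0 nx1 n1l l0 k10 G1')).
  by rewrite /S1 [in leRHS]big_ltn// lerDr mulr_ge0 ?powR_ge0 ?sqr_ge0//.
set kP := k1%:R `^ (- P) in kz kP0 hdG hS2' hS1'.
set GP := G%:R `^ (- P) in hS1'.
have main : l%:R `^ q * ((1 - e) * ((GP - kP) / P)) <=
    k1%:R `^ q * (3 * (al * (kP / P)) + 3 * (5 / 4 * z * (kP / P))).
  apply: (le_trans (ler_wpM2l (ltW lq0) hS1')).
  apply: (le_trans (ler_wpM2l (ltW lq0) hS1)).
  have i1 : l%:R `^ q * (de ^+ 2 * G1) <= k1%:R `^ q * (de ^+ 2 * G1).
    by rewrite ler_wpM2r// mulr_ge0 ?sqr_ge0 ?sq0.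
  have i2 := ler_wpM2l (ltW kq0) hS2.
  have i3 := ler_wpM2l (ltW kq0) hS2'.
  have i4 := ler_wpM2l (ltW kq0) hdG.
  lra.
have GP2 : l%:R `^ q * GP <= kP * k1%:R `^ q * ((3 * al + 15 / 4 * z) / (1 - e) + 1).
  have j1 : l%:R `^ q * kP <= k1%:R `^ q * kP by rewrite ler_pM2r.
  have j2 : l%:R `^ q * (GP - kP) <= k1%:R `^ q * kP * ((3 * al + 15 / 4 * z) / (1 - e)).
    have PE : 0 < P / (1 - e) by rewrite divr_gt0.
    have := ler_wpM2r (ltW PE) main.
    rewrite [X in X <= _](_ : _ = l%:R `^ q * (GP - kP)); last first.
      by field; rewrite !gt_eqF.
    move/le_trans; apply; rewrite le_eqVlt; apply/orP; left; apply/eqP; field.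
    by rewrite !gt_eqF.
  by move: j2; rewrite mulrBr; lra.
have gp0 : 0 < (1 + e) / (1 - e) * (1 + 2 / l%:R).
  by rewrite (mulr_gt0 g0)// addr_gt0// divr_gt0.
have Gl : ((1 + e) / (1 - e) * (1 + 2 / l%:R)) `^ (- P) * l%:R `^ (- P) <= GP.
  have GR : 0 < G%:R :> R by rewrite ltr0n.
  have glp : 0 < (1 + e) / (1 - e) * (1 + 2 / l%:R) * l%:R by rewrite (mulr_gt0 gp0).
  rewrite -(powRM _ (ltW gp0) (ltW lR)) /GP !powRN lef_pV2 ?posrE ?(powR_gt0 _ GR) ?(powR_gt0 _ glp)//.
  apply: ge0_ler_powR; rewrite ?nnegrE ?(ltW P0) ?(ltW GR) ?(ltW glp)//.
  have -> : (1 + e) / (1 - e) * (1 + 2 / l%:R) * l%:R =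
      (1 + e) / (1 - e) * l%:R + (1 + e) / (1 - e) * 2 by field; rewrite !gt_eqF.
  by apply: (le_trans G2'); rewrite lerD2l ler_peMl.
set gg := (1 + e) / (1 - e) * (1 + 2 / l%:R) in gp0 Gl *.
have gg0 : 0 < gg `^ P by rewrite powR_gt0.
set Bk := (_ / _ + 1) in GP2 *.
have lz : l%:R `^ (- z) = l%:R `^ q * l%:R `^ (- P) :> R.
  by rewrite -gt0_powRD//; congr (_ `^ _); rewrite /P; ring.
have : l%:R `^ (- z) <= gg `^ P * Bk * k1%:R `^ (- z).
  rewrite lz kz; have := ler_wpM2l (ltW lq0) Gl => /le_trans /(_ GP2).
  move/(ler_wpM2l (ltW gg0)) => h.
  have E : gg `^ P * (l%:R `^ q * (gg `^ (- P) * l%:R `^ (- P))) = l%:R `^ q * l%:R `^ (- P).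
    by rewrite powRN; field; rewrite gt_eqF.
  rewrite E in h; apply: (le_trans h).
  by rewrite le_eqVlt; apply/orP; left; apply/eqP; ring.
rewrite !powRN ler_pdivlMr ?powR_gt0// [leLHS]mulrC ler_pdivrMr ?powR_gt0// => hh.
apply: (le_trans (competitor_ka q0 z0 La100 kaE n0La k1K)).
have c0 : 0 <= 56 / 25 * tz by rewrite mulr_ge0// (ltW tz0).
apply: (le_trans (ler_wpM2l c0 hh)).
by rewrite le_eqVlt; apply/orP; left; apply/eqP; ring.
Qed.

End late_minimiser.

(** * Noise at the selected index and lower bound for every error *)

Section quasi_optimality.
Context {R : realType}.
Variables q z La ka de : R.
Hypotheses (q0 : 0 < q) (z0 : 0 < z) (La100 : 100 <= La).
Local Notation s := (q / z).
Local Notation r := (q + z + 1).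
Local Notation D := (La `^ (1 + s)).
Hypothesis kaE : ka = 324 `^ (z^-1) * 2 `^ (1 + s) * D.
Hypothesis de2 : de ^+ 2 = ka `^ (- r).
Variables (n0 : nat) (x g : nat -> R).
Hypotheses (n0La : La <= n0%:R <= La + 1).
Hypotheses (nx : sumsq_near 4^-1 n0 x) (ng : sumsq_near 4^-1 n0 g).
Local Notation y := (noisy_coef r de x g).

Variable kHD : nat -> nat.
Hypothesis kHD_adm : forall m, (2 <= m)%N -> (0 < kHD m)%N /\ (2 * kHD m <= m)%N.
Hypothesis kHD_min : forall m k, (2 <= m)%N -> (0 < k)%N -> (2 * k <= m)%N ->
  (kHD m)%:R `^ q * (\sum_(kHD m <= j < m.+1) y j ^+ 2) <=
  k%:R `^ q * (\sum_(k <= j < m.+1) y j ^+ 2).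

Let V (k : nat) : R := de ^+ 2 * \sum_(1 <= j < k.+1) j%:R `^ q * g j ^+ 2.

(** The squared error, given through the two properties that make it the least upper bound of its
    partial sums. *)
Variable err2 : nat -> R.
Hypothesis err2_ge : forall k n, V k + \sum_(k.+1 <= j < n) j%:R `^ (- (z + 1)) * x j ^+ 2 <= err2 k.
Hypothesis err2_le : forall k c, (forall n,
  V k + \sum_(k.+1 <= j < n) j%:R `^ (- (z + 1)) * x j ^+ 2 <= c) -> err2 k <= c.

Let s0 : 0 < s. Proof. exact: divr_gt0. Qed.
Let P0 : 0 < q + z. Proof. exact: addr_gt0. Qed.
Let r0 : 0 < r. Proof. exact: addr_gt0. Qed.
Let La0 : 0 < La. Proof. by rewrite (lt_le_trans _ La100). Qed.
Let zs : z * (1 + s) = q + z. Proof. by field; rewrite gt_eqF. Qed.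
Let ka0 : 0 < ka := scale_ka_gt0 La100 kaE.
Let D_La : La <= D := scale_La_le_D q0 z0 La100.
Let D100 : 100 * (1 + s) <= D := scale_D_ge q0 z0 La100.
Let ka2D : 2 * D <= ka := scale_ka_ge2D q0 z0 La100 kaE.
Let ka200 : 200 * (1 + s) <= ka. Proof. have h1 := D100; have h2 := ka2D; lra. Qed.
Let ka200' : 200 <= ka. Proof. have h1 := ka200; have h2 := s0; lra. Qed.
Let N := ka `^ (- z).
Let N0 : 0 < N. Proof. exact: powR_gt0. Qed.
Let de2_0 : 0 < de ^+ 2. Proof. by rewrite de2 powR_gt0. Qed.
Let de2N : de ^+ 2 * ka `^ (q + 1) = N.
Proof. by rewrite de2 -gt0_powRD// /N; congr (_ `^ _); ring. Qed.

Let k := (Num.truncn ka).+1.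
Let kka : ka <= k%:R <= ka + 1.
Proof. by rewrite ltW ?truncnS_gt//= -natr1 lerD2r truncn_le// ltW. Qed.
Let n0k : (n0 <= k)%N.
Proof.
rewrite -(ler_nat R); have /andP[h1 _] := kka; have /andP[_ h2] := n0La.
have h3 := ka2D; have h4 := D_La; have h5 := La100; lra.
Qed.

Let kHD_q m : (2 <= m)%N -> (kHD m)%:R `^ q <= 100 * k%:R `^ q.
Proof.
move=> m2; have [l0 lm] := kHD_adm m2; have /andP[h1 _] := kka.
apply: (@minimiser_not_large _ q z ka de q0 z0 ka0 de2 n0 x g nx ng k (kHD m) m h1 n0k _ l0 lm) => // k' k'0 k'm.
exact: kHD_min.
Qed.

Lemma kHD_le m : (2 <= m)%N -> (kHD m)%:R <= 100 `^ (q^-1) * k%:R.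
Proof.
move=> m2; have qi : 0 <= q^-1 by rewrite invr_ge0 (ltW q0).
have := @ge0_ler_powR R _ qi ((kHD m)%:R `^ q) (100 * k%:R `^ q).
rewrite !nnegrE powR_ge0 mulr_ge0 ?powR_ge0// => /(_ isT isT (kHD_q m2)).
by rewrite powRM ?powR_ge0// -!powRrM mulfV ?gt_eqF// !powRr1.
Qed.

Lemma kHD_bounded : exists M, forall m, (2 <= m)%N -> (kHD m <= M)%N.
Proof.
exists (Num.truncn (100 `^ (q^-1) * k%:R : R)) => m m2.
by rewrite truncn_ge_nat ?kHD_le// mulr_ge0 ?powR_ge0.
Qed.

Lemma noise_kHD_le m : (2 <= m)%N ->
  V (kHD m) <= 125 / 432 * (101 / 100) * (101 / 100) `^ z * 432 `^ (1 + q^-1) * N.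
Proof.
move=> m2; set l := kHD m.
have k0 : 0 < k%:R :> R by rewrite ltr0n.
have l_le : l%:R <= 100 `^ (q^-1) * k%:R := kHD_le m2.
have c1 : 1 <= 100 `^ (q^-1) :> R.
  by rewrite -[leLHS](powRr0 100); apply: ler_powR; rewrite ?ler1n// invr_ge0 (ltW q0).
have sg : \sum_(1 <= j < l.+1) g j ^+ 2 <= 5 / 4 * (100 `^ (q^-1) * k%:R).
  (* l may lie below n0, where the sums are not controlled; the sum up to the larger of l and k
     is. *)
  have mk : (maxn l k)%:R <= 100 `^ (q^-1) * k%:R.
    by rewrite /maxn; case: ifP => // _; rewrite ler_peMl// ltW.
  apply: (@le_trans _ _ (\sum_(1 <= j < (maxn l k).+1) g j ^+ 2)).
    by apply: sumsq_le_block => //; rewrite ltnS leq_maxl.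
  apply: (le_trans (sumsq_near_le ng _ (ltn0Sn 0))); first by rewrite leq_max n0k orbT.
  have := mk; lra.
have V1 : V l <= de ^+ 2 * (l%:R `^ q * (5 / 4 * (100 `^ (q^-1) * k%:R))).
  rewrite /V ler_pM2l//.
  apply: (@le_trans _ _ (l%:R `^ q * \sum_(1 <= j < l.+1) g j ^+ 2)); last first.
    by rewrite ler_wpM2l// powR_ge0.
  rewrite mulr_sumr; apply: ler_sum_nat => j /andP[_ jl].
  by rewrite ler_wpM2r ?sqr_ge0// ge0_ler_powR ?nnegrE ?(ltW q0) ?ler0n// ler_nat.
apply: (le_trans V1).
have c0 : 0 <= 5 / 4 * (100 `^ (q^-1) * k%:R) by rewrite !mulr_ge0 ?powR_ge0.
have V2 := ler_wpM2l (ltW de2_0) (ler_wpM2r c0 (kHD_q m2)).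
apply: (le_trans V2).
(* (k / ka)^(q + 1) <= exp ((q + 1) / ka), and ka >= 200 (1 + s) makes the exponent at most (z + 1)
   / 200, which is free of q. *)
have kq1 : k%:R `^ (q + 1) <= ka `^ (q + 1) * (101 / 100 * (101 / 100) `^ z).
  have e1 : expR (200^-1) <= 101 / 100 :> R by apply: expR_le_frac; lra.
  have /andP[_ h1] := kka; have h2 := ka200; have h3 := z0; have h4 := q0.
  have i0 : 0 < ka^-1 by rewrite invr_gt0.
  have i1 : 0 <= 1 + ka^-1 := addr_ge0 ler01 (ltW i0).
  apply: (@le_trans _ _ ((ka * (1 + ka^-1)) `^ (q + 1))).
    apply: ge0_ler_powR; rewrite ?nnegrE ?(ltW k0) ?(mulr_ge0 (ltW ka0) i1) ?addr_ge0 ?(ltW q0)//.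
    by rewrite mulrDr mulr1 divff ?gt_eqF.
  rewrite (powRM _ (ltW ka0) i1) ler_pM2l ?powR_gt0//.
  have -> : 101 / 100 * (101 / 100) `^ z = (101 / 100) `^ (z + 1) :> R.
    by rewrite gt0_powRD// powRr1// mulrC.
  apply: (@le_trans _ _ (expR (200^-1) `^ (z + 1))); last first.
    by rewrite ge0_ler_powR ?nnegrE ?expR_ge0 ?addr_ge0 ?(ltW z0).
  rewrite !powR_lnE ?expR_gt0 ?addr_gt0// expRK ler_expR.
  apply: (@le_trans _ _ ((q + 1) * ka^-1)).
    rewrite ler_wpM2l ?addr_ge0 ?(ltW q0)//.
    have := @ln_le_sub1 R (1 + ka^-1); rewrite addr_gt0// => /(_ isT).
    by rewrite (addrC 1) addrK.
  rewrite ler_pdivrMr// [leRHS]mulrAC ler_pdivlMr//.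
  have h5 : (q + 1) * 200 <= (z + 1) * (200 * (1 + s)).
    have h6 : (1 + s) * (z + 1) = q + z + 1 + s by rewrite mulrDr mulr1 mulrC zs addrA.
    have h7 := s0; lra.
  by apply: (le_trans h5); rewrite ler_wpM2l// addr_ge0// ltW.
have k1E : k%:R `^ (q + 1) = k%:R `^ q * k%:R :> R by rewrite gt0_powRD// powRr1// ltW.
(* The bound is brought to 432^(1 + 1/q) = A^(1 + q), the form in which A enters C. *)
have c4 : 100 `^ q^-1 <= 432 `^ q^-1 :> R.
  apply: ge0_ler_powR; first by rewrite invr_ge0 (ltW q0).
  - by rewrite nnegrE ler0n.
  - by rewrite nnegrE ler0n.
  - by rewrite ler_nat.
have p432 : 0 < 432 :> R by rewrite ltr0n.
rewrite (gt0_powRD 1 q^-1 p432) (powRr1 (ltW p432)).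
apply: (@le_trans _ _ (125 * 100 `^ (q^-1) * (de ^+ 2 * k%:R `^ (q + 1)))).
  by rewrite k1E le_eqVlt; apply/orP; left; apply/eqP; field.
apply: (@le_trans _ _ (125 * 432 `^ (q^-1) * (de ^+ 2 * (ka `^ (q + 1) * (101 / 100 * (101 / 100) `^ z))))).
  apply: (ler_pM _ _ (ler_wpM2l (ler0n R 125) c4) (ler_wpM2l (ltW de2_0) kq1)).
    by rewrite mulr_ge0 ?powR_ge0 ?ler0n.
  by rewrite mulr_ge0 ?powR_ge0 ?sqr_ge0.
by rewrite -de2N le_eqVlt; apply/orP; left; apply/eqP; field.
Qed.

(** Makes the error tend to infinity with the level, so that the oracle minimum is attained. *)
Lemma noise_ge_linear k' : (n0 <= k')%N -> de ^+ 2 * (3 / 4 * k'%:R) <= V k'.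
Proof.
move=> n0k'; rewrite /V ler_pM2l//.
have /andP[h1 _] := ng n0k'.
apply: (@le_trans _ _ (\sum_(1 <= j < k'.+1) g j ^+ 2)); first by lra.
apply: ler_sum_nat => j /andP[j0 _]; rewrite ler_peMl ?sqr_ge0//.
by rewrite -[leLHS](powRr0 j%:R); apply: ler_powR; rewrite ?ler1n// (ltW q0).
Qed.

Let V_mono k1 k2 : (k1 <= k2)%N -> V k1 <= V k2.
Proof.
move=> k12; rewrite /V ler_pM2l// [leRHS](@big_cat_nat _ _ _ k1.+1)//= lerDl.
by apply: sumr_ge0 => j _; rewrite mulr_ge0 ?powR_ge0 ?sqr_ge0.
Qed.

Let tail_ge0 a b : 0 <= \sum_(a <= j < b) j%:R `^ (- (z + 1)) * x j ^+ 2.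
Proof. by apply: sumr_ge0 => j _; rewrite mulr_ge0 ?powR_ge0 ?sqr_ge0. Qed.

(* Split at the index t ka with t = (9/5) exp (2 / (5 z)): beyond it the noise
   is too large, before it the remaining tail of the signal is. *)
Lemma err2_lower k' : 2^-1 * ((151 / 50) `^ (- z) / z) * N <= err2 k'.
Proof.
(* exp (2 / (5 z)) >= 1 + 2 / (5 z) gives 3/4 t - 5/4 >= 1 / (2 z) on the noise side, whereas its
   power - z is the constant exp (- 2/5) >= 2/3 on the signal side. *)
pose t := 9 / 5 * expR (2 / 5 / z).
have zi : 0 < z^-1 by rewrite invr_gt0.
have t1 : 9 / 5 * (1 + 2 / 5 / z) <= t by rewrite ler_pM2l// expR_ge1Dx.
have t18 : 9 / 5 <= t.
  by apply: le_trans t1; rewrite ler_peMr// lerDl divr_ge0// (ltW z0).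
have tka0 : 0 <= t * ka by rewrite mulr_ge0 ?(ltW ka0)// (le_trans _ t18).
pose ks := (Num.truncn (t * ka)).+1.
have ks1 : t * ka <= ks%:R by rewrite ltW// truncnS_gt.
have ks2 : ks%:R <= t * ka + 1 by rewrite -natr1 lerD2r truncn_le.
pose k0 := Num.truncn ka.
have k01 : k0%:R <= ka by rewrite truncn_le// ltW.
have k02 : ka <= k0.+1%:R by rewrite ltW// truncnS_gt.
have tka : 9 / 5 * ka <= t * ka by rewrite ler_pM2r.
have [h1 h2 h3 h4 h5] : [/\ 2 * D <= ka, La <= D, 100 <= La, 200 <= ka & n0%:R <= La + 1].
  by split=> //; case/andP: n0La.
have n0k0 : (n0 <= k0)%N.
  by rewrite -ltnS -(ltr_nat R); lra.
have k0ks : (k0 <= ks)%N by rewrite -(ler_nat R); lra.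
have [ksk|kks] := leqP ks k'.
  apply: (@le_trans _ _ (V ks)); last first.
    apply: (le_trans (V_mono ksk)); apply: le_trans (err2_ge k' 0).
    by rewrite big_geq// addr0.
  have := sumsq_near_block ng (introT andP (conj n0k0 k0ks)) => /andP[hg _].
  have V1 : de ^+ 2 * (ka `^ q * ((3 / 4 * t - 5 / 4) * ka)) <= V ks.
    rewrite /V ler_pM2l//; apply: (@le_trans _ _ (\sum_(k0.+1 <= j < ks.+1) j%:R `^ q * g j ^+ 2)).
      apply: (@le_trans _ _ (ka `^ q * \sum_(k0.+1 <= j < ks.+1) g j ^+ 2)).
        by rewrite ler_pM2l ?powR_gt0//; lra.
      rewrite mulr_sumr; apply: ler_sum_nat => j /andP[kj _].
      rewrite ler_wpM2r ?sqr_ge0// ge0_ler_powR ?nnegrE ?(ltW q0) ?(ltW ka0)//.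
      by apply: (le_trans k02); rewrite ler_nat.
    rewrite [leRHS](@big_cat_nat _ _ _ k0.+1)//= ?ltnS// ?(leq_trans k0ks)// lerDr.
    by apply: sumr_ge0 => j _; rewrite mulr_ge0 ?powR_ge0 ?sqr_ge0.
  apply: le_trans V1; rewrite [leRHS](_ : _ = (3 / 4 * t - 5 / 4) * N); last first.
    by rewrite -de2N gt0_powRD// powRr1 ?(ltW ka0)//; ring.
  rewrite ler_pM2r//.
  apply: (@le_trans _ _ (2^-1 * z^-1)).
    rewrite ler_pM2l// ler_piMl ?(ltW zi)// powRN invf_le1 ?powR_gt0//.
    by rewrite -[leLHS](powRr0 (151 / 50)); apply: ler_powR; [lra|rewrite ltW].
  by have := t1; lra.
pose G := (Num.truncn (5 / 3 * ks%:R : R)).+2.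
have G1 : (1 + 4^-1) / (1 - 4^-1) * ks%:R + 1 <= G%:R :> R.
  have -> : (1 + 4^-1) / (1 - 4^-1) = 5 / 3 :> R by field.
  by rewrite -[G%:R]natr1 lerD2r ltW// truncnS_gt.
have G2 : G%:R <= 5 / 3 * ks%:R + 2 :> R.
  by rewrite /G -addn2 natrD lerD2r truncn_le// mulr_ge0.
have G3 : G%:R <= 151 / 50 * expR (2 / 5 / z) * ka.
  have := ks2; have : ka <= expR (2 / 5 / z) * ka.
    rewrite ler_peMl ?(ltW ka0)// -expR0 ler_expR divr_ge0 ?(ltW z0)//.
  by move: G2; rewrite /t; lra.
have G0 : 0 < G%:R :> R by rewrite ltr0n.
have Gz : 2 / 3 * ((151 / 50) `^ (- z) * N) <= G%:R `^ (- z).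
  apply: (@le_trans _ _ ((151 / 50 * expR (2 / 5 / z) * ka) `^ (- z))); last first.
    rewrite !powRN lef_pV2 ?posrE ?powR_gt0 ?mulr_gt0 ?expR_gt0//.
    by rewrite ge0_ler_powR ?nnegrE ?(ltW z0) ?(ltW G0) ?mulr_ge0 ?expR_ge0 ?(ltW ka0).
  have b0 : 0 <= 151 / 50 :> R by rewrite divr_ge0 ?ler0n.
  rewrite (powRM _ (mulr_ge0 b0 (expR_ge0 _)) (ltW ka0)) (powRM _ b0 (expR_ge0 _)) -/N.
  have -> : expR (2 / 5 / z) `^ (- z) = expR (- (2 / 5)).
    by rewrite powR_lnE ?expR_gt0// expRK; congr expR; field; rewrite gt_eqF.
  have e1 : 2 / 3 <= expR (- (2 / 5)) :> R.
    rewrite expRN -[leLHS]invrK lef_pV2 ?posrE ?expR_gt0 ?invr_gt0//.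
    by rewrite invf_div; apply: expR_le_frac; lra.
  apply: (le_trans (ler_wpM2r (mulr_ge0 (powR_ge0 _ _) (ltW N0)) e1)).
  by rewrite le_eqVlt; apply/orP; left; apply/eqP; ring.
rewrite leNgt; apply/negP => lt1.
pose T := 3 / 4 * (G%:R `^ (- z) / z).
have T1 : 2^-1 * ((151 / 50) `^ (- z) / z) * N <= T.
  rewrite /T; have := ler_wpM2r (ltW zi) Gz; rewrite -/z; lra.
(* The tail bound is for finite sums. Its upper end n is taken so large that the missing n^(- z) / z
   is at most the supposed gap T - err2 k', of which only 3/4 is lost. *)
pose et := (T - err2 k') * z.
have et0 : 0 < et by rewrite mulr_gt0// subr_gt0; exact: lt_le_trans lt1 T1.
pose n := (Num.truncn (et `^ (- z^-1))).+1.
have n1 : et `^ (- z^-1) <= n%:R by rewrite ltW// truncnS_gt.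
have nz : n%:R `^ (- z) <= et.
  rewrite powRN -[leRHS]invrK lef_pV2 ?posrE ?powR_gt0 ?invr_gt0//.
  have := @ge0_ler_powR R z (ltW z0) (et `^ (- z^-1)) n%:R.
  rewrite !nnegrE powR_ge0 ler0n => /(_ isT isT n1).
  by rewrite -powRrM mulNr mulVf ?gt_eqF// powR_inv1 ?(ltW et0).
have n0ks := leq_trans n0k0 k0ks.
have e14 : 0 <= (4^-1 : R) < 1 by apply/andP; split; [rewrite invr_ge0 ler0n|rewrite invf_lt1 ?ltr1n ?ltr0n].
have := @sumsq_weighted_ge _ 4^-1 z n0 x ks n G e14 z0 nx n0ks (ltn0Sn _) (ltn0Sn _) G1.
have : \sum_(ks.+1 <= j < n) j%:R `^ (- (z + 1)) * x j ^+ 2 <= err2 k'.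
  apply: le_trans (err2_ge k' n).
  have [nks|ksn] := leqP n ks.+1.
    by rewrite big_geq// addr_ge0 ?tail_ge0// /V mulr_ge0 ?sqr_ge0 ?sumr_ge0// => j _;
      rewrite mulr_ge0 ?powR_ge0 ?sqr_ge0.
  rewrite [in leRHS](@big_cat_nat _ _ _ ks.+1)//= ?(ltnW ksn)// ?ltnS ?(ltnW kks)//.
  rewrite addrA lerDr addr_ge0 ?tail_ge0// /V mulr_ge0 ?sqr_ge0 ?sumr_ge0// => j _.
  by rewrite mulr_ge0 ?powR_ge0 ?sqr_ge0.
have nz' := ler_wpM2r (ltW zi) nz.
have etE : et / z = T - err2 k' by rewrite /et mulfK ?gt_eqF.
rewrite etE in nz'; move: nz' => {}nz'.
have Te : err2 k' < T := lt_le_trans lt1 T1.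
by move: nz' Te; rewrite /T; lra.
Qed.

End quasi_optimality.

(** * Numerical inequalities behind the constant C *)

Section numeric_margins.
Context {R : realType}.
Implicit Types z : R.

Lemma powR_ge_ln (a p c : R) : 0 < a -> c <= p * ln a -> 1 + c <= a `^ p.
Proof.
move=> a0 h; rewrite powR_lnE//; apply: le_trans (expR_ge1Dx _).
by rewrite lerD2l.
Qed.

Let pos (m n : nat) : 0 < m.+1%:R / n.+1%:R :> R.
Proof. by rewrite divr_gt0 ?ltr0n. Qed.

Lemma ln37_ge3 : 3 <= ln 37 :> R.
Proof.
have p3 : 0 < 3 :> R by rewrite ltr0n.
have p37 : 0 < 37 :> R by rewrite ltr0n.
have l3 : 1 <= ln 3 :> R.
  rewrite -[leLHS]expRK ler_ln ?posrE ?expR_gt0//.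
  by apply: expR_le_frac; rewrite ?ler01 ?ltr1n//; lra.
have : ln (3 ^+ 3) <= ln 37 :> R by rewrite ler_ln ?posrE ?exprn_gt0//; lra.
by rewrite lnXn//; lra.
Qed.

(** 5/8 = 1 / (1 + 3/5): for s <= 3/5 the exponent (1 + z) / (q + z) of 324 in C^2 is at least 5/8
    (1 + 1/z). *)
Lemma powR_18_ge : 37 <= 324 `^ (5 / 8) :> R.
Proof.
have p18 : 0 < 18 :> R by rewrite ltr0n.
have -> : 324 = 18 `^ 2 :> R.
  by rewrite (powR_mulrn 2 (ltW p18)) -natrX.
rewrite -powRrM (_ : 2 * (5 / 8) = 1 + 4^-1); last by field.
rewrite (gt0_powRD 1 4^-1 p18) (powRr1 (ltW p18)).
have q0 : 0 <= 37 / 18 :> R by rewrite divr_ge0 ?ler0n.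
have : 37 / 18 <= 18 `^ 4^-1 :> R.
  have -> : 37 / 18 = ((37 / 18) `^ 4%:R) `^ 4^-1 :> R.
    by rewrite -powRrM divff ?pnatr_eq0// powRr1.
  apply: ge0_ler_powR; rewrite ?nnegrE ?powR_ge0 ?invr_ge0 ?ler0n//.
  by rewrite powR_mulrn//; lra.
lra.
Qed.

(** The bounds 1 + 3/z for 37^(1/z) and (1 + z/34)^4 for (170/151)^z reduce this to a polynomial
    inequality in z, because 2 * 200/151 = 40/17 * 170/151. *)
Lemma margin_large_signal z : 0 < z ->
  5 / 4 * (56 / 25 * (6 + 33 / 4 * z) * (40 / 17) `^ z) <=
  9 / 8 * (2 * (37 * 37 `^ z^-1) * 2 `^ z * (200 / 151) `^ z).
Proof.
move=> z0; have p37 : 0 < 37 :> R by rewrite ltr0n.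
have p2 : 0 <= 2 :> R by rewrite ler0n.
have E : 2 `^ z * (200 / 151) `^ z = (40 / 17) `^ z * (170 / 151) `^ z :> R.
  rewrite -(powRM _ p2 (ltW (pos 199 150))) -(powRM _ (ltW (pos 39 16)) (ltW (pos 169 150))).
  by congr (_ `^ _); field.
have h1 : 1 + 3 / z <= 37 `^ z^-1.
  by apply: powR_ge_ln => //; rewrite mulrC ler_wpM2l ?ln37_ge3// invr_ge0 ltW.
have h2 : (1 + z / 34) ^+ 4 <= (170 / 151) `^ z.
  have -> : (170 / 151) `^ z = ((170 / 151) `^ (z / 4)) ^+ 4 :> R.
    by rewrite -(powR_mulrn 4 (powR_ge0 _ _)) -powRrM; congr (_ `^ _); field.
  have l17 : 38 / 321 <= ln (170 / 151) :> R.
    have := @ln_ge_mobius R (19 / 151) (ltW (pos 18 150)).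
    have -> : 1 + 19 / 151 = 170 / 151 :> R by field.
    have -> : 2 * (19 / 151) / (2 + 19 / 151) = 38 / 321 :> R by field.
    by [].
  have h : 1 + z / 34 <= (170 / 151) `^ (z / 4).
    apply: (powR_ge_ln (pos 169 150)).
    apply: (@le_trans _ _ (z / 4 * (38 / 321))); first by have := z0; lra.
    by rewrite ler_wpM2l// divr_ge0 ?ler0n// ltW.
  have hh : 0 <= 1 + z / 34 by rewrite addr_ge0 ?divr_ge0 ?ler0n ?ltW.
  by rewrite ler_pXn2r ?nnegrE ?powR_ge0.
have T0 : 0 < (40 / 17) `^ z :> R by rewrite powR_gt0.
have h12 : (1 + 3 / z) * (1 + z / 34) ^+ 4 <= 37 `^ z^-1 * (170 / 151) `^ z.
  apply: ler_pM => //; last by rewrite exprn_ge0// addr_ge0 ?divr_ge0 ?ler0n ?ltW.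
  by rewrite addr_ge0 ?divr_ge0 ?ler0n ?ltW.
have poly : 5 / 4 * (56 / 25 * (6 + 33 / 4 * z)) <= 9 / 8 * 74 * ((1 + 3 / z) * (1 + z / 34) ^+ 4).
  rewrite -subr_ge0.
  have -> : 9 / 8 * 74 * ((1 + 3 / z) * (1 + z / 34) ^+ 4) - 5 / 4 * (56 / 25 * (6 + 33 / 4 * z)) =
    z^-1 * (9 / 8 * 74 * ((z + 3) * (1 + z / 34) ^+ 4) - z * (14 / 5 * (6 + 33 / 4 * z))).
    by field; rewrite gt_eqF.
  rewrite mulr_ge0 ?invr_ge0 ?(ltW z0)//.
  have sq := sqr_ge0 (z - 13); have z2 := mulr_ge0 (ltW z0) sq.
  have z3 : 0 <= z ^+ 3 by rewrite exprn_ge0 ?ltW.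
  have z4 : 0 <= z ^+ 4 by rewrite exprn_ge0 ?ltW.
  have z5 : 0 <= z ^+ 5 by rewrite exprn_ge0 ?ltW.
  nra.
have := ler_wpM2r (ltW T0) (le_trans poly (ler_wpM2l (_ : 0 <= 9 / 8 * 74) h12)).
move=> /(_ (mulr_ge0 (ltW (pos 8 7)) (ler0n R 74))) h.
apply: (@le_trans _ _ (5 / 4 * (56 / 25 * (6 + 33 / 4 * z)) * (40 / 17) `^ z)).
  by rewrite le_eqVlt; apply/orP; left; apply/eqP; ring.
apply: (le_trans h); rewrite -(mulrA _ (2 `^ z)) E.
by rewrite le_eqVlt; apply/orP; left; apply/eqP; ring.
Qed.

(** Mx is the maximum in C. For z <= 1/2 its entry 1 is used, with w <= 7 / (8 z). For larger z the
    entry z 4^z is used: 4 = 200/151 * 151/50 cancels the power of 151/50 from [err2_lower]. *)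
Lemma margin_small_noise z (w Mx : R) : 0 < z -> 0 <= w -> w ^+ 2 = 1 + z^-1 ->
  1 <= Mx -> z * 4 `^ z <= Mx ->
  14 / 5 * w * (47 / 10 + 533 / 100 * z) * (3 / 2) `^ z <=
  66 * (41 / 29) `^ z * (Mx * (151 / 50) `^ (- z) / z).
Proof.
move=> z0 w0 w2 M1 M4.
have zi : 0 < z^-1 by rewrite invr_gt0.
have zz : z * z^-1 = 1 by rewrite divff ?gt_eqF.
have t0 : 0 < (3 / 2) `^ z :> R by rewrite powR_gt0.
have u0 : 0 < (151 / 50) `^ z :> R by rewrite powR_gt0.
have v1 : 1 <= (41 / 29) `^ z :> R.
  by rewrite -[leLHS](powRr0 (41 / 29)); apply: ler_powR; [lra|exact: ltW].
have [zh|zh] := leP z 2^-1.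
  have wz : w <= 7 / 8 * z^-1.
    rewrite -(@ler_pXn2r _ 2)// ?nnegrE// ?mulr_ge0 ?(ltW zi) ?(ltW (pos 6 7))//.
    rewrite w2 exprMn; have h : z * (1 + z) <= 3 / 4 by nra.
    have := ler_wpM2r (sqr_ge0 z^-1) h.
    have -> : z * (1 + z) * z^-1 ^+ 2 = 1 + z^-1 by field; rewrite gt_eqF.
    by have := sqr_ge0 z^-1; lra.
  have sq : (3 / 2) `^ z * (151 / 50) `^ z <= 11 / 5 :> R.
    rewrite -(powRM _ (ltW (pos 2 1)) (ltW (pos 150 49))).
    apply: (@le_trans _ _ ((3 / 2 * (151 / 50)) `^ 2^-1)).
      by apply: ler_powR => //; lra.
    rewrite powR12_sqrt ?mulr_ge0 ?(ltW (pos 2 1)) ?(ltW (pos 150 49))//.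
    rewrite -[leRHS]ger0_norm ?(ltW (pos 10 4))// -sqrtr_sqr ler_wsqrtr//; lra.
  rewrite powRN; apply: (@le_trans _ _ (66 * (z^-1 / (151 / 50) `^ z))); last first.
    have h1 : z^-1 / (151 / 50) `^ z <= (41 / 29) `^ z * (Mx * ((151 / 50) `^ z)^-1 / z).
      rewrite -[leLHS]mul1r; apply: ler_pM => //.
        by rewrite mulr_ge0 ?(ltW zi) ?invr_ge0 ?(ltW u0).
      by rewrite (mulrC z^-1) ler_wpM2r ?(ltW zi)// -[leLHS]mul1r ler_wpM2r// invr_ge0 ltW.
    by rewrite -(mulrA 66) ler_wpM2l// ler0n.
  rewrite mulrA ler_pdivlMr//.
  have c0 : 0 <= 47 / 10 + 533 / 100 * z by have := z0; lra.
  have c1 : 47 / 10 + 533 / 100 * z <= 15 / 2 by lra.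
  have h2 : w * (47 / 10 + 533 / 100 * z) <= 7 / 8 * z^-1 * (15 / 2) by apply: ler_pM.
  have h3 : w * (47 / 10 + 533 / 100 * z) * ((3 / 2) `^ z * (151 / 50) `^ z) <=
     7 / 8 * z^-1 * (15 / 2) * (11 / 5).
    by apply: ler_pM => //; rewrite mulr_ge0// ltW.
  apply: (@le_trans _ _ (14 / 5 * (7 / 8 * z^-1 * (15 / 2) * (11 / 5)))); last by have := zi; lra.
  apply: le_trans (ler_wpM2l (ltW (pos 13 4)) h3).
  by rewrite le_eqVlt; apply/orP; left; apply/eqP; ring.
have w26 : w <= 26 / 15.
  rewrite -(@ler_pXn2r _ 2)// ?nnegrE// ?(ltW (pos 25 14))// w2.
  have : z^-1 <= 2 by rewrite -[leRHS]invrK lef_pV2 ?posrE ?invr_gt0// ltW.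
  lra.
have p4 : 0 <= 4 :> R by rewrite ler0n.
have p151 : 0 <= 151 / 50 :> R := ltW (pos 150 49).
have M5 : (200 / 151) `^ z <= Mx * (151 / 50) `^ (- z) / z.
  rewrite ler_pdivlMr// powRN ler_pdivlMr//; apply: le_trans M4.
  have -> : 4 = 200 / 151 * (151 / 50) :> R by field.
  rewrite (powRM _ (ltW (pos 199 150)) p151).
  by rewrite le_eqVlt; apply/orP; left; apply/eqP; ring.
have base : (156 / 125) `^ z * (3 / 2) `^ z <= (41 / 29) `^ z * (200 / 151) `^ z :> R.
  rewrite -(powRM _ (ltW (pos 155 124)) (ltW (pos 2 1))) -(powRM _ (ltW (pos 40 28)) (ltW (pos 199 150))).
  apply: ge0_ler_powR; rewrite ?nnegrE ?(ltW z0)//.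
  lra.
have h2 : (1 + 11 / 100 * z) ^+ 2 <= (156 / 125) `^ z.
  have -> : (156 / 125) `^ z = ((156 / 125) `^ (z / 2)) ^+ 2 :> R.
    by rewrite -(powR_mulrn 2 (powR_ge0 _ _)) -powRrM; congr (_ `^ _); field.
  have l1 : 62 / 281 <= ln (156 / 125) :> R.
    have := @ln_ge_mobius R (31 / 125) (ltW (pos 30 124)).
    have -> : 1 + 31 / 125 = 156 / 125 :> R by field.
    have -> : 2 * (31 / 125) / (2 + 31 / 125) = 62 / 281 :> R by field.
    by [].
  have h : 1 + 11 / 100 * z <= (156 / 125) `^ (z / 2).
    apply: (powR_ge_ln (pos 155 124)).
    apply: (@le_trans _ _ (z / 2 * (62 / 281))); first by have := z0; lra.
    by rewrite ler_wpM2l// divr_ge0 ?ler0n// ltW.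
  have hh : 0 <= 1 + 11 / 100 * z by rewrite addr_ge0 ?mulr_ge0 ?(ltW (pos 10 99)) ?ltW.
  by rewrite ler_pXn2r ?nnegrE ?powR_ge0.
have poly : 14 / 5 * w * (47 / 10 + 533 / 100 * z) <= 66 * (1 + 11 / 100 * z) ^+ 2.
  have c0 : 0 <= 47 / 10 + 533 / 100 * z by have := z0; lra.
  have h3 := ler_wpM2r c0 w26.
  apply: (@le_trans _ _ (14 / 5 * (26 / 15 * (47 / 10 + 533 / 100 * z)))); first by lra.
  by have := sqr_ge0 (z - 71 / 10); nra.
apply: (le_trans (ler_wpM2r (ltW t0) (le_trans poly (ler_wpM2l (ler0n R 66) h2)))).
rewrite -!(mulrA 66) ler_wpM2l ?ler0n//.
by apply: (le_trans base); rewrite ler_wpM2l ?powR_ge0.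
Qed.

End numeric_margins.

(** * Quasi-optimality on the good event *)

Section combination.
Context {R : realType}.
Variables q z La ka de : R.
Hypotheses (q0 : 0 < q) (z0 : 0 < z) (La100 : 100 <= La).
Local Notation s := (q / z).
Local Notation r := (q + z + 1).
Local Notation D := (La `^ (1 + s)).
Hypothesis kaE : ka = 324 `^ (z^-1) * 2 `^ (1 + s) * D.
Hypothesis de2 : de ^+ 2 = ka `^ (- r).
Variables (n0 : nat) (x g : nat -> R).
Hypotheses (n0La : La <= n0%:R <= La + 1).
Hypotheses (nx : sumsq_near 4^-1 n0 x) (ng : sumsq_near 4^-1 n0 g).
Local Notation y := (noisy_coef r de x g).

Variable kHD : nat -> nat.
Hypothesis kHD_adm : forall m, (2 <= m)%N -> (0 < kHD m)%N /\ (2 * kHD m <= m)%N.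
Hypothesis kHD_min : forall m k, (2 <= m)%N -> (0 < k)%N -> (2 * k <= m)%N ->
  (kHD m)%:R `^ q * (\sum_(kHD m <= j < m.+1) y j ^+ 2) <=
  k%:R `^ q * (\sum_(k <= j < m.+1) y j ^+ 2).

Let s0 : 0 < s. Proof. exact: divr_gt0. Qed.
Let P0 : 0 < q + z. Proof. exact: addr_gt0. Qed.
Let r0 : 0 < r. Proof. exact: addr_gt0. Qed.
Let La0 : 0 < La. Proof. by rewrite (lt_le_trans _ La100). Qed.
Let zs : z * (1 + s) = q + z. Proof. by field; rewrite gt_eqF. Qed.
Let ka0 : 0 < ka := scale_ka_gt0 La100 kaE.
Let D_La : La <= D := scale_La_le_D q0 z0 La100.
Let D100 : 100 * (1 + s) <= D := scale_D_ge q0 z0 La100.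
Let D0 : 0 < D. Proof. exact: powR_gt0. Qed.
Let DE : D `^ (- z) = La `^ (- (q + z)).
Proof. by rewrite -powRrM mulrN mulrC zs. Qed.

Let K1 := (2 * (1 + s)) `^ (- r^-1) * ka.
Let K12D : 2 * D <= K1 := scale_K1_ge2D q0 z0 La100 kaE.
Let k1 := Num.truncn K1.
Let k1K : K1 - 1 <= k1%:R <= K1.
Proof.
have h1 := K12D; have h2 := D0; have h : 0 <= K1 by lra.
by rewrite lerBlDr natr1 (ltW (truncnS_gt _)) truncn_le.
Qed.
Let l := kHD (2 * k1).

Let k1_199 : 199 * (1 + s) <= k1%:R.
Proof.
have /andP[h1 h2] := k1K; have h3 := K12D; have h4 := D100; have h5 := s0; lra.
Qed.

Let k1large := competitor_large q0 z0 La100 kaE n0La k1K.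
Let k10 : (0 < k1)%N.
Proof. by have [_] := k1large; apply: leq_ltn_trans. Qed.
Let k1m : (2 <= 2 * k1)%N. Proof. by rewrite mul2n -addnn (leq_add k10 k10). Qed.
Let l0 : (0 < l)%N. Proof. by case: (kHD_adm k1m). Qed.

Let lmin : l%:R `^ q * (\sum_(l <= j < (2 * k1).+1) y j ^+ 2) <=
  k1%:R `^ q * (\sum_(k1 <= j < (2 * k1).+1) y j ^+ 2).
Proof. by apply: kHD_min => //; case: (kHD_adm k1m). Qed.

Let tz := (200 / 199) `^ z : R.
Let tz0 : 0 < tz. Proof. by apply: powR_gt0; rewrite divr_gt0 ?ltr0n. Qed.

Let n0_le : n0%:R <= 101 / 100 * La.
Proof. by have /andP[_ h] := n0La; have h1 := La100; lra. Qed.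
Let La101 : 0 < 101 / 100 * La.
Proof. by have h1 := La0; lra. Qed.

(** [minimiser_not_early] is applied twice: a block starting at n0 excludes l < n0, and then, with
    the sums controlled from l on, a block starting at l excludes l < D. *)
Let not_before_n0 : (n0 <= l)%N.
Proof.
rewrite leqNgt; apply/negP => ln0.
have h1 := n0_le; have h2 := D_La; have h3 := La100; have /andP[h4 _] := n0La.
have n0R : 0 < n0%:R :> R by lra.
have cond : (101 / 100 * La) `^ (- (q + z)) <= l%:R `^ q * (n0%:R * n0%:R `^ (- r)).
  have -> : n0%:R * n0%:R `^ (- r) = n0%:R `^ (- (q + z)) :> R.
    by rewrite powRNS// mulrCA divff ?mulr1// gt_eqF.
  apply: (@le_trans _ _ (n0%:R `^ (- (q + z)))).
    rewrite !powRN lef_pV2 ?posrE ?(powR_gt0 _ n0R) ?(powR_gt0 _ La101)//.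
    by apply: ge0_ler_powR; rewrite ?nnegrE ?(ltW P0) ?(ltW n0R) ?(ltW La101).
  rewrite ler_peMl ?powR_ge0// -[leLHS](powRr0 l%:R).
  by apply: ler_powR; rewrite ?ler1n// ltW.
have LD : n0%:R <= 101 / 100 * D by lra.
have ll : (0 < l <= n0)%N by rewrite l0 ltnW.
have := minimiser_not_early q0 z0 La100 kaE de2 n0La nx ng k1K (leqnn n0) LD ll cond.
by rewrite ltNge lmin.
Qed.

Let not_before_D : D <= l%:R.
Proof.
rewrite leNgt; apply/negP => lD.
have lR : 0 < l%:R :> R by rewrite ltr0n.
have cond : (101 / 100 * La) `^ (- (q + z)) <= l%:R `^ q * (l%:R * l%:R `^ (- r)).
  have -> : l%:R `^ q * (l%:R * l%:R `^ (- r)) = l%:R `^ (- z) :> R.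
    rewrite powRNS// (mulrCA l%:R) divff ?gt_eqF// mulr1 -gt0_powRD//.
    by congr (_ `^ _); ring.
  apply: (@le_trans _ _ (D `^ (- z))).
    rewrite DE !powRN lef_pV2 ?posrE ?(powR_gt0 _ La0) ?(powR_gt0 _ La101)//.
    apply: ge0_ler_powR; rewrite ?nnegrE ?(ltW P0) ?(ltW La0) ?(ltW La101)//.
    by have h := La0; lra.
  rewrite !powRN lef_pV2 ?posrE ?(powR_gt0 _ lR) ?(powR_gt0 _ D0)//.
  by apply: ge0_ler_powR; rewrite ?nnegrE ?(ltW z0) ?(ltW lR) ?(ltW D0) ?(ltW lD).
have LD : l%:R <= 101 / 100 * D by have := D0; lra.
have ll : (0 < l <= l)%N by rewrite l0 leqnn.
have := minimiser_not_early q0 z0 La100 kaE de2 n0La nx ng k1K not_before_n0 LD ll cond.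
by rewrite ltNge lmin.
Qed.

Let l100 : 100 * (1 + s) <= l%:R := le_trans D100 not_before_D.

Let scale_of_late (e : R) n1 (Q : R) : 0 <= e < 1 -> sumsq_near e n1 x -> (n1 < k1)%N ->
  (n1 <= l)%N -> 1 <= Q ->
  tz * ((1 + e) / (1 - e) * (1 + 2 / l%:R)) `^ (q + z) *
    ((3 * ((1 + e) * (1 + (q + z) / k1%:R) + 2 * e * (q + z)) + 15 / 4 * z) / (1 - e) + 1)
    <= Q -> tz <= Q ->
  ka `^ z <= 56 / 25 * Q * l%:R `^ z.
Proof.
move=> e01 nx1 n1k1 n1l Q1 hQ tQ.
have c0 : 0 <= 56 / 25 :> R by rewrite divr_ge0 ?ler0n.
have lR : 0 < l%:R :> R by rewrite ltr0n.
have [k1l|lk1] := leqP k1 l.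
  apply: (le_trans (competitor_ka q0 z0 La100 kaE n0La k1K)).
  apply: ler_pM; rewrite ?powR_ge0 ?(mulr_ge0 c0 (ltW tz0))//.
    by rewrite ler_wpM2l.
  by apply: ge0_ler_powR; rewrite ?nnegrE ?ler0n ?(ltW z0)// ler_nat.
have n1lk : (n1 <= l < k1)%N by rewrite n1l.
apply: (le_trans (minimiser_late q0 z0 La100 kaE de2 n0La ng k1K e01 nx1 n1k1 n1lk l0 lmin)).
rewrite ler_wpM2r ?powR_ge0// -/tz.
apply: le_trans (ler_wpM2l c0 hQ).
by rewrite le_eqVlt; apply/orP; left; apply/eqP; ring.
Qed.

Let P_k1 : (q + z) / k1%:R <= z / 199.
Proof.
have h1 := k1_199; have h2 := s0; have h3 := z0.
rewrite ler_pdivrMr ?ltr0n// -zs mulrAC ler_pdivlMr ?ltr0n//.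
by rewrite -mulrA ler_wpM2l ?(ltW h3)// mulrC.
Qed.

(** Here e = 1/4 and q + z <= 8/5 z. The base is built from 5/3 (1 + 2/l) <= 17/10, (17/10)^(8/5) <=
    117/50 and 200/199 * 117/50 <= 40/17. *)
Lemma scale_large_signal : s <= 3 / 5 ->
  ka `^ z <= 56 / 25 * ((6 + 33 / 4 * z) * (40 / 17) `^ z) * l%:R `^ z.
Proof.
move=> s35; have h1 := P_k1; have h2 := s0; have h3 := z0; have h4 := l100.
have lR : 0 < l%:R :> R by rewrite ltr0n.
have e01 : 0 <= (4^-1 : R) < 1.
  by apply/andP; split; [rewrite invr_ge0 ler0n|rewrite invf_lt1 ?ltr1n ?ltr0n].
have Pz : q + z <= 8 / 5 * z.
  by rewrite -zs mulrC ler_wpM2r ?(ltW h3)//; lra.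
have a17 : 0 < 17 / 10 :> R by rewrite divr_gt0 ?ltr0n.
have a4017 : 1 <= 40 / 17 :> R by lra.
have a117 : 0 <= 117 / 50 :> R by rewrite divr_ge0 ?ler0n.
have a200 : 0 <= 200 / 199 :> R by rewrite divr_ge0 ?ler0n.
have g17 : (1 + 4^-1) / (1 - 4^-1) * (1 + 2 / l%:R) <= 17 / 10 :> R.
  have -> : (1 + 4^-1) / (1 - 4^-1) = 5 / 3 :> R by field.
  have : 2 / l%:R <= 1 / 50 :> R by rewrite ler_pdivrMr//; lra.
  lra.
have gp : 0 <= (1 + 4^-1) / (1 - 4^-1) * (1 + 2 / l%:R) :> R.
  have -> : (1 + 4^-1) / (1 - 4^-1) = 5 / 3 :> R by field.
  by rewrite mulr_ge0 ?addr_ge0 ?divr_ge0 ?ler0n.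
have g1 : ((1 + 4^-1) / (1 - 4^-1) * (1 + 2 / l%:R)) `^ (q + z) <= (117 / 50) `^ z :> R.
  apply: (@le_trans _ _ ((17 / 10) `^ (q + z))).
    by apply: ge0_ler_powR; rewrite ?nnegrE ?(ltW P0) ?(ltW a17).
  apply: (@le_trans _ _ ((17 / 10) `^ (8 / 5 * z))).
    by apply: ler_powR => //; lra.
  rewrite powRrM; apply: ge0_ler_powR; rewrite ?nnegrE ?powR_ge0 ?(ltW h3)//.
  have -> : 117 / 50 = ((117 / 50) `^ 5%:R) `^ 5^-1 :> R.
    by rewrite -powRrM divff ?pnatr_eq0// powRr1.
  rewrite [X in X <= _]powRrM.
  apply: ge0_ler_powR; rewrite ?nnegrE ?powR_ge0 ?invr_ge0 ?ler0n//.
  by rewrite powR_mulrn ?(ltW a17)// powR_mulrn//; lra.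
have base : tz * (117 / 50) `^ z <= (40 / 17) `^ z.
  rewrite /tz -(powRM _ a200 a117).
  by apply: ge0_ler_powR; rewrite ?nnegrE ?(ltW h3) ?(mulr_ge0 a200 a117)//; lra.
have c6 : 1 <= 6 + 33 / 4 * z by lra.
have p4017 : 1 <= (40 / 17) `^ z :> R.
  by rewrite -[leLHS](powRr0 (40 / 17)); apply: ler_powR => //; exact: ltW.
have n0k1 : (n0 < k1)%N by case: k1large.
apply: (scale_of_late e01 nx n0k1 not_before_n0).
- by rewrite -[leLHS]mulr1; apply: ler_pM => //; exact: ler01.
- rewrite mulrC; apply: ler_pM.
  + have pk : 0 <= (q + z) / k1%:R by rewrite divr_ge0 ?ler0n// ltW.
    have := P0; have -> : (1 - 4^-1 : R)^-1 = 4 / 3 by field.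
    by move=> ?; lra.
  + by rewrite mulr_ge0 ?powR_ge0// ltW.
  + have := P0; have -> : (1 - 4^-1 : R)^-1 = 4 / 3 by field.
    by move=> ?; lra.
  + by apply: le_trans base; rewrite ler_pM2l.
- apply: (@le_trans _ _ ((40 / 17) `^ z)); last by rewrite ler_peMl// powR_ge0.
  apply: le_trans base; rewrite ler_peMr ?(ltW tz0)// -[leLHS](powRr0 (117 / 50)).
  by apply: ler_powR; [lra|exact: ltW].
Qed.

(** e = 1 / (6 (1 + s)) makes 2 e (q + z) = z / 3, so that s drops out of the bounds: the power q +
    z is at most exp (11/28 z) <= (67/45)^z, and 200/199 * 67/45 <= 3/2. *)
Lemma scale_small_signal n1 : 3 / 5 <= s -> sumsq_near (6 * (1 + s))^-1 n1 x ->
  D <= n1%:R < D + 1 ->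
  ka `^ z <= 56 / 25 * ((47 / 10 + 533 / 100 * z) * (3 / 2) `^ z) * l%:R `^ z.
Proof.
move=> s35 nx1 /andP[Dn1 n1D]; have h1 := P_k1; have h2 := s0; have h3 := z0; have h4 := l100.
have lR : 0 < l%:R :> R by rewrite ltr0n.
set e := (6 * (1 + s))^-1 in nx1.
have w0 : 0 < 6 * (1 + s) by lra.
have e0 : 0 < e by rewrite invr_gt0.
have ew : 2 * e * (q + z) = z / 3.
  have w1 : 1 + s != 0 by rewrite lt0r_neq0 //; lra.
  by rewrite -zs /e; move: (1 + s) w1 => t tn; field.
have e48 : e <= 5 / 48.
  have -> : 5 / 48 = (48 / 5)^-1 :> R by rewrite invf_div.
  by rewrite lef_pV2 ?posrE//; lra.
have e1' : 0 < 1 - e by lra.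
have i1 : (1 - e)^-1 <= 48 / 43.
  have -> : 48 / 43 = (43 / 48)^-1 :> R by rewrite invf_div.
  by rewrite lef_pV2 ?posrE//; lra.
have i0 : 0 < (1 - e)^-1 by rewrite invr_gt0.
have e01 : 0 <= e < 1 by apply/andP; split; lra.
have n1k1 : (n1 < k1)%N.
  rewrite -(ltr_nat R); have [h5 _] := k1large; lra.
have n1l : (n1 <= l)%N.
  rewrite leqNgt; apply/negP => ln1; have := not_before_D; rewrite leNgt => /negP; apply.
  by have : l.+1%:R <= n1%:R :> R by [rewrite ler_nat]; rewrite -natr1; lra.
have a200 : 0 <= 200 / 199 :> R by rewrite divr_ge0 ?ler0n.
have a67 : 0 <= 67 / 45 :> R by rewrite divr_ge0 ?ler0n.
have g0 : 0 < (1 + e) / (1 - e) by rewrite divr_gt0//; lra.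
have l20 : 0 < 1 + 2 / l%:R :> R by rewrite addr_gt0// divr_gt0.
have g1 : ((1 + e) / (1 - e) * (1 + 2 / l%:R)) `^ (q + z) <= (67 / 45) `^ z :> R.
  rewrite (powR_lnE (q + z) (mulr_gt0 g0 l20)) lnM ?posrE//.
  have j1 : ln ((1 + e) / (1 - e)) <= 2 * e / (1 - e).
    apply: (le_trans (ln_le_sub1 g0)); rewrite le_eqVlt; apply/orP; left; apply/eqP.
    by field; rewrite gt_eqF.
  have j2 : ln (1 + 2 / l%:R) <= 2 / l%:R :> R.
    by apply: (le_trans (ln_le_sub1 l20)); rewrite (addrC 1) addrK.
  have e67 : expR (11 / 28) <= 67 / 45 :> R by apply: expR_le_frac; lra.
  apply: (@le_trans _ _ (expR (11 / 28) `^ z)); last first.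
    by apply: ge0_ler_powR; rewrite ?nnegrE ?expR_ge0 ?(ltW h3).
  rewrite powR_lnE ?expR_gt0// expRK ler_expR.
  apply: (le_trans (ler_wpM2l (ltW P0) (lerD j1 j2))).
  have j3 : (q + z) * (2 * e / (1 - e)) = z / 3 * (1 - e)^-1 by rewrite -ew; ring.
  have j4 : (q + z) * (2 / l%:R) <= z / 50 :> R.
    rewrite -zs mulrA ler_pdivrMr// -(mulrA z) -(mulrA z) ler_wpM2l ?(ltW h3)//.
    by rewrite mulrC ler_pdivlMl ?ltr0n//; lra.
  have j5 : z / 3 * (1 - e)^-1 <= z / 3 * (48 / 43).
    by rewrite ler_wpM2l// divr_ge0 ?ler0n// ltW.
  rewrite mulrDr j3; apply: (le_trans (lerD j5 j4)); lra.
have base : tz * (67 / 45) `^ z <= (3 / 2) `^ z.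
  rewrite /tz -(powRM _ a200 a67).
  by apply: ge0_ler_powR; rewrite ?nnegrE ?(ltW h3) ?(mulr_ge0 a200 a67)//; lra.
have p32 : 1 <= (3 / 2) `^ z :> R.
  by rewrite -[leLHS](powRr0 (3 / 2)); apply: ler_powR; [lra|exact: ltW].
have c0 : 1 <= 47 / 10 + 533 / 100 * z by lra.
have pk : 0 <= (q + z) / k1%:R by rewrite divr_ge0 ?ler0n// ltW.
have al : (1 + e) * (1 + (q + z) / k1%:R) <= 53 / 48 * (1 + z / 199).
  by apply: ler_pM; lra.
have al0 : 0 <= (1 + e) * (1 + (q + z) / k1%:R) by rewrite mulr_ge0//; lra.
apply: (scale_of_late e01 nx1 n1k1 n1l).
- by rewrite -[leLHS]mulr1; apply: ler_pM => //; exact: ler01.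
- rewrite mulrC; apply: ler_pM.
  + by rewrite ew addr_ge0// mulr_ge0 ?(ltW i0)//; lra.
  + by rewrite mulr_ge0 ?powR_ge0// ltW.
  + rewrite ew; apply: (@le_trans _ _ ((3 * (53 / 48 * (1 + z / 199) + z / 3) + 15 / 4 * z) * (48 / 43) + 1)).
      rewrite lerD2r; apply: ler_pM => //; [lra|exact: ltW|lra].
    lra.
  + by apply: le_trans base; rewrite ler_pM2l.
- apply: (@le_trans _ _ ((3 / 2) `^ z)); last by rewrite ler_peMl// powR_ge0.
  apply: le_trans base; rewrite ler_peMr ?(ltW tz0)// -[leLHS](powRr0 (67 / 45)).
  by apply: ler_powR; [lra|exact: ltW].
Qed.

Variable err2 : nat -> R.
Let V (k : nat) : R := de ^+ 2 * \sum_(1 <= j < k.+1) j%:R `^ q * g j ^+ 2.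
Hypothesis err2_ge : forall k n, V k + \sum_(k.+1 <= j < n) j%:R `^ (- (z + 1)) * x j ^+ 2 <= err2 k.
Hypothesis err2_le : forall k c, (forall n,
  V k + \sum_(k.+1 <= j < n) j%:R `^ (- (z + 1)) * x j ^+ 2 <= c) -> err2 k <= c.

(* The tail beyond the maximal index is at most the tail beyond the index
   selected for m = 2 k1. *)
Lemma err2_kHD_le m (Q : R) : (2 <= m)%N -> (forall m', (2 <= m')%N -> (kHD m' <= kHD m)%N) ->
  ka `^ z <= 56 / 25 * Q * l%:R `^ z ->
  err2 (kHD m) <= (125 / 432 * (101 / 100) * (101 / 100) `^ z * 432 `^ (1 + q^-1) +
    5 / 4 * (1 + z^-1) * (56 / 25 * Q)) * ka `^ (- z).
Proof.
move=> m2 mx hQ; have lm : (l <= kHD m)%N by exact: mx.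
have lR : 0 < l%:R :> R by rewrite ltr0n.
apply: err2_le => n; rewrite mulrDl; apply: lerD.
  exact: (noise_kHD_le q0 z0 La100 kaE de2 n0La nx ng kHD_adm kHD_min m2).
have tail : \sum_(l.+1 <= j < n) j%:R `^ (- (z + 1)) * x j ^+ 2 <= 5 / 4 * (1 + z^-1) * l%:R `^ (- z).
  have e0 : 0 <= 4^-1 :> R by rewrite invr_ge0 ler0n.
  apply: (le_trans (sumsq_weighted_le _ e0 z0 nx not_before_n0)).
  have h1 := @sum_powR_le R z l n z0 l0.
  have h2 : l%:R * l.+1%:R `^ (- (z + 1)) <= l%:R `^ (- z) :> R.
    apply: (@le_trans _ _ (l%:R * l%:R `^ (- (z + 1)))).
      by rewrite ler_pM2l//; apply: powR_weight_noninc z0 l0 _ (leqnn l).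
    by rewrite powRNS// mulrCA divff ?mulr1// gt_eqF.
  have h3 : 0 <= l%:R `^ (- z) :> R by rewrite powR_ge0.
  by move: h1 h2 h3; lra.
apply: (@le_trans _ _ (\sum_(l.+1 <= j < n) j%:R `^ (- (z + 1)) * x j ^+ 2)).
  have [nk|kn] := leqP n (kHD m).+1.
    by rewrite big_geq// sumr_ge0// => j _; rewrite mulr_ge0 ?powR_ge0 ?sqr_ge0.
  rewrite [leRHS](@big_cat_nat _ _ _ (kHD m).+1)//= ?(ltnW kn)// lerDr.
  by rewrite sumr_ge0// => j _; rewrite mulr_ge0 ?powR_ge0 ?sqr_ge0.
have c0 : 0 <= 5 / 4 * (1 + z^-1).
  by rewrite mulr_ge0 ?divr_ge0 ?addr_ge0 ?ler0n// invr_ge0 ltW.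
have hl : l%:R `^ (- z) <= 56 / 25 * Q * ka `^ (- z).
  by rewrite !powRN ler_pdivlMr ?(powR_gt0 _ ka0)// [leLHS]mulrC ler_pdivrMr ?(powR_gt0 _ lR).
apply: (le_trans tail); apply: (le_trans (ler_wpM2l c0 hl)).
by rewrite le_eqVlt; apply/orP; left; apply/eqP; ring.
Qed.

(** The factor is C^2, with xx the term of A, ya the power of a and w the root of eta / (eta - 1).
    In the expanded square, xx^2 pays for the noise at the selected index; the tail is paid by (ya
    w)^2 if s <= 3/5 and by the cross term otherwise. *)
Lemma quasi_optimal m k (xx ya w Mx : R) :
  (2 <= m)%N -> (forall m', (2 <= m')%N -> (kHD m' <= kHD m)%N) ->
  0 <= xx -> xx ^+ 2 = 432 `^ (1 + q^-1) ->
  0 <= ya -> ya ^+ 2 = 2 `^ (1 + z) * 324 `^ ((1 + z) / (q + z)) ->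
  0 <= w -> w ^+ 2 = 1 + z^-1 ->
  1 <= Mx -> z * 4 `^ z <= Mx ->
  (s <= 3 / 5) \/ (3 / 5 <= s /\ exists n1,
     sumsq_near (6 * (1 + s))^-1 n1 x /\ D <= n1%:R < D + 1) ->
  err2 (kHD m) <= 9 / 4 * (xx + ya * w) ^+ 2 * Mx * err2 k.
Proof.
move=> m2 mx xx0 xx2 ya0 ya2 w0 w2 M1 M4 cases.
have N0 : 0 < ka `^ (- z) by rewrite powR_gt0.
have C0 : 0 <= 9 / 4 * (xx + ya * w) ^+ 2 * Mx.
  apply: mulr_ge0; last exact: le_trans ler01 M1.
  by apply: mulr_ge0; [rewrite divr_ge0 ?ler0n|exact: sqr_ge0].
have zi : 0 < z^-1 by rewrite invr_gt0.
have low := @err2_lower _ q z La ka de q0 z0 La100 kaE de2 n0 x g n0La nx ng err2 err2_ge k.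
apply: le_trans (ler_wpM2l C0 low).
pose Gq := Mx * (151 / 50) `^ (- z) / z.
have G0 : 0 <= Gq.
  by rewrite /Gq mulr_ge0 ?(ltW zi)// mulr_ge0 ?powR_ge0 ?(le_trans ler01 M1).
have -> : 9 / 4 * (xx + ya * w) ^+ 2 * Mx * (2^-1 * ((151 / 50) `^ (- z) / z) * ka `^ (- z)) =
   9 / 8 * (xx ^+ 2 + 2 * xx * (ya * w) + ya ^+ 2 * w ^+ 2) * Gq * ka `^ (- z).
  by rewrite /Gq; field; rewrite gt_eqF.
have a200 : 0 <= 200 / 151 :> R by rewrite divr_ge0 ?ler0n.
have a151 : 0 < 151 / 50 :> R by rewrite divr_gt0 ?ltr0n.
have G1 : (200 / 151) `^ z <= Gq.
  rewrite /Gq ler_pdivlMr// powRN ler_pdivlMr ?(powR_gt0 _ a151)//; apply: le_trans M4.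
  have -> : 4 = 200 / 151 * (151 / 50) :> R by field.
  rewrite (powRM _ a200 (ltW a151)).
  by rewrite le_eqVlt; apply/orP; left; apply/eqP; ring.
have xp : 0 <= xx ^+ 2 by rewrite sqr_ge0.
have xy0 : 0 <= 2 * xx * (ya * w) by rewrite !mulr_ge0 ?ler0n.
have yw0 : 0 <= ya ^+ 2 * w ^+ 2 by rewrite mulr_ge0 ?sqr_ge0.
have VV : 125 / 432 * (101 / 100) * (101 / 100) `^ z * 432 `^ (1 + q^-1) <= 9 / 8 * xx ^+ 2 * Gq.
  have h : (101 / 100) `^ z <= Gq.
    apply: le_trans G1; apply: ge0_ler_powR; rewrite ?nnegrE ?(ltW z0) ?divr_ge0 ?ler0n//; lra.
  rewrite -xx2; apply: (@le_trans _ _ (125 / 432 * (101 / 100) * (xx ^+ 2 * Gq))).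
    have c0 : 0 <= 125 / 432 * (101 / 100) :> R by rewrite mulr_ge0 ?divr_ge0 ?ler0n.
    by rewrite -[leLHS]mulrA; apply: (ler_wpM2l c0); rewrite mulrC; exact: ler_wpM2l.
  have := mulr_ge0 xp G0; lra.
(* For fixed z the power of 324 in ya^2 degenerates to 1 as s grows. The cross term brings in xx >=
   83/4 instead. *)
have [Q [hQ hB]] : exists Q, ka `^ z <= 56 / 25 * Q * l%:R `^ z /\
    5 / 4 * w ^+ 2 * (56 / 25 * Q) <= 9 / 8 * (2 * xx * (ya * w) + ya ^+ 2 * w ^+ 2) * Gq.
  case: cases => [s35|[s35 [n1 [nx1 Dn1]]]].
    exists ((6 + 33 / 4 * z) * (40 / 17) `^ z); split; first exact: scale_large_signal.
    apply: (@le_trans _ _ (9 / 8 * (ya ^+ 2 * w ^+ 2) * Gq)); last first.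
      by rewrite ler_wpM2r// ler_wpM2l ?divr_ge0 ?ler0n// lerDr.
    have p37 : 0 < 37 :> R by rewrite ltr0n.
    have h37 : 37 * 37 `^ z^-1 <= 324 `^ ((1 + z) / (q + z)) :> R.
      have -> : 37 * 37 `^ z^-1 = 37 `^ (1 + z^-1) :> R.
        by rewrite (gt0_powRD 1 z^-1 p37) powRr1 ?ltW.
      apply: (@le_trans _ _ ((324 `^ (5 / 8)) `^ (1 + z^-1))).
        apply: ge0_ler_powR; rewrite ?nnegrE ?powR_ge0 ?(ltW p37) ?addr_ge0 ?(ltW zi)//.
        exact: powR_18_ge.
      rewrite -powRrM; apply: ler_powR; first by rewrite ler1n.
      have -> : 1 + z^-1 = (1 + z) / z by field; rewrite gt_eqF.
      rewrite mulrCA ler_wpM2l ?addr_ge0 ?(ltW z0)//.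
      rewrite -zs invfM (mulrC z^-1) ler_wpM2r ?(ltW zi)//.
      have -> : 5 / 8 = (8 / 5)^-1 :> R by rewrite invf_div.
      by have h := s0; rewrite lef_pV2 ?posrE//; lra.
    have hm := @margin_large_signal R z z0.
    have hy : 2 * (37 * 37 `^ z^-1) * 2 `^ z <= ya ^+ 2.
      rewrite ya2 (gt0_powRD 1 z (ltr0n R 2)) powRr1 ?ler0n// mulrAC.
      by rewrite ler_wpM2l// mulr_ge0 ?powR_ge0 ?ler0n.
    have hh : 2 * (37 * 37 `^ z^-1) * 2 `^ z * (200 / 151) `^ z <= ya ^+ 2 * Gq.
      by apply: ler_pM; rewrite ?mulr_ge0 ?powR_ge0 ?ler0n.
    have c98 : 0 <= 9 / 8 :> R by rewrite divr_ge0 ?ler0n.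
    have := ler_wpM2l (sqr_ge0 w) (le_trans hm (ler_wpM2l c98 hh)).
    have -> : w ^+ 2 * (5 / 4 * (56 / 25 * (6 + 33 / 4 * z) * (40 / 17) `^ z)) =
       5 / 4 * w ^+ 2 * (56 / 25 * ((6 + 33 / 4 * z) * (40 / 17) `^ z)) by ring.
    move/le_trans; apply.
    by rewrite le_eqVlt; apply/orP; left; apply/eqP; ring.
  exists ((47 / 10 + 533 / 100 * z) * (3 / 2) `^ z); split.
    exact: (scale_small_signal s35 nx1 Dn1).
  apply: (@le_trans _ _ (9 / 8 * (2 * xx * (ya * w)) * Gq)); last first.
    by rewrite ler_wpM2r// ler_wpM2l ?divr_ge0 ?ler0n// lerDl.
  have hm := margin_small_noise z0 w0 w2 M1 M4; rewrite -/Gq in hm.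
  have xx83 : 83 / 4 <= xx.
    have h0 : 0 <= 83 / 4 :> R by rewrite divr_ge0 ?ler0n.
    rewrite -(@ler_pXn2r _ 2)// ?nnegrE// xx2.
    apply: (@le_trans _ _ 432); first lra.
    have p432 : 0 < 432 :> R by rewrite ltr0n.
    rewrite -[leLHS](powRr1 (ltW p432)); apply: ler_powR; first by rewrite ler1n.
    by rewrite lerDl invr_ge0 ltW.
  have ya41 : 41 / 29 * (41 / 29) `^ z <= ya.
    have a41 : 0 < 41 / 29 :> R by rewrite divr_gt0 ?ltr0n.
    have h0 : 0 <= 41 / 29 * (41 / 29) `^ z :> R by rewrite mulr_ge0 ?powR_ge0 ?(ltW a41).
    rewrite -(@ler_pXn2r _ 2)// ?nnegrE// ya2.
    have -> : (41 / 29 * (41 / 29) `^ z) ^+ 2 = ((41 / 29) ^+ 2) `^ (1 + z) :> R.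
      rewrite exprMn -(powR_mulrn 2 (powR_ge0 _ _)) powRAC (powR_mulrn 2 (ltW a41)).
      by rewrite (gt0_powRD 1 z (exprn_gt0 2 a41)) powRr1// exprn_ge0// ltW.
    apply: (@le_trans _ _ (2 `^ (1 + z))).
      apply: ge0_ler_powR; rewrite ?nnegrE ?sqr_ge0 ?ler0n ?addr_ge0 ?(ltW z0)//; lra.
    rewrite ler_peMr ?powR_ge0// -[leLHS](powRr0 324); apply: ler_powR; first by rewrite ler1n.
    by rewrite divr_ge0 ?(ltW P0) ?addr_ge0 ?(ltW z0).
  have xy : 83 / 4 * (41 / 29 * (41 / 29) `^ z) <= xx * ya.
    by apply: ler_pM; rewrite ?mulr_ge0 ?powR_ge0 ?divr_ge0 ?ler0n.
  have hw := ler_wpM2l w0 hm.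
  have hx := ler_wpM2r (mulr_ge0 w0 G0) xy.
  have E1 : 5 / 4 * w ^+ 2 * (56 / 25 * ((47 / 10 + 533 / 100 * z) * (3 / 2) `^ z)) =
     w * (14 / 5 * w * (47 / 10 + 533 / 100 * z) * (3 / 2) `^ z) by field.
  rewrite E1; apply: (le_trans hw).
  have u0 : 0 <= (41 / 29) `^ z * (w * Gq) := mulr_ge0 (powR_ge0 _ _) (mulr_ge0 w0 G0).
  apply: (@le_trans _ _ (9 / 4 * (83 / 4 * (41 / 29 * (41 / 29) `^ z) * (w * Gq)))).
    move: u0; have -> : w * (66 * (41 / 29) `^ z * Gq) = 66 * ((41 / 29) `^ z * (w * Gq)) by ring.
    have -> : 9 / 4 * (83 / 4 * (41 / 29 * (41 / 29) `^ z) * (w * Gq)) =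
      9 / 4 * (83 / 4) * (41 / 29) * ((41 / 29) `^ z * (w * Gq)) by ring.
    by move: (_ * (w * Gq)) => u u0; lra.
  by move: hx; lra.
apply: (le_trans (err2_kHD_le m2 mx hQ)).
rewrite ler_pM2r// -w2; apply: (le_trans (lerD VV hB)).
by rewrite le_eqVlt; apply/orP; left; apply/eqP; ring.
Qed.

End combination.

(** * The good event and its probability *)

Section good_event.
Context {R : realType}.

Lemma expR_ge_quad (x : R) : 0 <= x -> 1 + x + x ^+ 2 / 2 <= expR x.
Proof.
move=> x0; rewrite -subr_ge0.
pose f (y : R) := expR y - (1 + y + y * y / 2).
have df (y : R) : is_derive y 1 f (expR y - (1 + y)).
  by apply: is_derive_eq; rewrite /GRing.scale /=; field.
have f0 : f 0 = 0 by rewrite /f expR0; field.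
have [xE|xn0] := eqVneq x 0; first by rewrite xE expR0; lra.
have xp : 0 < x by rewrite lt_neqAle eq_sym xn0.
have [c _] := @MVT R f (fun y => expR y - (1 + y)) 0 x xp (fun y _ => df y)
  (derivable_within_continuous (fun y _ => @ex_derive _ _ _ _ _ _ _ (df y))).
rewrite f0 !subr0 /f expr2 => ->; rewrite mulr_ge0// subr_ge0.
exact: expR_ge1Dx.
Qed.

Lemma chi_rate_upper (e : R) : 0 <= e <= 5 / 48 -> 7 / 20 * e ^+ 2 <= e - ln (1 + e).
Proof.
move=> /andP[e0 e1]; pose y := e - 7 / 20 * e ^+ 2.
have y0 : 0 <= y by rewrite /y; nra.
suff : ln (1 + e) <= y by rewrite /y; lra.
have e10 : 0 < 1 + e by lra.
rewrite -ler_expR lnK ?posrE//; apply: le_trans (expR_ge_quad y0).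
have h : (7 / 10) * e ^+ 2 <= y ^+ 2.
  have -> : y ^+ 2 = (1 - 7 / 20 * e) ^+ 2 * e ^+ 2 by rewrite /y; ring.
  by rewrite ler_wpM2r ?sqr_ge0//; nra.
by move: h; rewrite /y; lra.
Qed.

Lemma chi_rate_lower (e : R) : 0 <= e < 1 -> e ^+ 2 / 2 <= - e - ln (1 - e).
Proof.
move=> /andP[e0 e1]; have e1' : 0 < 1 - e by lra.
have f0 : 0 <= e / (1 - e) by rewrite divr_ge0// ltW.
have := ln_ge_mobius f0.
have -> : 1 + e / (1 - e) = (1 - e)^-1 by field; rewrite gt_eqF.
rewrite lnV ?posrE//.
have -> : 2 * (e / (1 - e)) / (2 + e / (1 - e)) = 2 * e / (2 - e).
  field; rewrite !lt0r_neq0 //=; lra.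
have : e + e ^+ 2 / 2 <= 2 * e / (2 - e).
  have e2 : 0 < 2 - e by lra.
  have -> : 2 * e / (2 - e) = e + e ^+ 2 / (2 - e) by field; rewrite gt_eqF.
  rewrite lerD2l ler_wpM2l ?sqr_ge0// lef_pV2 ?posrE//; lra.
lra.
Qed.

Lemma rate_quarter_upper : 0 <= (4^-1 - ln (1 + 4^-1) : R) <= 36^-1.
Proof.
have p : 0 <= 4^-1 :> R by rewrite invr_ge0 ler0n.
have := ln_ge_mobius p; have := @ln_le_sub1 R (1 + 4^-1).
have -> : 2 * 4^-1 / (2 + 4^-1) = 2 / 9 :> R by field.
rewrite (addrC 1) addrK => h1 h2; apply/andP; split.
  by rewrite subr_ge0; apply: h1; rewrite ltr_wpDl.
have -> : 36^-1 = 4^-1 - 2 / 9 :> R by field.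
by rewrite lerD2l lerN2.
Qed.

(** The lower tail has an exponent larger by the factor 5/4 than the upper one; this leaves room in
    the probability budget for a third bad event. *)
Lemma rate_quarter_lower : 5 / 4 * (4^-1 - ln (1 + 4^-1)) <= - 4^-1 - ln (1 - 4^-1) :> R.
Proof.
have /andP[_ h] := rate_quarter_upper.
have p : 0 <= 3^-1 :> R by rewrite invr_ge0 ler0n.
have := ln_ge_mobius p.
have -> : 2 * 3^-1 / (2 + 3^-1) = 2 / 7 :> R by field.
have -> : 1 + 3^-1 = (1 - 4^-1)^-1 :> R by field.
rewrite lnV ?posrE; last by lra.
move: h; lra.
Qed.

(* 10^s dominates 12/5 (1 + s) once s >= 3/5, since 10^(3/5) >= 39/10. *)
Lemma powR_100_ge (s : R) : 3 / 5 <= s -> (12 / 5 * (1 + s)) ^+ 2 <= 100 `^ s.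
Proof.
move=> s35; have p10 : 0 < 10 :> R by rewrite ltr0n.
have -> : 100 `^ s = (10 `^ s) ^+ 2 :> R.
  rewrite -(powR_mulrn 2 (powR_ge0 _ _)) powRAC (powR_mulrn 2 (ltW p10)).
  by rewrite -natrX.
have a : 39 / 10 <= 10 `^ (3 / 5) :> R.
  have q0 : 0 <= 39 / 10 :> R by rewrite divr_ge0 ?ler0n.
  have -> : 39 / 10 = ((39 / 10) `^ 5%:R) `^ 5^-1 :> R.
    by rewrite -powRrM divff ?pnatr_eq0// powRr1.
  rewrite (powRrM 10 3 5^-1); apply: ge0_ler_powR; rewrite ?nnegrE ?powR_ge0 ?invr_ge0 ?ler0n//.
  by rewrite (powR_mulrn 5 q0) (powR_mulrn 3 (ltW p10)); lra.
have b : 1 + (s - 3 / 5) <= 10 `^ (s - 3 / 5) :> R.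
  rewrite powR_lnE//; apply: le_trans (expR_ge1Dx _); rewrite lerD2l ler_peMr//; first lra.
  rewrite -[leLHS]expRK ler_ln ?posrE ?expR_gt0//.
  by apply: expR_le_frac; lra.
have c : 12 / 5 * (1 + s) <= 10 `^ s.
  have -> : 10 `^ s = 10 `^ (3 / 5) * 10 `^ (s - 3 / 5) :> R.
    by rewrite -gt0_powRD//; congr (_ `^ _); ring.
  apply: (@le_trans _ _ (39 / 10 * (1 + (s - 3 / 5)))); first lra.
  by apply: ler_pM => //; lra.
by rewrite ler_pXn2r ?nnegrE ?powR_ge0//; lra.
Qed.

Context {d} {T : measurableType d} (P : probability T R).

Lemma sum_squares_bad_event (X : nat -> {RV P >-> R}) (f : R -> R) (e : R) (n : nat) :
  mutually_independent [set j | (0 < j)%N] X -> measurable_fun setT f ->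
  (forall j (t : R), (0 < j)%N -> t < 2^-1 ->
    (\int[P]_x (expR (t * f (X j x)))%:E = ((1 - 2 * t) `^ (- 2^-1))%:E)%E) ->
  0 < e < 1 ->
  exists B : set T, [/\ measurable B,
    (P B <= (expR (- (n%:R * ((e - ln (1 + e)) / 2))) +
             expR (- (n%:R * ((- e - ln (1 - e)) / 2))))%:E)%E &
    forall w, ~ B w -> forall k, (n <= k)%N ->
      (1 - e) * k%:R <= \sum_(1 <= j < k.+1) f (X j w) <= (1 + e) * k%:R].
Proof.
move=> hX mf mgf /andP[e0 e1].
pose S k w := \sum_(1 <= j < k.+1) f (X j w).
pose B c := \bigcup_(k in [set k | (n <= k)%N]) [set w | 0 <= (c - 1) * (S k w - k%:R * c)].
have mB c : measurable (B c).
  apply: bigcup_measurable => k _; rewrite -[X in measurable X]setTI.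
  apply: measurable_fun_le => //; apply: measurable_funM => //; apply: measurable_funB => //.
  by apply: measurable_sum => j; exact: measurableT_comp.
have up := @chi_square_deviation _ _ _ P X f hX mf mgf (1 + e) n.
have lo := @chi_square_deviation _ _ _ P X f hX mf mgf (1 - e) n.
exists (B (1 + e) `|` B (1 - e)); split; first exact: measurableU.
- apply: (le_trans (measureU2 _ (mB _) (mB _))); rewrite EFinD; apply: leeD.
    have -> : e - ln (1 + e) = 1 + e - 1 - ln (1 + e) by ring.
    by apply: up; lra.
  have -> : - e - ln (1 - e) = 1 - e - 1 - ln (1 - e) by ring.
  by apply: lo; lra.
- move=> w; rewrite not_orP => -[nu nl] k nk; apply/andP; split; rewrite leNgt; apply/negP => h.
    apply: nl; exists k => //=; rewrite -/(S k w) in h *; have -> : 1 - e - 1 = - e by ring.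
    by nra.
  apply: nu; exists k => //=; rewrite -/(S k w) in h *; have -> : 1 + e - 1 = e by ring.
  by nra.
Qed.

End good_event.

Section good_event_theorem.
Context {R : realType} {d} {T : measurableType d} (P : probability T R).
Context {Y : hilbertType R} (Z : Y -> {RV P >-> R}) (u : nat -> Y).
Hypothesis hZ : gaussian_white_noise Z.
Hypothesis ou : forall i j, (0 < i)%N -> (0 < j)%N -> '[u i, u j] = (i == j)%:R.
Variable xi : nat -> {RV P >-> R}.
Hypothesis hxi : (forall j w, (0 < j)%N -> xi j w = 1) \/
  iid_standard_gaussian [set j | (0 < j)%N] xi.

Lemma white_noise_coef_gaussian j : (0 < j)%N -> standard_gaussian (Z (u j)).
Proof.
move=> j0; have n1 : `|u j| = 1.
  apply/eqP; rewrite -(@eqrXn2 _ 2)// ?expr1n -?innerE ?ou ?eqxx//.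
have u0 : u j != 0 by rewrite -normr_eq0 n1 oner_eq0.
by have := wn_gaussian hZ u0; rewrite n1 invr1 scale1r.
Qed.

Lemma noise_bad_event (e : R) (n : nat) : 0 < e < 1 ->
  exists B : set T, [/\ measurable B,
    (P B <= (expR (- (n%:R * ((e - ln (1 + e)) / 2))) +
             expR (- (n%:R * ((- e - ln (1 - e)) / 2))))%:E)%E &
    forall w, ~ B w -> sumsq_near e n (fun j => Z (u j) w)].
Proof.
move=> e01.
have hX := white_noise_sqr_independent hZ (D := [set j | (0 < j)%N]) ou.
have [|B [mB PB hB]] := @sum_squares_bad_event R d T P _ id e n hX (@measurable_id _ _ _) _ e01.
  move=> j t j0 t2; rewrite -(standard_gaussian_expR_sqr (white_noise_coef_gaussian j0) t2).
  by apply: eq_integral.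
by exists B; split.
Qed.

Lemma signal_bad_event (e : R) (n : nat) : 0 < e < 1 ->
  exists B : set T, [/\ measurable B,
    (P B <= (expR (- (n%:R * ((e - ln (1 + e)) / 2))) +
             expR (- (n%:R * ((- e - ln (1 - e)) / 2))))%:E)%E &
    forall w, ~ B w -> sumsq_near e n (fun j => xi j w)].
Proof.
move=> e01; have /andP[e0 e1] := e01.
case: hxi => [x1|[hX gX]].
  exists set0; split; [exact: measurable0|by rewrite measure0 lee_fin addr_ge0 ?expR_ge0|].
  move=> w _ k _; rewrite (eq_big_nat _ _ (F2 := fun=> 1)); last first.
    by move=> j /andP[j0 _]; rewrite x1// expr1n.
  rewrite sumr_const_nat subn1 /=.
  have := mulr_ge0 (ltW e0) (ler0n R k); lra.
have mf : measurable_fun [set: R] (fun y : R => y ^+ 2) by exact: measurable_funX.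
have [|B [mB PB hB]] := @sum_squares_bad_event R d T P xi (fun y => y ^+ 2) e n hX mf _ e01.
  by move=> j t j0 t2; rewrite -(standard_gaussian_expR_sqr (gX j j0) t2).
by exists B; split.
Qed.

Lemma exists_nat_ceil (x : R) : 0 <= x -> exists n : nat, x <= n%:R < x + 1.
Proof.
move=> x0; have h1 : (Num.truncn x)%:R <= x by rewrite truncn_le.
have h2 : x < (Num.truncn x).+1%:R by rewrite truncnS_gt.
have [xE|xn] := eqVneq x (Num.truncn x)%:R.
  by exists (Num.truncn x); rewrite -xE lexx ltrDl ltr01.
exists (Num.truncn x).+1; rewrite (ltW h2) -natr1 ltrD2r/=.
by rewrite lt_neqAle h1 eq_sym xn.
Qed.

(** The budget is 4 v with v <= 1/4. For signal and for noise the upper tail costs v and the lower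
    tail at most 3/4 v, in total 7/2 v. The finer control of the signal from n1 on, used for s > 3/5
    only, has to fit into the remaining v / 2. *)
Lemma good_event (q z La : R) (n0 : nat) :
  0 < q -> 0 < z -> 100 <= La -> La <= n0%:R ->
  4 * expR (- (La * (4^-1 - ln (1 + 4^-1)) / 2)) <= 1 ->
  exists B : set T, [/\ measurable B,
    (P B <= (4 * expR (- (La * (4^-1 - ln (1 + 4^-1)) / 2)))%:E)%E &
    forall w, ~ B w -> [/\ sumsq_near 4^-1 n0 (fun j => xi j w),
      sumsq_near 4^-1 n0 (fun j => Z (u j) w) &
      q / z <= 3 / 5 \/ (3 / 5 <= q / z /\ exists n1,
        sumsq_near (6 * (1 + q / z))^-1 n1 (fun j => xi j w) /\
        La `^ (1 + q / z) <= n1%:R < La `^ (1 + q / z) + 1)]].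
Proof.
move=> q0 z0 La100 La0 v4; set rho := 4^-1 - ln (1 + 4^-1) in v4 *.
set v := expR _ in v4 *.
have v0 : 0 < v by rewrite expR_gt0.
have /andP[rho0 rho1] := rate_quarter_upper (R := R); rewrite -/rho in rho0 rho1.
have n00 : 0 <= n0%:R :> R by rewrite ler0n.
have Lp : 0 < La by rewrite (lt_le_trans _ La100).
have e14 : 0 < (4^-1 : R) < 1.
  by apply/andP; split; [rewrite invr_gt0 ltr0n|rewrite invf_lt1 ?ltr1n ?ltr0n].
have b1 : expR (- (n0%:R * (rho / 2))) <= v.
  by rewrite ler_expR lerN2 -mulrA ler_wpM2r// divr_ge0 ?ler0n.
have b2 : expR (- (n0%:R * ((- 4^-1 - ln (1 - 4^-1)) / 2))) <= 3 / 4 * v.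
  have h := rate_quarter_lower (R := R); rewrite -/rho in h.
  (* This is the fourth root of v, and v <= 1/4 <= (3/4)^4. *)
  have w34 : expR (- (La * rho / 8)) <= 3 / 4.
    have e4 : v = expR (- (La * rho / 8)) ^+ 4.
      by rewrite /v -expRM_natl; congr expR; field.
    rewrite -(@ler_pXn2r _ 4)// ?nnegrE ?expR_ge0 ?divr_ge0 ?ler0n// -e4; lra.
  apply: (@le_trans _ _ (expR (- (La * rho / 8)) * v)); last by rewrite ler_wpM2r// ltW.
  rewrite /v -expRD ler_expR -[X in _ <= X]opprD lerN2.
  have -> : La * rho / 8 + La * rho / 2 = La * (5 / 4 * rho / 2) by field.
  apply: ler_pM => //; [exact: ltW|by rewrite !mulr_ge0 ?invr_ge0 ?ler0n|].
  by rewrite ler_pM2r ?invr_gt0 ?ltr0n.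
have [B1 [mB1 PB1 hB1]] := signal_bad_event n0 e14.
have [B2 [mB2 PB2 hB2]] := noise_bad_event n0 e14.
have fine2 (a b : R) : a <= v -> b <= 3 / 4 * v -> ((a + b)%:E <= (7 / 4 * v)%:E)%E.
  by move=> ha hb; rewrite lee_fin; lra.
have PB1' := le_trans PB1 (fine2 _ _ b1 b2).
have PB2' := le_trans PB2 (fine2 _ _ b1 b2).
have PB12 : (P (B1 `|` B2) <= (7 / 2 * v)%:E)%E.
  apply: (le_trans (measureU2 _ mB1 mB2)).
  have -> : 7 / 2 * v = 7 / 4 * v + 7 / 4 * v by field.
  by rewrite EFinD; exact: leeD.
have mB12 : measurable (B1 `|` B2) by exact: measurableU.
have [s35|s35] := leP (q / z) (3 / 5).
  exists (B1 `|` B2); split => //.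
    by apply: (le_trans PB12); rewrite lee_fin; lra.
  by move=> w; rewrite not_orP => -[/hB1 h1 /hB2 h2]; split => //; left.
have s35' := ltW s35; set s := q / z in s35 s35' *.
have D0 : 0 <= La `^ (1 + s) by exact: powR_ge0.
have [n1 /andP[Dn1 n1D]] := exists_nat_ceil D0.
set e := (6 * (1 + s))^-1.
have w0 : 0 < 6 * (1 + s) by lra.
have e0 : 0 < e by rewrite invr_gt0.
have e48 : e <= 5 / 48.
  have -> : 5 / 48 = (48 / 5)^-1 :> R by rewrite invf_div.
  by rewrite lef_pV2 ?posrE//; lra.
have e01 : 0 < e < 1 by apply/andP; split; lra.
have e02 : 0 <= e < 1 by apply/andP; split; lra.
have [B3 [mB3 PB3 hB3]] := signal_bad_event n1 e01.
(* n1 >= Lambda^(1 + s) and (12/5)^2 * 7/20 / 36 = 7/125 >= 2/36 >= 2 rho. The exponent is at least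
   twice that of v, and v^2 <= v / 4. *)
have eD : La * (2 * rho) <= n1%:R * (7 / 20 * e ^+ 2).
  apply: (@le_trans _ _ (La `^ (1 + s) * (7 / 20 * e ^+ 2))); last first.
    by rewrite ler_wpM2r// mulr_ge0 ?sqr_ge0 ?divr_ge0 ?ler0n.
  rewrite (gt0_powRD 1 s Lp) (powRr1 (ltW Lp)) -mulrA ler_pM2l//.
  have h1 := powR_100_ge s35'.
  have h2 : 100 `^ s <= La `^ s.
    have p100 : 0 <= 100 :> R by rewrite ler0n.
    apply: ge0_ler_powR; rewrite ?nnegrE ?p100 ?(ltW Lp) ?(le_trans _ s35')//.
  have h3 : 0 <= 7 / 20 * e ^+ 2 by rewrite mulr_ge0 ?sqr_ge0 ?divr_ge0 ?ler0n.
  apply: le_trans (ler_wpM2r h3 (le_trans h1 h2)).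
  have -> : (12 / 5 * (1 + s)) ^+ 2 * (7 / 20 * e ^+ 2) = 7 / 125.
    have w1 : 1 + s != 0 by rewrite lt0r_neq0 //; lra.
    by rewrite /e; move: (1 + s) w1 => t tn; field.
  by lra.
have small c : 7 / 20 * e ^+ 2 <= c -> expR (- (n1%:R * (c / 2))) <= v / 4.
  move=> hc; apply: (@le_trans _ _ (v * v)).
    rewrite /v -expRD ler_expR -opprD lerN2.
    have n10 : 0 <= n1%:R :> R by rewrite ler0n.
    by have := ler_wpM2l n10 hc; move: eD; lra.
  by have := ler_wpM2l (ltW v0) v4; lra.
have c1 : expR (- (n1%:R * ((e - ln (1 + e)) / 2))) <= v / 4.
  by apply: small; apply: chi_rate_upper; rewrite (ltW e0).
have c2 : expR (- (n1%:R * ((- e - ln (1 - e)) / 2))) <= v / 4.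
  by apply: small; have := chi_rate_lower e02; have := sqr_ge0 e; lra.
have PB3' : (P B3 <= (2^-1 * v)%:E)%E.
  by apply: (le_trans PB3); rewrite lee_fin; lra.
exists (B1 `|` B2 `|` B3); split; first exact: measurableU.
  apply: (le_trans (measureU2 _ mB12 mB3)).
  have -> : 4 * v = 7 / 2 * v + 2^-1 * v by field.
  by rewrite EFinD; exact: leeD.
move=> w; rewrite not_orP not_orP => -[[/hB1 h1 /hB2 h2] /hB3 h3]; split => //; right.
by split => //; exists n1; split => //; rewrite Dn1.
Qed.

End good_event_theorem.

(** * Explicit values of the constants *)

Section constants_values.
Context {R : realType}.
Variables q eta : R.
Hypotheses (hq : 0 < q) (heta : 1 < eta).
Local Notation z := (eta - 1).

Let z0 : 0 < z. Proof. by rewrite subr_gt0. Qed.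
Let P0 : 0 < q + z. Proof. by rewrite addr_gt0. Qed.
Let r0 : 0 < q + eta. Proof. by rewrite addr_gt0// (lt_trans ltr01). Qed.
Let p2 : 0 < 2 :> R. Proof. by rewrite ltr0n. Qed.
Let p324 : 0 < 324 :> R. Proof. by rewrite ltr0n. Qed.

Lemma eps'E : eps' = 2^-1 :> R.
Proof.
rewrite /eps' /eps; have -> : 1 - 3 * (1 / 4) = 2^-1 ^+ 2 :> R by field.
by rewrite sqrtr_sqr ger0_norm ?invr_ge0 ?ler0n//; field.
Qed.

(** With eps' = 1/2 the bases are 6 and 12 sqrt 3. The second entry is the maximum, as 432 = (12
    sqrt 3)^2 exceeds 36 and 1/q exceeds 1 / (q + eta). *)
Lemma constAE : constA q eta = 432 `^ q^-1.
Proof.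
have a0 : 0 <= 12 * Num.sqrt 3 :> R by rewrite mulr_ge0 ?ler0n ?sqrtr_ge0.
have p6 : 0 < 6 :> R by rewrite ltr0n.
rewrite /constA eps'E.
have -> : 4 * Num.sqrt 3 * (1 + 2^-1) / (1 - 2^-1) = 12 * Num.sqrt 3 :> R by field.
have -> : 2 * (1 + 2^-1) / (1 - 2^-1) = 6 :> R by field.
have -> : (12 * Num.sqrt 3) `^ (2 / q) = 432 `^ q^-1 :> R.
  rewrite powRrM (powR_mulrn 2 a0) exprMn sqr_sqrtr ?ler0n//.
  by congr (_ `^ _); ring.
rewrite max_r// powRrM (powR_mulrn 2 (ltW p6)).
apply: (@le_trans _ _ (432 `^ (q + eta)^-1)).
  apply: ge0_ler_powR; rewrite ?nnegrE ?invr_ge0 ?(ltW r0) ?sqr_ge0 ?ler0n//; lra.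
apply: ler_powR; first by rewrite ler1n.
by rewrite lef_pV2 ?posrE// lerDl (le_trans ler01)// ltW.
Qed.

Lemma constaE : consta q eta = (324 * 2 `^ (q + z)) `^ (- (q + z)^-1).
Proof.
have s2 : 0 <= Num.sqrt 2 :> R by exact: sqrtr_ge0.
rewrite /consta eps'E.
have -> : 3 * Num.sqrt 2 * (1 + 2^-1) / (1 - 2^-1) = 9 * Num.sqrt 2 :> R by field.
have -> : 2 / (1 - q - eta) = 2 * (- (q + z)^-1).
  by rewrite -invrN; congr (_ / _); ring.
have b0 : 0 <= 2 `^ ((q + eta) / 2) * (9 * Num.sqrt 2) :> R.
  by rewrite !mulr_ge0 ?powR_ge0 ?ler0n.
rewrite [LHS]powRrM (powR_mulrn 2 b0); congr (_ `^ _).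
rewrite exprMn -(powR_mulrn 2 (powR_ge0 _ _)) -powRrM exprMn sqr_sqrtr ?ler0n//.
have -> : (q + eta) / 2 * 2%:R = q + z + 1 by field.
by rewrite (gt0_powRD (q + z) 1 p2) (powRr1 (ltW p2)); ring.
Qed.

Let base0 : 0 < 324 * 2 `^ (q + z) :> R.
Proof. by rewrite (mulr_gt0 p324) ?powR_gt0. Qed.

Lemma consta_gt0 : 0 < consta q eta.
Proof. by rewrite constaE powR_gt0. Qed.

Lemma sqr_consta : (consta q eta `^ (- (eta / 2))) ^+ 2 =
  2 `^ (1 + z) * 324 `^ ((1 + z) / (q + z)).
Proof.
rewrite -(powR_mulrn 2 (powR_ge0 _ _)) -powRrM constaE -powRrM.
have -> : - (q + z)^-1 * (- (eta / 2) * 2%:R) = (1 + z) / (q + z).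
  by field; rewrite gt_eqF.
rewrite (powRM _ (ltW p324) (powR_ge0 _ _)) -powRrM mulrC; congr (_ `^ _ * _).
by field; rewrite gt_eqF.
Qed.

Lemma constC_ge0 : 0 <= constC q eta.
Proof.
rewrite /constC eps'E !mulr_ge0 ?sqrtr_ge0 ?addr_ge0 ?invr_ge0 ?ler0n ?sqrtr_ge0//.
by rewrite mulr_ge0 ?powR_ge0 ?sqrtr_ge0.
Qed.

Lemma sqr_constC : constC q eta ^+ 2 =
  9 / 4 * (Num.sqrt (constA q eta `^ (1 + q)) +
    consta q eta `^ (- (eta / 2)) * Num.sqrt (eta / (eta - 1))) ^+ 2 *
  Num.max 1 (z * 4 `^ z).
Proof.
rewrite /constC eps'E !exprMn [X in _ * X](sqr_sqrtr _).
  by congr (_ * _ * _); field.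
by rewrite le_max ler01.
Qed.

Lemma sqr_sqrt_constA : Num.sqrt (constA q eta `^ (1 + q)) ^+ 2 = 432 `^ (1 + q^-1).
Proof.
rewrite sqr_sqrtr ?powR_ge0// constAE -powRrM; congr (_ `^ _).
by field; rewrite gt_eqF.
Qed.

Lemma sqr_sqrt_eta : Num.sqrt (eta / (eta - 1)) ^+ 2 = 1 + z^-1.
Proof.
rewrite sqr_sqrtr ?divr_ge0 ?(ltW z0) ?(le_trans ler01 (ltW heta))//.
by field; rewrite gt_eqF.
Qed.

Variable delta : R.
Hypothesis delta0 : 0 < delta.
Let ka := delta `^ (- (2 / (q + eta))).
Let La := consta q eta * ka `^ (z / (q + z)).

Lemma scale_delta : delta ^+ 2 = ka `^ (- (q + z + 1)).
Proof.
rewrite -(powR_mulrn 2 (ltW delta0)) /ka -powRrM; congr (_ `^ _).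
have -> : q + z + 1 = q + eta by ring.
by field; rewrite gt_eqF.
Qed.

Let ka0 : 0 < ka. Proof. exact: powR_gt0. Qed.

Lemma scale_La : ka = 324 `^ z^-1 * 2 `^ (1 + q / z) * La `^ (1 + q / z).
Proof.
have zn := gt_eqF z0; have Pn := gt_eqF P0.
rewrite /La (powRM _ (ltW consta_gt0) (powR_ge0 _ _)) -[(ka `^ _) `^ _]powRrM.
have -> : z / (q + z) * (1 + q / z) = 1 by field; rewrite zn Pn.
rewrite (powRr1 (ltW ka0)) constaE -powRrM.
have -> : - (q + z)^-1 * (1 + q / z) = - z^-1 by field; rewrite zn Pn.
rewrite powRN (powRM _ (ltW p324) (powR_ge0 _ _)) -powRrM.
have -> : (q + z) / z = 1 + q / z by field; rewrite zn.
have h1 : 324 `^ z^-1 != 0 :> R by rewrite gt_eqF// powR_gt0.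
have h2 : 2 `^ (1 + q / z) != 0 :> R by rewrite gt_eqF// powR_gt0.
by move: h1 h2; move: (324 `^ _) (2 `^ _) => A B h1 h2; field; rewrite h1 h2.
Qed.

Lemma scale_rate : constp q eta * delta `^ (2 * (1 - eta) / ((q + eta - 1) * (q + eta))) =
  La * (4^-1 - ln (1 + 4^-1)) / 2.
Proof.
rewrite /constp /eps div1r /La /ka -powRrM.
have -> : - (2 / (q + eta)) * (z / (q + z)) = 2 * (1 - eta) / ((q + eta - 1) * (q + eta)).
  have rn := gt_eqF r0; have Pn : q + eta - 1 != 0 by rewrite -addrA gt_eqF.
  have -> : q + z = q + eta - 1 by rewrite addrA.
  by field; rewrite rn Pn.
ring.
Qed.

(** For rho = 1/4 - ln (5/4) one has exp rho = 4/5 exp (1/4), and rational bounds give exp (50 rho)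
    <= 4. Thus Lambda < 100 occurs only when the probability bound is vacuous. *)
Lemma scale_La_ge : 4 * expR (- (La * (4^-1 - ln (1 + 4^-1)) / 2)) < 1 -> 100 <= La.
Proof.
move=> h; rewrite leNgt; apply/negP => La100.
have /andP[rho0 _] := rate_quarter_upper (R := R).
set rho := 4^-1 - ln (1 + 4^-1) in h rho0.
have e1 : expR rho <= 4 / 5 * (17 / 15) ^+ 2.
  have p54 : 0 < 1 + 4^-1 :> R by rewrite addr_gt0 ?ltr01 ?invr_gt0 ?ltr0n.
  rewrite /rho expRD expRN lnK ?posrE//.
  have -> : (1 + 4^-1)^-1 = 4 / 5 :> R by field.
  rewrite mulrC ler_wpM2l ?divr_ge0 ?ler0n//.
  have -> : 4^-1 = 2%:R * 8^-1 :> R by field.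
  rewrite expRM_natl ler_pXn2r ?nnegrE ?expR_ge0 ?divr_ge0 ?ler0n//.
  by apply: expR_le_frac; lra.
have e2 : expR rho ^+ 5 <= 47 / 41.
  apply: (@le_trans _ _ ((4 / 5 * (17 / 15) ^+ 2) ^+ 5)); last lra.
  by rewrite ler_pXn2r ?nnegrE ?expR_ge0 ?mulr_ge0 ?exprn_ge0 ?divr_ge0 ?ler0n.
have e3 : (expR rho ^+ 5) ^+ 5 <= 99 / 50.
  apply: (@le_trans _ _ ((47 / 41) ^+ 5)); last lra.
  by rewrite ler_pXn2r ?nnegrE ?exprn_ge0 ?expR_ge0 ?divr_ge0 ?ler0n.
have e4 : expR (50 * rho) <= 4.
  have -> : 50 * rho = 2%:R * (5%:R * (5%:R * rho)) by ring.
  rewrite !expRM_natl; apply: (@le_trans _ _ ((99 / 50) ^+ 2)); last lra.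
  by rewrite ler_pXn2r ?nnegrE ?exprn_ge0 ?expR_ge0 ?divr_ge0 ?ler0n.
have : expR (La * rho / 2) <= 4.
  apply: le_trans e4; rewrite ler_expR.
  by have := ler_wpM2r rho0 (ltW La100); lra.
by rewrite expRN in h; move: h; rewrite ltr_pdivrMr ?expR_gt0// mul1r ltNge => /negP.
Qed.

End constants_values.

(** * The error as a limit of finite sums, and measurability *)

Section orthonormal_expansion.
Context {R : realType} {V : hilbertType R}.
Variables (v : nat -> V) (x : V).
Hypothesis ov : forall i j, (0 < i)%N -> (0 < j)%N -> '[v i, v j] = (i == j)%:R.
Hypothesis xv : (fun n => \sum_(1 <= j < n.+1) '[x, v j] *: v j) @ \oo --> x.

(** Convergence of finite sums is the form that serves both later uses: measurability of the error
    and its bounds by partial sums. *)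
Lemma cvg_sqr_norm_sub (b : nat -> R) (k : nat) :
  (fun n => \sum_(1 <= j < k.+1) (b j - '[x, v j]) ^+ 2 +
    \sum_(k.+1 <= j < n.+1) '[x, v j] ^+ 2) @ \oo -->
  `|\sum_(1 <= j < k.+1) b j *: v j - x| ^+ 2.
Proof.
set s := \sum_(1 <= j < k.+1) b j *: v j.
have c1 : (fun n => `|s - \sum_(1 <= j < n.+1) '[x, v j] *: v j|) @ \oo --> `|s - x|.
  by apply: cvg_norm; apply: cvgB => //; exact: cvg_cst.
rewrite expr2; apply: cvg_trans (cvgM c1 c1); apply: near_eq_cvg; near=> n.
have kn : (k <= n)%N by near: n; exact: nbhs_infty_ge.
pose a j := if (j <= k)%N then b j - '[x, v j] else - '[x, v j].
have E (W : nmodType) (f : nat -> R -> W) : \sum_(1 <= j < n.+1) f j (a j) =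
    \sum_(1 <= j < k.+1) f j (b j - '[x, v j]) + \sum_(k.+1 <= j < n.+1) f j (- '[x, v j]).
  rewrite (@big_cat_nat _ _ _ k.+1)//=; congr (_ + _); apply: eq_big_nat => j /andP[h1 h2].
    by rewrite /a -ltnS h2.
  by rewrite /a leqNgt h1.
have sE : s - \sum_(1 <= j < n.+1) '[x, v j] *: v j = \sum_(1 <= j < n.+1) a j *: v j.
  rewrite (E _ (fun j c => c *: v j)) (@big_cat_nat _ _ _ k.+1 1 n.+1)//= opprD addrA.
  congr (_ + _).
    by rewrite /s -sumrB; apply: eq_bigr => j _; rewrite scalerBl.
  by rewrite -sumrN; apply: eq_bigr => j _; rewrite scaleNr.
transitivity (`|\sum_(1 <= j < n.+1) a j *: v j| ^+ 2); first by rewrite -sE expr2.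
rewrite norm_sum_orthonormal ?iota_uniq//; last first.
  move=> i j; rewrite !mem_index_iota => /andP[i0 _] /andP[j0 _]; exact: ov.
rewrite (E _ (fun j c => c ^+ 2)); congr (_ + _).
by apply: eq_bigr => j _; rewrite sqrrN.
Unshelve. all: by end_near. Qed.

End orthonormal_expansion.

Lemma argmin_exists (R : realType) (f : nat -> R) (K : nat) :
  (forall k, (K <= k)%N -> f 1%N <= f k) ->
  exists k, is_argmin [set k | (1 <= k)%N] f k.
Proof.
move=> fK; have i1 : (1 < K.+2)%N by [].
pose i0 : 'I_K.+2 := Ordinal i1.
have [i i_gt0 imin] := @arg_minP _ _ _ i0 (fun i : 'I_K.+2 => (0 < i)%N) (fun i => f i) isT.
exists i; split => //= l l1; have [lK|Kl] := leqP K l; last first.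
  have lK : (l < K.+2)%N by rewrite ltnW// ltnW.
  exact: (imin (Ordinal lK) l1).
by apply: le_trans (fK l lK); exact: (imin i0 isT).
Qed.

(** The event quantifies over natural numbers only, hence is a countable combination of measurable
    sets; measurability is needed to compare its probability with that of the good event by
    inclusion. *)
Lemma measurable_oracle_event d (T : measurableType d) (R : realType)
    (E : nat -> T -> R) (kHDm : nat -> T -> nat) (C : R) :
  (forall k, measurable_fun [set: T] (E k)) ->
  (forall m, (2 <= m)%N -> measurable_fun [set: T] (kHDm m)) ->
  measurable [set w | exists kHD kopt : nat,
    [/\ is_max [set kHDm m w | m in [set m | (2 <= m)%N]] kHD,
        is_argmin [set k | (1 <= k)%N] (fun k => E k w) kopt
      & E kHD w <= C * E kopt w]].
Proof.
move=> mE mk.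
have mle k l c : measurable [set w | E k w <= c * E l w].
  rewrite -[X in measurable X]setTI; apply: measurable_fun_le => //.
  by apply: measurable_funM.
have mpre m (A : set nat) : (2 <= m)%N -> measurable (kHDm m @^-1` A).
  by move=> m2; rewrite -[X in measurable X]setTI; exact: mk.
have -> : [set w | exists kHD kopt : nat,
    [/\ is_max [set kHDm m w | m in [set m | (2 <= m)%N]] kHD,
        is_argmin [set k | (1 <= k)%N] (fun k => E k w) kopt
      & E kHD w <= C * E kopt w]] =
  \bigcup_k \bigcup_(l in [set l | (1 <= l)%N])
    (((\bigcup_(m in [set m | (2 <= m)%N]) (kHDm m @^-1` [set k])) `&`
      (\bigcap_(m in [set m | (2 <= m)%N]) (kHDm m @^-1` [set i | (i <= k)%N]))) `&`
     (\bigcap_(i in [set i | (1 <= i)%N]) [set w | E l w <= 1 * E i w]) `&`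
     [set w | E k w <= C * E l w]).
  apply/seteqP; split => w /=.
    move=> [k [l [[[m m2 mw] hk] [l1 hl] kl]]]; exists k => //; exists l => //.
    split; [split; [split|]|] => //.
    - by exists m.
    - by move=> i i2; apply: hk; exists i.
    - by move=> i i1 /=; rewrite mul1r; exact: hl.
  move=> [k _ [l l1 [[[[m m2 mw] hk] hl] kl]]]; exists k, l; split => //.
    by split; [exists m|move=> _ [i i2 <-]; exact: hk].
  by split => // i i1; have := hl i i1; rewrite /= mul1r.
apply: bigcup_measurable => k _; apply: bigcup_measurable => l _.
apply: measurableI => //; apply: measurableI; first apply: measurableI.
- by apply: bigcup_measurable => m m2; exact: mpre.
- by apply: bigcap_measurable => [|m m2]; [exists 2%N|exact: mpre].
- by apply: bigcap_measurable => [|i i1]; [exists 1%N|].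
Qed.

Section squared_error.
Context (R : realType) (q z : R) (k : nat) (de : R) (x g : nat -> R) (e2 : R).
Let V := de ^+ 2 * \sum_(1 <= j < k.+1) j%:R `^ q * g j ^+ 2.
Let tail n := \sum_(k.+1 <= j < n) j%:R `^ (- (z + 1)) * x j ^+ 2.
Hypothesis cv : (fun n => V + tail n.+1) @ \oo --> e2.

Lemma partial_error_le n : V + tail n <= e2.
Proof.
have mono a b : (a <= b)%N -> tail a <= tail b.
  move=> ab; have [ak|ka] := leqP a k.+1.
    by rewrite /tail [leLHS]big_geq// sumr_ge0// => j _; rewrite mulr_ge0 ?powR_ge0 ?sqr_ge0.
  rewrite /tail [leRHS](@big_cat_nat _ _ _ a)//= ?(ltnW ka)// lerDl.
  by rewrite sumr_ge0// => j _; rewrite mulr_ge0 ?powR_ge0 ?sqr_ge0.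
rewrite -(cvg_lim _ cv)//; apply: limr_ge; first by apply/cvg_ex; exists e2.
by near=> i; rewrite lerD2l mono// leqW//; near: i; exact: nbhs_infty_ge.
Unshelve. all: by end_near. Qed.

Lemma error_le c : (forall n, V + tail n <= c) -> e2 <= c.
Proof.
move=> h; rewrite -(cvg_lim _ cv)//; apply: limr_le; first by apply/cvg_ex; exists e2.
by apply: nearW => i; exact: h.
Qed.

End squared_error.

Theorem theorem2p3 (R : realType) (X Y : hilbertType R)
    (K : {linear X -> Y}) (Kadj : Y -> X)
    (sigma : nat -> R) (v : nat -> X) (u : nat -> Y)
    (d : measure_display) (T : measurableType d) (P : probability T R)
    (q eta : R) (xdag : T -> X) (xi : nat -> {RV P >-> R})
    (Z : Y -> {RV P >-> R})
    (hX : infinite_dimensional X) (hY : infinite_dimensional Y)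
    (hK : compact_operator K) (hKadj : is_adjoint K Kadj)
    (hsvd : is_svd K Kadj sigma v u)
    (hq : 0 < q) (heta : 1 < eta)
    (hsigma : forall j, (0 < j)%N -> sigma j ^+ 2 = j%:R `^ (- q))
    (* x^dagger is a random element of N(K)^\perp *)
    (hxdag_meas : forall x, measurable_fun [set: T] (fun w => '[xdag w, x]))
    (hxdag_perp : forall w, ker_perp K (xdag w))
    (hxdag_coef : {ae P, forall w, forall j, (0 < j)%N ->
       '[xdag w, v j] = j%:R `^ (- (eta / 2)) * xi j w})
    (hxi : (forall j w, (0 < j)%N -> xi j w = 1) \/
           iid_standard_gaussian [set j | (0 < j)%N] xi)
    (hZ : gaussian_white_noise Z) :
  forall delta : R, 0 < delta <= 1 ->
  let ydelta := noisy_data (K \o xdag) delta (fun y => Z y) in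
  let err k w := `|spectral_cutoff sigma v u (ydelta w) k - xdag w| in
  forall kHDm : nat -> T -> nat, heuristic_rule sigma u ydelta kHDm ->
  let event := [set w | exists kHD kopt : nat,
    [/\ is_max [set kHDm m w | m in [set m | (2 <= m)%N]] kHD,
        is_argmin [set k | (1 <= k)%N] (fun k => err k w) kopt
      & err kHD w <= constC q eta * err kopt w]] in
  ((1 - 4 * expR (- (constp q eta *
      delta `^ (2 * (1 - eta) / ((q + eta - 1) * (q + eta))))))%:E <=
   P event)%E.
Proof.
move=> delta /andP[d0 d1]; cbv zeta; set ydelta := noisy_data _ _ _.
pose err k w := `|spectral_cutoff sigma v u (ydelta w) k - xdag w|.
move=> kHDm hrule; set event := [set w | _].
have [[[_ ov xv] [_ ou _]] smono slim Kv Ku] := hsvd.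
pose z := eta - 1; have z0 : 0 < z by rewrite subr_gt0.
have etaE : eta = z + 1 by rewrite /z subrK.
pose ka := delta `^ (- (2 / (q + eta))).
pose La := consta q eta * ka `^ (z / (q + z)).
(* Only sigma_j^2 is prescribed; the sign follows from the decrease to 0. *)
have sge0 j : (0 < j)%N -> 0 <= sigma j.
  move=> j0; rewrite -(cvg_lim (@Rhausdorff R) slim).
  apply: limr_le; first by apply/cvg_ex; exists 0.
  by near=> n; apply: smono; rewrite j0/=; near: n; exact: nbhs_infty_ge.
have sE j : (0 < j)%N -> sigma j = j%:R `^ (- (q / 2)).
  move=> j0; apply/eqP; rewrite -(@eqrXn2 _ 2)// ?sge0 ?powR_ge0//.
  rewrite hsigma// -(powR_mulrn 2 (powR_ge0 _ _)) -powRrM; apply/eqP; congr (_ `^ _).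
  by field.
have sgt0 j : (0 < j)%N -> 0 < sigma j.
  by move=> j0; rewrite sE// powR_gt0// ltr0n.
have yE w j : (0 < j)%N ->
    ydelta w (u j) = sigma j * '[xdag w, v j] + delta * Z (u j) w.
  by move=> j0; rewrite /ydelta /noisy_data /= hKadj Ku// innerZr.
have errcv k w : (fun n => \sum_(1 <= j < k.+1) (delta * Z (u j) w / sigma j) ^+ 2 +
    \sum_(k.+1 <= j < n.+1) '[xdag w, v j] ^+ 2) @ \oo --> err k w ^+ 2.
  have := @cvg_sqr_norm_sub _ _ v (xdag w) ov (xv _ (hxdag_perp w)) (fun j => ydelta w (u j) / sigma j) k.
  rewrite (eq_big_nat _ _ (F2 := fun j => (delta * Z (u j) w / sigma j) ^+ 2)); first exact.
  move=> j /andP[j0 _]; rewrite yE//; congr (_ ^+ 2).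
  by field; rewrite gt_eqF ?sgt0.
have merr k : measurable_fun [set: T] (err k).
  (* [xdag] is measurable through its inner products only, so the error is reached as the square
     root of a limit of measurable functions. *)
  have -> : err k = (fun w => (err k w ^+ 2) `^ 2^-1).
    by apply/funext => w; rewrite powR12_sqrt ?sqr_ge0// sqrtr_sqr /err normr_id.
  apply: (measurableT_comp (measurable_powR _)).
  apply: measurable_fun_cvg (fun w _ => errcv k w) => n.
  apply: measurable_funD; apply: measurable_sum => j.
    by apply: measurable_funX; apply: measurable_funM => //; exact: measurable_funM.
  by apply: measurable_funX; exact: hxdag_meas.
have mkHD m : (2 <= m)%N -> measurable_fun [set: T] (kHDm m) by case/hrule.
have mevent : measurable event by exact: measurable_oracle_event merr mkHD.
rewrite (scale_rate hq heta delta) -/z -/ka -/La.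
set v4 := 4 * expR _.
(* If 4 v >= 1 the claimed lower bound is nonpositive. *)
have [v1|v1] := leP 1 v4.
  by apply: le_trans (measure_ge0 _ _); rewrite lee_fin subr_le0.
have La100 : 100 <= La by exact: (scale_La_ge (q := q) (eta := eta) (delta := delta)).
have kaE := scale_La hq heta d0; rewrite -/z -/ka -/La in kaE.
have de2 := scale_delta hq heta d0; rewrite -/z -/ka in de2.
have [n0 /andP[n0La n0La1]] := exists_nat_ceil (le_trans (ler0n R 100) La100).
have n0b : La <= n0%:R <= La + 1 by rewrite n0La ltW.
have [B [mB PB hB]] := good_event hZ ou hxi hq z0 La100 n0La (ltW v1).
have [A [mA PA hA]] := hxdag_coef.
have PBA : (P (B `|` A) <= v4%:E)%E.
  apply: (le_trans (measureU2 _ mB mA)); rewrite [X in (_ + X)%E](_ : _ = 0%E); first by rewrite adde0.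
  exact: PA.
apply: (@le_trans _ _ (P (~` (B `|` A)))).
  rewrite probability_setC; last exact: measurableU.
  by rewrite EFinB leeB.
apply: le_measure; rewrite ?inE//; first by apply: measurableC; exact: measurableU.
move=> w; rewrite /= not_orP => -[nB nA].
have coef j : (0 < j)%N -> '[xdag w, v j] = j%:R `^ (- (eta / 2)) * xi j w.
  by move: j; apply: contrapT => h; apply: nA; apply: hA => /= h'; exact: h.
have [nx ng cases] := hB w nB.
set x := fun j => xi j w in nx cases; set g := fun j => Z (u j) w in ng.
have yn j : (0 < j)%N -> ydelta w (u j) = noisy_coef (q + z + 1) delta x g j.
  move=> j0; rewrite yE// sE// coef// /noisy_coef mulrA -gt0_powRD ?ltr0n//.
  by congr (_ `^ _ * _ + _); rewrite etaE; field.
have adm m : (2 <= m)%N -> (0 < kHDm m w)%N /\ (2 * kHDm m w <= m)%N.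
  by move=> m2; have [_ /(_ w)[[]]] := hrule m m2.
have sq m k : (0 < k)%N -> Psi sigma u m k (ydelta w) ^+ 2 =
    k%:R `^ q * \sum_(k <= j < m.+1) noisy_coef (q + z + 1) delta x g j ^+ 2.
  move=> k0; rewrite /Psi exprMn sqr_sqrtr; last by apply: sumr_ge0 => j _; exact: sqr_ge0.
  rewrite exprVn hsigma// powRN invrK; congr (_ * _).
  by apply: eq_big_nat => j /andP[kj _]; rewrite yn// (leq_trans k0).
have Psi0 m k : (0 < k)%N -> 0 <= Psi sigma u m k (ydelta w).
  by move=> k0; rewrite /Psi mulr_ge0 ?invr_ge0 ?sge0 ?sqrtr_ge0.
have kmin m k : (2 <= m)%N -> (0 < k)%N -> (2 * k <= m)%N ->
  (kHDm m w)%:R `^ q * (\sum_(kHDm m w <= j < m.+1) noisy_coef (q + z + 1) delta x g j ^+ 2) <=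
  k%:R `^ q * (\sum_(k <= j < m.+1) noisy_coef (q + z + 1) delta x g j ^+ 2).
  move=> m2 k0 km; have [l0 _] := adm m m2; rewrite -!sq//.
  rewrite ler_pXn2r ?nnegrE ?Psi0//.
  by have [_ /(_ w)[_]] := hrule m m2; apply; split.
have cv k : (fun n => delta ^+ 2 * (\sum_(1 <= j < k.+1) j%:R `^ q * g j ^+ 2) +
    \sum_(k.+1 <= j < n.+1) j%:R `^ (- (z + 1)) * x j ^+ 2) @ \oo --> err k w ^+ 2.
  have := errcv k w; rewrite mulr_sumr.
  rewrite (eq_big_nat _ _ (F2 := fun j => delta ^+ 2 * (j%:R `^ q * g j ^+ 2))); last first.
    move=> j /andP[j0 _]; rewrite !exprMn exprVn hsigma// powRN invrK /g; ring.
  rewrite (_ : (fun n => _ + \sum_(k.+1 <= j < n.+1) '[xdag w, v j] ^+ 2) =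
    (fun n => \sum_(1 <= j < k.+1) delta ^+ 2 * (j%:R `^ q * g j ^+ 2) +
      \sum_(k.+1 <= j < n.+1) j%:R `^ (- (z + 1)) * x j ^+ 2))//.
  apply/funext => n; congr (_ + _); apply: eq_big_nat => j /andP[kj _].
  rewrite coef ?(leq_trans _ kj)// exprMn -(powR_mulrn 2 (powR_ge0 _ _)) -powRrM.
  by congr (_ `^ _ * _); rewrite etaE; field.
have ege k n := partial_error_le (cv k) n.
have ele k c := @error_le _ _ _ k _ _ _ _ (cv k) c.
have [M hM] := kHD_bounded hq z0 La100 kaE de2 n0b nx ng adm kmin.
pose isk k := `[< exists2 m, (2 <= m)%N & kHDm m w = k >].
have exk : exists k, isk k by exists (kHDm 2%N w); apply/asboolP; exists 2%N.
have lek k : isk k -> (k <= M)%N by move=> /asboolP[m m2 <-]; exact: hM.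
have [kHD /asboolP[m m2 mk] kHDmax] := ex_maxnP exk lek.
have mmax m' : (2 <= m')%N -> (kHDm m' w <= kHDm m w)%N.
  by move=> m'2; rewrite mk; apply: kHDmax; apply/asboolP; exists m'.
have en k : 0 <= err k w by exact: normr_ge0.
have d20 : 0 < delta ^+ 2 by rewrite exprn_gt0.
(* From k1 on the noise alone exceeds the squared error at level 1, so that the oracle minimum is
   over finitely many levels. *)
pose k1 := maxn n0 (Num.truncn (err 1 w ^+ 2 / (delta ^+ 2 * (3 / 4)))).+1.
have [kopt hopt] : exists k, is_argmin [set k | (1 <= k)%N] (fun k => err k w) k.
  apply: (@argmin_exists _ _ k1) => k; rewrite geq_max => /andP[n0k Kk].
  rewrite -(@ler_pXn2r _ 2)// ?nnegrE//.
  have := noise_ge_linear hq La100 kaE de2 ng n0k; have := ege k 0%N.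
  rewrite (@big_geq _ _ _ k.+1 0)// addr0 => h1 /le_trans/(_ h1); apply: le_trans.
  have c0 : 0 < delta ^+ 2 * (3 / 4) by rewrite mulr_gt0// divr_gt0 ?ltr0n.
  rewrite mulrA -ler_pdivrMl// mulrC.
  by apply: (le_trans (ltW (truncnS_gt _))); rewrite ler_nat.
exists kHD, kopt; split => //.
  split; first by exists m.
  by move=> _ [m' m'2 <-]; rewrite -mk mmax.
have M1 : 1 <= Num.max 1 (z * 4 `^ z) by rewrite le_max lexx.
have M4 : z * 4 `^ z <= Num.max 1 (z * 4 `^ z) by rewrite le_max lexx orbT.
have := quasi_optimal hq z0 La100 kaE de2 n0b nx ng adm kmin ege ele kopt m2 mmax
  (sqrtr_ge0 _) (sqr_sqrt_constA hq heta) (powR_ge0 _ _) (sqr_consta hq heta)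
  (sqrtr_ge0 _) (sqr_sqrt_eta heta) M1 M4 cases.
rewrite mk -(sqr_constC q eta) -exprMn.
have Ce := mulr_ge0 (constC_ge0 q eta) (en kopt).
by rewrite (@ler_pXn2r _ 2)// ?nnegrE ?Ce ?en.
Unshelve. all: by end_near.
Qed.
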